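(* Let $U_1=\{\sigma+it\in\mathbb{C}:\alpha_1<\sigma<\beta_1\}$ and $U_2=\{\sigma+it\in\mathbb{C}:\alpha_2<\sigma<\beta_2\}$ with $U_1\cap U_2\neq\emptyset$. Let $\Lambda_1=\{\lambda_1,\lambda_2,\ldots\}$ and $\Lambda_2=\{\mu_1,\mu_2,\ldots\}$ be two countable sets of real numbers, each of which is linearly independent over $\mathbb{Q}$. Let $f_1\in AP(U_1,\mathbb{C})$ and $f_2\in AP(U_2,\mathbb{C})$ be two almost periodic functions whose sets of Fourier exponents are $\Lambda_1$ and $\Lambda_2$, respectively. Then $f_1$ and $f_2$ are Bohr-equivalent if and only if there exists a nonempty open interval $(\alpha,\beta)\subset(\alpha_1,\beta_1)\cap(\alpha_2,\beta_2)$ such that $$\bigcup_{\sigma\in E}\operatorname{Img}\left(f_1(\sigma+it)\right)=\bigcup_{\sigma\in E}\operatorname{Img}\left(f_2(\sigma+it)\right)$$ for every open set $E\subset(\alpha,\beta)$ of real numbers.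
   Context: Throughout $s=\sigma+it$ with $\sigma,t\in\mathbb{R}$, and $-\infty\le\alpha_k<\beta_k\le\infty$ for $k=1,2$. For an open vertical strip $U=\{\sigma+it:\alpha<\sigma<\beta\}$ ($-\infty\le\alpha<\beta\le\infty$), a reduced strip of $U$ is a set $\{\sigma+it:\sigma_1\le\sigma\le\sigma_2\}$ with $\alpha<\sigma_1\le\sigma_2<\beta$. $AP(U,\mathbb{C})$ is the set of analytic functions $f:U\to\mathbb{C}$ such that for every $\varepsilon>0$ and every reduced strip $K$ of $U$ there is $l>0$ such that every real interval of length $l$ contains a number $\tau$ with $|f(s+i\tau)-f(s)|\le\varepsilon$ for all $s\in K$. Dirichlet series and Fourier exponents: for $f\in AP(U,\mathbb{C})$ and $\lambda\in\mathbb{R}$, the Fourier coefficient is $a(\lambda)=\lim_{T\to\infty}\frac{1}{2T}\int_{-T}^{T}f(\sigma+it)e^{-\lambda(\sigma+it)}\,dt$, which exists and does not depend on $\sigma\in(\alpha,\beta)$. The set of $\lambda$ with $a(\lambda)\ne0$ is countable (finite or infinite); it is the set of Fourier exponents of $f$. The formal series $\sum_\lambda a(\lambda)e^{\lambda s}$ over this set is the Dirichlet series of $f$. Bohr-equivalence: let $\Lambda$ be a countable set of distinct reals and $V\subset\mathbb{R}$ the $\mathbb{Q}$-vector space generated by $\Lambda$. Two functions $a,b:\Lambda\to\mathbb{C}$ are Bohr-equivalent if there is a $\mathbb{Q}$-linear map $\psi:V\to\mathbb{R}$ such that $b(\lambda)=a(\lambda)e^{i\psi(\lambda)}$ for all $\lambda\in\Lambda$.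 Two almost periodic functions $f_1\in AP(U_1,\mathbb{C})$, $f_2\in AP(U_2,\mathbb{C})$ are Bohr-equivalent if their sets of Fourier exponents coincide, say both equal $\Lambda$, and their Fourier coefficient functions $\Lambda\to\mathbb{C}$ are Bohr-equivalent. Notation: $\operatorname{Img}(f(\sigma+it))=\{f(\sigma+it):t\in\mathbb{R}\}$ for fixed $\sigma$. *)

(* Defs.v *)
(* Stdlib reals with Coquelicot. *)
From Stdlib Require Export Reals QArith Qreals List.
From Coquelicot Require Export Coquelicot.
Open Scope R_scope.

(** Functions on a strip are total functions [C -> C]; every notion below
    depends only on the values in the strip [alpha < Re s < beta]. *)

Definition strip (alpha beta : Rbar) (s : C) : Prop :=
  Rbar_lt alpha (Re s) /\ Rbar_lt (Re s) beta.

Definition Cexp (z : C) : C :=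
  (exp (Re z) * cos (Im z), exp (Re z) * sin (Im z)).

(** Asking for [tau] inside the open interval [(x, x + l)] covers real intervals
    of length [l] of every kind. *)
Definition AP (alpha beta : Rbar) (f : C -> C) : Prop :=
  (forall s : C, strip alpha beta s ->
     @ex_derive C_AbsRing C_NormedModule f s) /\
  (forall (eps sigma1 sigma2 : R),
     0 < eps ->
     Rbar_lt alpha sigma1 -> sigma1 <= sigma2 -> Rbar_lt sigma2 beta ->
     exists l : R, 0 < l /\
       forall x : R, exists tau : R, x < tau < x + l /\
         forall s : C, sigma1 <= Re s <= sigma2 ->
           Cmod (f (s + Ci * RtoC tau) - f s)%C <= eps).

Definition fourier_mean (f : C -> C) (lambda sigma T : R) : C :=
  (RtoC (/ (2 * T)) *
   @RInt C_R_CompleteNormedModule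
     (fun t : R =>
        (f (sigma, t) * Cexp (- (RtoC lambda * (sigma, t))))%C) (- T) T)%C.

Definition is_fourier_coef (alpha beta : Rbar) (f : C -> C) (lambda : R)
    (a : C) : Prop :=
  forall sigma : R, Rbar_lt alpha sigma -> Rbar_lt sigma beta ->
    filterlim (fourier_mean f lambda sigma) (Rbar_locally p_infty)
      (@locally C_UniformSpace a).

(** Meaningful when the limit exists and is the same for all [sigma], which
    holds for [f] in [AP alpha beta] and [alpha < beta]. *)
Definition fourier_coef (alpha beta : Rbar) (f : C -> C) (lambda : R) : C :=
  @iota (CompleteNormedModule.CompleteSpace _ C_R_CompleteNormedModule) (is_fourier_coef alpha beta f lambda).

Definition fourier_exponent (alpha beta : Rbar) (f : C -> C) (lambda : R)
    : Prop :=
  fourier_coef alpha beta f lambda <> RtoC 0.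

Definition countable_set (L : R -> Prop) : Prop :=
  exists u : nat -> R, forall x : R, L x -> exists n : nat, u n = x.

Definition Qcomb (l : list (Q * R)) : R :=
  fold_right (fun p acc => Q2R (fst p) * snd p + acc) 0 l.

Definition Q_lin_indep (L : R -> Prop) : Prop :=
  forall l : list (Q * R),
    NoDup (map snd l) -> List.Forall L (map snd l) -> Qcomb l = 0 ->
    List.Forall (fun q : Q => (q == 0)%Q) (map fst l).

Definition Q_span (L : R -> Prop) (x : R) : Prop :=
  exists l : list (Q * R), List.Forall L (map snd l) /\ Qcomb l = x.

(** [psi] is only constrained on the subspace [V]; its other values are junk. *)
Definition Q_linear_on (V : R -> Prop) (psi : R -> R) : Prop :=
  (forall x y : R, V x -> V y -> psi (x + y) = psi x + psi y) /\
  (forall (q : Q) (x : R), V x -> psi (Q2R q * x) = Q2R q * psi x).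

Definition Bohr_equiv_coef (L : R -> Prop) (a b : R -> C) : Prop :=
  exists psi : R -> R, Q_linear_on (Q_span L) psi /\
    forall lambda : R, L lambda ->
      b lambda = (a lambda * Cexp (Ci * RtoC (psi lambda)))%C.

Definition Bohr_equiv (alpha1 beta1 : Rbar) (f1 : C -> C)
    (alpha2 beta2 : Rbar) (f2 : C -> C) : Prop :=
  (forall lambda : R,
     fourier_exponent alpha1 beta1 f1 lambda <->
     fourier_exponent alpha2 beta2 f2 lambda) /\
  Bohr_equiv_coef (fourier_exponent alpha1 beta1 f1)
    (fourier_coef alpha1 beta1 f1) (fourier_coef alpha2 beta2 f2).

Definition Img (f : C -> C) (sigma : R) (w : C) : Prop :=
  exists t : R, f (sigma, t) = w.

(* Main.v *)
(** On a vertical line a function [f] with linearly independent Fourier exponents [l] satisfies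
    Bohr's inequality [sum |a(l)| e^(l sigma) <= sup |f|], so its Dirichlet series converges
    absolutely; it represents [f] because a continuous almost periodic function all of whose
    Fourier coefficients vanish is zero.

    If [b(l) = a(l) e^(i psi(l))], Kronecker's theorem makes vertical translates of [f1] converge to
    [f2] uniformly on reduced strips, and by Hurwitz's theorem every value of [f2] at abscissa [sigma]
    is taken by [f1] at abscissas arbitrarily close to [sigma]; the relation is symmetric.

    Conversely the supremum of [|f|] on the line of abscissa [sigma] equals [sum |a(l)| e^(l sigma)],
    which is continuous in [sigma]. Equality of the images over all small open sets thus gives
    [sum |a(l)| e^(l sigma) = sum |b(l)| e^(l sigma)] on an interval. These two Dirichlet series
    coincide, hence [|a| = |b|], and by linear independence the phases [b / a] extend to a
    Q-linear map. *)

Require Import Defs.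
From Stdlib Require Import ZArith Lra Lia Classical ClassicalEpsilon.

(** Analyticity of [f1] and [f2] themselves serves for continuity and for Cauchy's theorem on
    rectangles, which makes the Fourier coefficients independent of the abscissa. Once a function is
    identified with its absolutely convergent Dirichlet series, Taylor's formula with remainder is
    proved term by term. It supplies the derivatives, the identity theorem and the local form
    $F(s+h)=F(s)+d\,h^k+O(h^{k+1})$ behind Hurwitz's theorem: where this form holds, $|F-w|$ can be
    lowered unless it is zero, so an interior minimum is a zero. Bohr's inequality does double duty.
    Applied to the given function it bounds the coefficient sums; applied to a finite sum of unit
    exponentials with prescribed phases it yields Kronecker's theorem. That vanishing coefficients
    force the zero function is reduced to Plancherel's identity on a finite cyclic group, by
    sampling over a long almost period. Independence also excludes the exponent $0$, so a series
    with a nonzero coefficient is nonconstant and has a leading term at every point. *)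

Definition cis (x : R) : C := (cos x, sin x).

Lemma C_ext (z w : C) : Re z = Re w -> Im z = Im w -> z = w.
Proof. destruct z, w; simpl; intros; subst; reflexivity. Qed.

Lemma RtoC_m1 : RtoC (-1) = (- RtoC 1)%C.
Proof. apply C_ext; simpl; ring. Qed.

Lemma im_le_Cmod (z : C) : Rabs (Im z) <= Cmod z.
Proof.
  apply Rle_trans with (2 := Rmax_Cmod z). apply Rmax_r.
Qed.

Lemma Cmod_le_re_im (z : C) : Cmod z <= Rabs (Re z) + Rabs (Im z).
Proof.
  replace z with (RtoC (Re z) + Ci * RtoC (Im z))%C at 1
    by (apply C_ext; simpl; unfold Re, Im; ring).
  eapply Rle_trans; [apply Cmod_triangle|].
  rewrite Cmod_mult, Cmod_Ci, !Cmod_R. lra.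
Qed.

Lemma re_bound (z : C) : Re z <= Cmod z.
Proof. apply Rle_trans with (2 := re_le_Cmod z). apply Rle_abs. Qed.

Lemma cis_plus (x y : R) : cis (x + y) = (cis x * cis y)%C.
Proof. apply C_ext; simpl; [apply cos_plus | rewrite sin_plus; ring]. Qed.

Lemma cis_0 : cis 0 = RtoC 1.
Proof. unfold cis. rewrite cos_0, sin_0. reflexivity. Qed.

Lemma Cmod_cis (x : R) : Cmod (cis x) = 1.
Proof.
  unfold Cmod, cis; simpl. transitivity (sqrt 1); [f_equal|apply sqrt_1].
  generalize (sin2_cos2 x); unfold Rsqr; intros; lra.
Qed.

Lemma cis_opp (x : R) : cis (- x) = Cconj (cis x).
Proof. unfold cis, Cconj; simpl. rewrite cos_neg, sin_neg; reflexivity. Qed.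

Lemma cis_opp_r (x : R) : (cis x * cis (- x))%C = RtoC 1.
Proof. rewrite <- cis_plus, Rplus_opp_r; apply cis_0. Qed.

Lemma Cexp_cis (z : C) : Cexp z = (RtoC (exp (Re z)) * cis (Im z))%C.
Proof. apply C_ext; simpl; ring. Qed.

Lemma Cexp_plus (z w : C) : Cexp (z + w) = (Cexp z * Cexp w)%C.
Proof.
  rewrite !Cexp_cis.
  change (Re (z + w)) with (Re z + Re w). change (Im (z + w)) with (Im z + Im w).
  rewrite exp_plus, cis_plus, RtoC_mult. ring.
Qed.

Lemma Cmod_Cexp (z : C) : Cmod (Cexp z) = exp (Re z).
Proof.
  rewrite Cexp_cis, Cmod_mult, Cmod_cis, Cmod_R, Rmult_1_r.
  apply Rabs_pos_eq, Rlt_le, exp_pos.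
Qed.

Lemma Cexp_line (l sigma t : R) :
  Cexp (RtoC l * (sigma, t)) = (RtoC (exp (l * sigma)) * cis (l * t))%C.
Proof.
  rewrite Cexp_cis.
  replace (Re (RtoC l * (sigma, t))) with (l * sigma) by (simpl; ring).
  replace (Im (RtoC l * (sigma, t))) with (l * t) by (simpl; ring).
  reflexivity.
Qed.

Lemma Cmod_triangle_sub (x y z : C) : Cmod (x - z) <= Cmod (x - y) + Cmod (y - z).
Proof.
  replace (x - z)%C with ((x - y) + (y - z))%C by ring. apply Cmod_triangle.
Qed.

Lemma Cmod_sub_sym (x y : C) : Cmod (x - y) = Cmod (y - x).
Proof. rewrite <- Cmod_opp. f_equal. ring. Qed.

Lemma Cmod_rev_triangle (x y : C) : Cmod x - Cmod y <= Cmod (x - y).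
Proof.
  assert (H : Cmod x <= Cmod (x - y) + Cmod y).
  { replace x with ((x - y) + y)%C at 1 by ring. apply Cmod_triangle. }
  lra.
Qed.

(** The angle is minus the argument of [z], found as plus or minus the arc cosine of the normalised
    real part. Rotating by it turns estimates of moduli of integrals, series and Taylor remainders
    into estimates of real parts, without loss of a constant. *)
Lemma unit_phase (z : C) : exists th : R, (cis th * z)%C = RtoC (Cmod z).
Proof.
  destruct (classic (z = RtoC 0)) as [->|Hz].
  { exists 0. rewrite Cmod_0. ring. }
  assert (Hm := proj1 (Cmod_gt_0 z) Hz).
  set (c := Re z / Cmod z). set (s := Im z / Cmod z).
  assert (Hcs : c ^ 2 + s ^ 2 = 1).
  { unfold c, s. assert (H := Cmod2_alt z). field_simplify; [|lra].
    rewrite <- H. field. lra. }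
  assert (Hc : -1 <= c <= 1) by nra.
  assert (Ex : exists th, cos th = c /\ sin th = s).
  { destruct (Rle_dec 0 s) as [Hs|Hs].
    - exists (acos c). split; [apply cos_acos; auto|].
      rewrite sin_acos; auto. replace (1 - Rsqr c) with (s * s) by (unfold Rsqr; lra).
      apply sqrt_square; auto.
    - exists (- acos c). rewrite cos_neg, sin_neg. split; [apply cos_acos; auto|].
      rewrite sin_acos; auto.
      replace (1 - Rsqr c) with ((- s) * (- s)) by (unfold Rsqr; lra).
      rewrite sqrt_square; lra. }
  destruct Ex as [th [H1 H2]].
  exists (- th). rewrite cis_opp. unfold cis. rewrite H1, H2.
  assert (Hz2 : z = (RtoC (Cmod z) * (c, s))%C).
  { apply C_ext; simpl; unfold c, s, Re, Im; field; lra. }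
  rewrite Hz2 at 1. apply C_ext; simpl; [|ring].
  replace (c * (Cmod z * c - 0 * s) - - s * (Cmod z * s + 0 * c)) with (Cmod z * (c ^ 2 + s ^ 2)) by ring.
  rewrite Hcs. ring.
Qed.

(** * Finite sums *)

Fixpoint Csum (n : nat) (F : nat -> C) : C :=
  match n with O => RtoC 0 | S m => (Csum m F + F m)%C end.

Fixpoint Rsum (n : nat) (F : nat -> R) : R :=
  match n with O => 0 | S m => Rsum m F + F m end.

Lemma Csum_ext n F G : (forall k, (k < n)%nat -> F k = G k) -> Csum n F = Csum n G.
Proof.
  induction n; simpl; intros H; auto. rewrite IHn, H by auto with arith. reflexivity.
Qed.

Lemma Rsum_ext n F G : (forall k, (k < n)%nat -> F k = G k) -> Rsum n F = Rsum n G.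
Proof.
  induction n; simpl; intros H; auto. rewrite IHn, H by auto with arith. reflexivity.
Qed.

Lemma Csum_plus n F G : Csum n (fun k => F k + G k)%C = (Csum n F + Csum n G)%C.
Proof. induction n; simpl; [ring|]. rewrite IHn. ring. Qed.

Lemma Rsum_plus n F G : Rsum n (fun k => F k + G k) = (Rsum n F + Rsum n G).
Proof. induction n; simpl; [ring|]. rewrite IHn. ring. Qed.

Lemma Csum_scal n c F : Csum n (fun k => c * F k)%C = (c * Csum n F)%C.
Proof. induction n; simpl; [ring|]. rewrite IHn. ring. Qed.

Lemma Rsum_scal n c F : Rsum n (fun k => c * F k) = (c * Rsum n F).
Proof. induction n; simpl; [ring|]. rewrite IHn. ring. Qed.

Lemma Csum_0 n F : (forall k, (k < n)%nat -> F k = RtoC 0) -> Csum n F = RtoC 0.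
Proof.
  induction n; simpl; intros H; auto. rewrite IHn, H by auto with arith. ring.
Qed.

Lemma Rsum_const n c : Rsum n (fun _ => c) = INR n * c.
Proof. induction n; [simpl; ring|]. rewrite S_INR. simpl. rewrite IHn. ring. Qed.

Lemma Csum_const n c : Csum n (fun _ => c) = (RtoC (INR n) * c)%C.
Proof.
  induction n; [simpl; ring|]. rewrite S_INR, RtoC_plus. simpl Csum. rewrite IHn. ring.
Qed.

Lemma Rsum_le n F G : (forall k, (k < n)%nat -> F k <= G k) -> Rsum n F <= Rsum n G.
Proof.
  induction n; simpl; intros H; [lra|]. apply Rplus_le_compat; auto with arith.
Qed.

Lemma Rsum_ge0 n F : (forall k, (k < n)%nat -> 0 <= F k) -> 0 <= Rsum n F.
Proof.
  intros H. rewrite <- (Rmult_0_r (INR n)), <- Rsum_const. apply Rsum_le; auto.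
Qed.

Lemma Rsum_ge_term n F i :
  (forall k, (k < n)%nat -> 0 <= F k) -> (i < n)%nat -> F i <= Rsum n F.
Proof.
  induction n; intros H Hi; [lia|]. simpl.
  destruct (Nat.eq_dec i n) as [->|Hn].
  - assert (0 <= Rsum n F) by (apply Rsum_ge0; auto). lra.
  - assert (F i <= Rsum n F) by (apply IHn; auto; lia).
    assert (0 <= F n) by auto. lra.
Qed.

Lemma Cmod_Csum n F : Cmod (Csum n F) <= Rsum n (fun k => Cmod (F k)).
Proof.
  induction n; simpl; [rewrite Cmod_0; lra|].
  eapply Rle_trans; [apply Cmod_triangle|]. lra.
Qed.

Lemma Cmod_Csum_le n F B :
  (forall k, (k < n)%nat -> Cmod (F k) <= B) -> Cmod (Csum n F) <= INR n * B.
Proof.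
  intros H. eapply Rle_trans; [apply Cmod_Csum|].
  rewrite <- Rsum_const. apply Rsum_le; auto.
Qed.

Lemma Csum_swap n m F :
  Csum n (fun i => Csum m (fun j => F i j)) = Csum m (fun j => Csum n (fun i => F i j)).
Proof.
  induction n; simpl; [symmetry; apply Csum_0; auto|].
  rewrite IHn, <- Csum_plus. reflexivity.
Qed.

Lemma Rsum_swap n m F :
  Rsum n (fun i => Rsum m (fun j => F i j)) = Rsum m (fun j => Rsum n (fun i => F i j)).
Proof.
  induction n; simpl.
  - rewrite Rsum_const. ring.
  - rewrite IHn, <- Rsum_plus. reflexivity.
Qed.

Lemma Csum_single n F i : (i < n)%nat ->
  (forall k, (k < n)%nat -> k <> i -> F k = RtoC 0) -> Csum n F = F i.
Proof.
  induction n; intros Hi H; [lia|]. simpl.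
  destruct (Nat.eq_dec i n) as [->|Hn].
  - rewrite Csum_0; [ring|]. intros; apply H; lia.
  - rewrite IHn; [|lia|]. { rewrite (H n); auto; ring. }
    intros; apply H; auto.
Qed.

Lemma Cconj_Csum n F : Cconj (Csum n F) = Csum n (fun k => Cconj (F k)).
Proof.
  induction n; simpl; [apply C_ext; simpl; ring|].
  rewrite <- IHn. apply C_ext; simpl; ring.
Qed.

Lemma Re_Csum n F : Re (Csum n F) = Rsum n (fun k => Re (F k)).
Proof. induction n; simpl; auto. rewrite <- IHn. reflexivity. Qed.

Lemma RtoC_Rsum n F : RtoC (Rsum n F) = Csum n (fun k => RtoC (F k)).
Proof. induction n; simpl; auto. rewrite RtoC_plus, IHn. reflexivity. Qed.

Lemma Csum_shift1 n F : Csum (S n) F = (F 0%nat + Csum n (fun k => F (S k)))%C.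
Proof. induction n; [simpl; ring|]. change (Csum (S (S n)) F) with (Csum (S n) F + F (S n))%C.
  rewrite IHn. simpl. ring. Qed.

(** * Integrals of complex-valued functions *)

(** Continuity and integration are handled by components, so that the theory of real functions
    applies directly; [Ccont_at_eps] gives the equivalent form with the modulus, and [RInt_C_CI]
    identifies [CI] with the vector-valued integral in [fourier_mean]. *)
Definition Ccont_at (g : R -> C) (t : R) : Prop :=
  continuous (fun x => Re (g x)) t /\ continuous (fun x => Im (g x)) t.

Definition Ccont (g : R -> C) : Prop := forall t, Ccont_at g t.

Definition Cint (g : R -> C) (a b : R) : Prop :=
  ex_RInt (fun t => Re (g t)) a b /\ ex_RInt (fun t => Im (g t)) a b.

Definition CI (g : R -> C) (a b : R) : C :=
  (RInt (fun t => Re (g t)) a b, RInt (fun t => Im (g t)) a b).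

Lemma Cint_cont_on g a b : a <= b ->
  (forall t, a <= t <= b -> Ccont_at g t) -> Cint g a b.
Proof.
  intros Hab H. split; apply (ex_RInt_continuous (V := R_CompleteNormedModule));
    rewrite Rmin_left, Rmax_right by auto; intros z Hz; apply H; auto.
Qed.

Lemma Cint_cont g a b : Ccont g -> Cint g a b.
Proof.
  intros H. split; apply (ex_RInt_continuous (V := R_CompleteNormedModule));
    intros z Hz; apply H.
Qed.

Lemma Ccont_at_eps g t : Ccont_at g t <->
  (forall eps, 0 < eps -> exists d, 0 < d /\
     forall x, Rabs (x - t) < d -> Cmod (g x - g t) < eps).
Proof.
  split.
  - intros [H1 H2] eps Heps.
    assert (He : 0 < eps / 2) by lra.
    destruct (proj1 (filterlim_locally _ _) H1 (mkposreal _ He)) as [d1 Hd1].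
    destruct (proj1 (filterlim_locally _ _) H2 (mkposreal _ He)) as [d2 Hd2].
    exists (Rmin d1 d2). split; [apply Rmin_pos; apply cond_pos|].
    intros x Hx.
    assert (K1 : Rabs (Re (g x) - Re (g t)) < eps / 2).
    { apply Hd1. apply Rlt_le_trans with (1 := Hx). apply Rmin_l. }
    assert (K2 : Rabs (Im (g x) - Im (g t)) < eps / 2).
    { apply Hd2. apply Rlt_le_trans with (1 := Hx). apply Rmin_r. }
    eapply Rle_lt_trans; [apply Cmod_le_re_im|].
    change (Rabs (Re (g x) - Re (g t)) + Rabs (Im (g x) - Im (g t)) < eps). lra.
  - intros H. split; apply filterlim_locally; intros eps;
    destruct (H eps (cond_pos eps)) as [d [Hd Hx]]; exists (mkposreal d Hd);
    intros x Hxt; specialize (Hx x Hxt).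
    + apply Rle_lt_trans with (2 := Hx). apply (re_le_Cmod (g x - g t)%C).
    + apply Rle_lt_trans with (2 := Hx). apply (im_le_Cmod (g x - g t)%C).
Qed.

Lemma Ccont_at_ext f g t : (forall x, f x = g x) -> Ccont_at f t -> Ccont_at g t.
Proof.
  intros E [H1 H2]; split; [apply continuous_ext with (2 := H1)|apply continuous_ext with (2 := H2)];
  intros; rewrite E; reflexivity.
Qed.

Lemma Ccont_at_plus f g t : Ccont_at f t -> Ccont_at g t -> Ccont_at (fun x => f x + g x)%C t.
Proof.
  intros [H1 H2] [H3 H4]; split; simpl.
  - exact (continuous_plus _ _ _ H1 H3).
  - exact (continuous_plus _ _ _ H2 H4).
Qed.

Lemma Ccont_at_mult f g t : Ccont_at f t -> Ccont_at g t -> Ccont_at (fun x => f x * g x)%C t.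
Proof.
  intros [H1 H2] [H3 H4]; split; simpl.
  - exact (continuous_minus _ _ _ (continuous_mult _ _ _ H1 H3) (continuous_mult _ _ _ H2 H4)).
  - exact (continuous_plus _ _ _ (continuous_mult _ _ _ H1 H4) (continuous_mult _ _ _ H2 H3)).
Qed.

Lemma Ccont_at_const c t : Ccont_at (fun _ => c) t.
Proof. split; apply continuous_const. Qed.

Lemma Ccont_plus f g : Ccont f -> Ccont g -> Ccont (fun x => f x + g x)%C.
Proof. intros H1 H2 t; apply Ccont_at_plus; auto. Qed.

Lemma Ccont_mult f g : Ccont f -> Ccont g -> Ccont (fun x => f x * g x)%C.
Proof. intros H1 H2 t; apply Ccont_at_mult; auto. Qed.

Lemma Ccont_const c : Ccont (fun _ => c).
Proof. intros t; apply Ccont_at_const. Qed.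

Lemma Ccont_ext f g : (forall x, f x = g x) -> Ccont f -> Ccont g.
Proof. intros E H t; apply Ccont_at_ext with f; auto. Qed.

Lemma Ccont_minus f g : Ccont f -> Ccont g -> Ccont (fun x => f x - g x)%C.
Proof.
  intros H1 H2. apply Ccont_ext with (fun x => f x + RtoC (-1) * g x)%C.
  { intros; rewrite RtoC_m1; ring. }
  apply Ccont_plus, Ccont_mult; auto. apply Ccont_const.
Qed.

Lemma Ccont_conj f : Ccont f -> Ccont (fun x => Cconj (f x)).
Proof.
  intros H t; destruct (H t) as [H1 H2]; split; simpl; auto.
  exact (continuous_opp _ _ H2).
Qed.

Lemma Ccont_Csum n (F : nat -> R -> C) :
  (forall k, Ccont (F k)) -> Ccont (fun t => Csum n (fun k => F k t)).
Proof.
  intros H; induction n; simpl; [apply Ccont_const|]. apply Ccont_plus; auto.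
Qed.

Lemma Ccont_comp_shift f a : Ccont f -> Ccont (fun x => f (x + a)).
Proof.
  intros H t. assert (Hc : continuous (fun x => x + a) t).
  { apply (continuous_plus (fun x => x) (fun _ => a)); [apply continuous_id|apply continuous_const]. }
  split; [apply (continuous_comp (fun x => x + a) (fun x => Re (f x)))|
          apply (continuous_comp (fun x => x + a) (fun x => Im (f x)))]; auto; apply H.
Qed.

Lemma Ccont_cis l th : Ccont (fun t => cis (l * t + th)).
Proof.
  intros t. assert (Hc : continuous (fun x => l * x + th) t).
  { apply (continuous_plus (fun x => l * x) (fun _ => th)); [|apply continuous_const].
    apply (continuous_mult (fun _ => l) (fun x => x)); [apply continuous_const|apply continuous_id]. }
  split; simpl.
  - apply (continuous_comp _ cos); auto. apply continuity_pt_filterlim, continuity_cos.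
  - apply (continuous_comp _ sin); auto. apply continuity_pt_filterlim, continuity_sin.
Qed.

Lemma Ccont_cis0 l : Ccont (fun t => cis (l * t)).
Proof.
  apply Ccont_ext with (2 := Ccont_cis l 0). intros; rewrite Rplus_0_r; auto.
Qed.

Lemma CI_ext f g a b : (forall t, Rmin a b < t < Rmax a b -> f t = g t) -> CI f a b = CI g a b.
Proof.
  intros H. unfold CI. f_equal; apply RInt_ext; intros; rewrite H; auto.
Qed.

Lemma Cint_ext f g a b : (forall t, f t = g t) -> Cint f a b -> Cint g a b.
Proof.
  intros H [H1 H2]; split; [apply ex_RInt_ext with (2 := H1)|apply ex_RInt_ext with (2 := H2)];
  intros; rewrite H; auto.
Qed.

Lemma Cint_plus f g a b : Cint f a b -> Cint g a b -> Cint (fun t => f t + g t)%C a b.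
Proof.
  intros [H1 H2] [H3 H4]; split; simpl.
  - exact (ex_RInt_plus _ _ _ _ H1 H3).
  - exact (ex_RInt_plus _ _ _ _ H2 H4).
Qed.

Lemma CI_plus f g a b : Cint f a b -> Cint g a b ->
  CI (fun t => f t + g t)%C a b = (CI f a b + CI g a b)%C.
Proof.
  intros [H1 H2] [H3 H4]; apply C_ext; simpl.
  - exact (RInt_plus _ _ _ _ H1 H3).
  - exact (RInt_plus _ _ _ _ H2 H4).
Qed.

Lemma Cint_scal c f a b : Cint f a b -> Cint (fun t => c * f t)%C a b.
Proof.
  intros [H1 H2]; split; simpl.
  - exact (ex_RInt_minus _ _ _ _ (ex_RInt_scal _ _ _ (Re c) H1) (ex_RInt_scal _ _ _ (Im c) H2)).
  - exact (ex_RInt_plus _ _ _ _ (ex_RInt_scal _ _ _ (Re c) H2) (ex_RInt_scal _ _ _ (Im c) H1)).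
Qed.

Lemma RInt_lin2 (p q : R) (u v : R -> R) a b : ex_RInt u a b -> ex_RInt v a b ->
  RInt (fun t => p * u t + q * v t) a b = p * RInt u a b + q * RInt v a b.
Proof.
  intros H1 H2. apply (is_RInt_unique (V := R_CompleteNormedModule)).
  apply (is_RInt_plus (V := R_NormedModule) (fun t => p * u t) (fun t => q * v t)).
  - apply (is_RInt_scal (V := R_NormedModule) u a b p), (RInt_correct (V := R_CompleteNormedModule)), H1.
  - apply (is_RInt_scal (V := R_NormedModule) v a b q), (RInt_correct (V := R_CompleteNormedModule)), H2.
Qed.

Lemma CI_scal c f a b : Cint f a b -> CI (fun t => c * f t)%C a b = (c * CI f a b)%C.
Proof.
  intros [H1 H2]; apply C_ext; simpl.
  - rewrite (RInt_ext (V := R_CompleteNormedModule) _ (fun t => Re c * Re (f t) + (- Im c) * Im (f t)))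
      by (intros; simpl; unfold Re, Im; ring).
    rewrite RInt_lin2 by auto. unfold Re, Im; ring.
  - rewrite (RInt_ext (V := R_CompleteNormedModule) _ (fun t => Re c * Im (f t) + Im c * Re (f t)))
      by (intros; simpl; unfold Re, Im; ring).
    rewrite RInt_lin2 by auto. unfold Re, Im; ring.
Qed.

Lemma Cint_minus f g a b : Cint f a b -> Cint g a b -> Cint (fun t => f t - g t)%C a b.
Proof.
  intros H1 H2. apply Cint_ext with (fun t => f t + RtoC (-1) * g t)%C.
  { intros; rewrite RtoC_m1; ring. }
  apply Cint_plus, Cint_scal; auto.
Qed.

Lemma CI_minus f g a b : Cint f a b -> Cint g a b ->
  CI (fun t => f t - g t)%C a b = (CI f a b - CI g a b)%C.
Proof.
  intros H1 H2. rewrite (CI_ext _ (fun t => f t + RtoC (-1) * g t)%C).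
  2: intros; rewrite RtoC_m1; ring.
  rewrite CI_plus, CI_scal; auto. { rewrite RtoC_m1; ring. } apply Cint_scal; auto.
Qed.

Lemma CI_const c a b : CI (fun _ => c) a b = (RtoC (b - a) * c)%C.
Proof.
  apply C_ext; simpl; rewrite RInt_const; unfold scal; simpl; unfold mult; simpl; unfold Re, Im; ring.
Qed.

Lemma CI_Chasles f a b c : Cint f a b -> Cint f b c ->
  (CI f a b + CI f b c)%C = CI f a c.
Proof.
  intros [H1 H2] [H3 H4]; apply C_ext; simpl.
  - exact (RInt_Chasles _ _ _ _ H1 H3).
  - exact (RInt_Chasles _ _ _ _ H2 H4).
Qed.

Lemma CI_point f a : CI f a a = RtoC 0.
Proof. apply C_ext; simpl; apply (RInt_point (V := R_CompleteNormedModule)). Qed.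

Lemma RInt_shift (f : R -> R) s a b : ex_RInt f (a + s) (b + s) ->
  RInt (fun t => f (t + s)) a b = RInt f (a + s) (b + s).
Proof.
  intros H.
  assert (K := RInt_comp_lin (V := R_CompleteNormedModule) f 1 s a b).
  rewrite !Rmult_1_l in K. rewrite <- K by auto.
  apply RInt_ext; intros. unfold scal; simpl; unfold mult; simpl. rewrite !Rmult_1_l. reflexivity.
Qed.

Lemma CI_shift f s a b : Ccont f -> CI (fun t => f (t + s)) a b = CI f (a + s) (b + s).
Proof.
  intros H. destruct (Cint_cont f (a + s) (b + s) H) as [H1 H2].
  apply C_ext; simpl; [exact (RInt_shift (fun t => Re (f t)) s a b H1)
                      |exact (RInt_shift (fun t => Im (f t)) s a b H2)].
Qed.

Lemma Re_CI_le f a b B : a <= b -> Cint f a b ->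
  (forall t, a <= t <= b -> Re (f t) <= B) -> Re (CI f a b) <= (b - a) * B.
Proof.
  intros Hab [H1 H2] H. simpl.
  assert (K : RInt (fun _ => B) a b = (b - a) * B).
  { rewrite RInt_const. reflexivity. }
  rewrite <- K. apply RInt_le; auto.
  - apply ex_RInt_const.
  - intros; apply H; lra.
Qed.

(** After rotation the integral is real and nonnegative, so only the real part of the rotated
    integrand has to be bounded. Estimating the two components separately would cost a factor. *)
Lemma CI_bound f a b B : a <= b -> Cint f a b ->
  (forall t, a <= t <= b -> Cmod (f t) <= B) -> Cmod (CI f a b) <= (b - a) * B.
Proof.
  intros Hab Hi H.
  destruct (unit_phase (CI f a b)) as [th Hth].
  replace (Cmod (CI f a b)) with (Re (cis th * CI f a b)) by (rewrite Hth; reflexivity).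
  rewrite <- CI_scal by auto.
  apply Re_CI_le; auto using Cint_scal.
  intros t Ht. eapply Rle_trans; [apply re_bound|].
  rewrite Cmod_mult, Cmod_cis, Rmult_1_l; auto.
Qed.

Lemma RInt_C_CI (g : R -> C) a b : Cint g a b ->
  @RInt C_R_CompleteNormedModule g a b = CI g a b.
Proof.
  intros [H1 H2]. apply (is_RInt_unique (V := C_R_CompleteNormedModule)).
  apply (is_RInt_fct_extend_pair (U := R_NormedModule) (V := R_NormedModule) g a b).
  - apply (RInt_correct (V := R_CompleteNormedModule)), H1.
  - apply (RInt_correct (V := R_CompleteNormedModule)), H2.
Qed.

(** * Almost periodic functions on the line and total boundedness of their translates *)

Definition TB (g : R -> C) : Prop := forall eps, 0 < eps ->
  exists A : list R, forall a, exists b, In b A /\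
    forall t, Cmod (g (t + a) - g (t + b)) <= eps.

Definition almost_periodic (g : R -> C) : Prop := forall eps, 0 < eps ->
  exists l, 0 < l /\ forall x, exists tau, x < tau < x + l /\
    forall t, Cmod (g (t + tau) - g t) <= eps.

Lemma list_abs_bound (A : list R) : exists M, 0 < M /\ forall b, In b A -> Rabs b <= M.
Proof.
  induction A as [|x A [M [HM H]]].
  - exists 1. split; [lra|]. intros b [].
  - exists (M + Rabs x). assert (Hx := Rabs_pos x). split; [lra|].
    intros b [<-|Hb]; [lra|]. specialize (H b Hb). lra.
Qed.

Lemma TB_bounded g : TB g -> exists B, 0 < B /\ forall t, Cmod (g t) <= B.
Proof.
  intros H. destruct (H 1 Rlt_0_1) as [A HA].
  destruct (list_abs_bound (map (fun b => Cmod (g b)) A)) as [M [HM HB]].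
  exists (M + 1). split; [lra|]. intros t.
  destruct (HA t) as [b [Hb Ht]]. specialize (Ht 0). rewrite !Rplus_0_l in Ht.
  assert (K := HB (Cmod (g b)) (in_map (fun b => Cmod (g b)) A b Hb)).
  rewrite Rabs_pos_eq in K by apply Cmod_ge_0.
  assert (K2 := Cmod_rev_triangle (g t) (g b)). lra.
Qed.

Lemma list_common_delta (P : R -> R -> Prop) (A : list R) :
  (forall b d d', P b d -> 0 < d' <= d -> P b d') ->
  (forall b, exists d, 0 < d /\ P b d) ->
  exists d, 0 < d /\ forall b, In b A -> P b d.
Proof.
  intros Hm H. induction A as [|x A [d [Hd IH]]].
  - exists 1. split; [lra|]. intros b [].
  - destruct (H x) as [d' [Hd' Hx]]. exists (Rmin d d').
    assert (0 < Rmin d d') by (apply Rmin_pos; auto).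
    split; auto. intros b [<-|Hb].
    + apply Hm with d'; auto. split; auto. apply Rmin_r.
    + apply Hm with d; auto. split; auto. apply Rmin_l.
Qed.

Definition ucont (g : R -> C) : Prop := forall eps, 0 < eps ->
  exists d, 0 < d /\ forall s t, Rabs (s - t) < d -> Cmod (g s - g t) <= eps.

(** [g s] is the translate by [t] evaluated at [s - t]. Replacing this translate by one of finitely
    many centres [b] leaves only continuity at the points [b], for which a common [d] exists. *)
Lemma TB_ucont g : Ccont g -> TB g -> ucont g.
Proof.
  intros Hc H eps Heps. destruct (H (eps / 3)) as [A HA]; [lra|].
  destruct (list_common_delta
    (fun b d => forall h, Rabs h < d -> Cmod (g (h + b) - g b) <= eps / 3) A) as [d [Hd HAd]].
  - intros b d d' Hd Hd' h Hh. apply Hd. lra.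
  - intros b. destruct (proj1 (Ccont_at_eps g b) (Hc b) (eps / 3)) as [d [Hd Hx]]; [lra|].
    exists d; split; auto. intros h Hh. apply Rlt_le, Hx. replace (h + b - b) with h by ring; auto.
  - exists d; split; auto. intros s t Hst.
    destruct (HA t) as [b [Hb Hab]].
    assert (K1 := Hab (s - t)). assert (K2 := Hab 0). assert (K3 := HAd b Hb (s - t) Hst).
    rewrite !Rplus_0_l in K2. replace (s - t + t) with s in K1 by ring.
    eapply Rle_trans; [apply (Cmod_triangle_sub _ (g (s - t + b)))|].
    assert (K4 := Cmod_triangle_sub (g (s - t + b)) (g b) (g t)).
    rewrite (Cmod_sub_sym (g b)) in K4. lra.
Qed.

(** An almost period carries [t] into [[0, l]], and with it every [s] at distance less than 1 into
    [[-1, l + 1]]. There uniform continuity on a compact interval applies to both components. *)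
Lemma ap_ucont g : Ccont g -> almost_periodic g -> ucont g.
Proof.
  intros Hc H eps Heps. destruct (H (eps / 3)) as [l [Hl HA]]; [lra|].
  assert (He : 0 < eps / 3 / 2) by lra.
  destruct (unifcont_1d (fun x => Re (g x)) (-1) (l + 1) (fun x _ => proj1 (Hc x)) (mkposreal _ He)) as [d1 Hd1].
  destruct (unifcont_1d (fun x => Im (g x)) (-1) (l + 1) (fun x _ => proj2 (Hc x)) (mkposreal _ He)) as [d2 Hd2].
  exists (Rmin 1 (Rmin d1 d2)). split.
  { repeat apply Rmin_pos; try apply cond_pos. lra. }
  intros s t Hst.
  assert (Hs1 : Rabs (s - t) < 1) by (eapply Rlt_le_trans; [exact Hst|apply Rmin_l]).
  assert (Hs2 : Rabs (s - t) < Rmin d1 d2) by (eapply Rlt_le_trans; [exact Hst|apply Rmin_r]).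
  assert (Hs3 : Rabs (s - t) < d1) by (eapply Rlt_le_trans; [exact Hs2|apply Rmin_l]).
  assert (Hs4 : Rabs (s - t) < d2) by (eapply Rlt_le_trans; [exact Hs2|apply Rmin_r]).
  destruct (HA (- t)) as [tau [Ht Htau]].
  assert (K1 := Htau s). assert (K2 := Htau t).
  assert (Hab := Rabs_def2 _ _ Hs1).
  assert (B1 : -1 <= s + tau <= l + 1) by lra.
  assert (B2 : -1 <= t + tau <= l + 1) by lra.
  assert (E : s - t = (s + tau) - (t + tau)) by ring.
  assert (R1 := Hd1 (t + tau) (s + tau) B2 B1).
  assert (R2 := Hd2 (t + tau) (s + tau) B2 B1).
  rewrite E in Hs3, Hs4.
  specialize (R1 Hs3). specialize (R2 Hs4). apply NNPP in R1. apply NNPP in R2.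
  assert (K3 : Cmod (g (s + tau) - g (t + tau)) <= eps / 3).
  { eapply Rle_trans; [apply Cmod_le_re_im|].
    change (Rabs (Re (g (s + tau)) - Re (g (t + tau))) + Rabs (Im (g (s + tau)) - Im (g (t + tau))) <= eps / 3).
    change (Rabs (Re (g (s + tau)) - Re (g (t + tau))) < eps / 3 / 2) in R1.
    change (Rabs (Im (g (s + tau)) - Im (g (t + tau))) < eps / 3 / 2) in R2. lra. }
  eapply Rle_trans; [apply (Cmod_triangle_sub _ (g (s + tau)))|].
  assert (K4 := Cmod_triangle_sub (g (s + tau)) (g (t + tau)) (g t)).
  rewrite (Cmod_sub_sym (g s)). lra.
Qed.

Lemma grid_cover (l d : R) : 0 < d -> exists A : list R,
  forall r, 0 <= r <= l -> exists b, In b A /\ Rabs (r - b) < d.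
Proof.
  intros Hd.
  assert (H : forall n : nat, exists A : list R, forall r, 0 <= r <= INR n * (d / 2) ->
    exists b, In b A /\ Rabs (r - b) < d).
  { induction n as [|n [A HA]].
    - exists (0 :: nil). intros r Hr. simpl in Hr. exists 0. split; [left; auto|].
      replace r with 0 by lra. rewrite Rminus_0_r, Rabs_R0; auto.
    - exists (INR n * (d / 2) :: A). rewrite S_INR. intros r Hr.
      destruct (Rle_dec r (INR n * (d / 2))).
      + destruct (HA r) as [b [Hb Hb']]; [lra|]. exists b; split; auto. right; auto.
      + exists (INR n * (d / 2)). split; [left; auto|]. rewrite Rabs_pos_eq; lra. }
  destruct (nfloor_ex (Rmax 0 (l / (d / 2)))) as [n Hn]; [apply Rmax_l|].
  destruct (H (S n)) as [A HA]. exists A. intros r Hr. apply HA. rewrite S_INR.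
  split; [lra|]. assert (l / (d / 2) <= Rmax 0 (l / (d / 2))) by apply Rmax_r.
  assert (l / (d / 2) < INR n + 1) by lra.
  apply Rmult_lt_compat_r with (r := d / 2) in H1; [|lra].
  unfold Rdiv at 1 in H1. rewrite Rmult_assoc, Rinv_l, Rmult_1_r in H1 by lra. lra.
Qed.

(** Subtracting an almost period reduces the translation [a] to [[0, l]]; uniform continuity then
    allows rounding it to a finite grid. *)
Lemma ap_TB g : Ccont g -> almost_periodic g -> TB g.
Proof.
  intros Hc H eps Heps.
  destruct (ap_ucont g Hc H (eps / 2)) as [d [Hd Hu]]; [lra|].
  destruct (H (eps / 2)) as [l [Hl HA]]; [lra|].
  destruct (grid_cover l d Hd) as [A Hgrid]. exists A. intros a.
  destruct (HA (a - l)) as [tau [Ht Htau]].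
  destruct (Hgrid (a - tau)) as [b [Hb Hab]]; [lra|].
  exists b. split; auto. intros t.
  assert (K1 := Htau (t + (a - tau))). replace (t + (a - tau) + tau) with (t + a) in K1 by ring.
  assert (K2 : Cmod (g (t + (a - tau)) - g (t + b)) <= eps / 2).
  { apply Hu. replace (t + (a - tau) - (t + b)) with (a - tau - b) by ring; auto. }
  eapply Rle_trans; [apply (Cmod_triangle_sub _ (g (t + (a - tau))))|]. lra.
Qed.

(** If the translates by [a] and [b] are close, then [a - b] is an almost period. Since the centres
    lie in [[-M, M]], the choice [a = x + M + 1] places [a - b] strictly between [x] and
    [x + 2 * M + 2]. *)
Lemma TB_ap g : TB g -> almost_periodic g.
Proof.
  intros H eps Heps. destruct (H eps Heps) as [A HA].
  destruct (list_abs_bound A) as [M [HM HB]].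
  exists (2 * M + 2). split; [lra|]. intros x.
  destruct (HA (x + M + 1)) as [b [Hb Ht]]. exists (x + M + 1 - b).
  assert (K := HB b Hb). assert (K' := Rabs_pos_eq). unfold Rabs in K.
  split; [destruct (Rcase_abs b); lra|].
  intros t. specialize (Ht (t - b)). replace (t - b + b) with t in Ht by ring.
  replace (t + (x + M + 1 - b)) with (t - b + (x + M + 1)) by ring. auto.
Qed.

(** A sum or product needs translations good for both functions at once, which two separate families
    of almost periods do not provide. The two finite covers are therefore intersected. *)
Lemma TB_pair f g eps : TB f -> TB g -> 0 < eps ->
  exists A : list R, forall a, exists b, In b A /\
    (forall t, Cmod (f (t + a) - f (t + b)) <= eps) /\
    (forall t, Cmod (g (t + a) - g (t + b)) <= eps).
Proof.
  intros Hf Hg Heps.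
  destruct (Hf (eps / 2)) as [Af HAf]; [lra|].
  destruct (Hg (eps / 2)) as [Ag HAg]; [lra|].
  set (cell := fun (p : R * R) (a : R) =>
    (forall t, Cmod (f (t + a) - f (t + fst p)) <= eps / 2) /\
    (forall t, Cmod (g (t + a) - g (t + snd p)) <= eps / 2)).
  (* Neither of the two centres of a cell need lie in the cell, so a representative is chosen from
     each nonempty cell. Comparing [a] with it through the centre doubles the error, hence [eps / 2]
     above. *)
  exists (map (fun p => epsilon (inhabits 0) (cell p)) (list_prod Af Ag)).
  intros a. destruct (HAf a) as [b1 [Hb1 H1]]. destruct (HAg a) as [b2 [Hb2 H2]].
  exists (epsilon (inhabits 0) (cell (b1, b2))). split.
  { apply in_map_iff. exists (b1, b2). split; auto. apply in_prod; auto. }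
  assert (Hc : cell (b1, b2) (epsilon (inhabits 0) (cell (b1, b2)))).
  { apply epsilon_spec. exists a. split; auto. }
  destruct Hc as [H3 H4]. simpl in H3, H4. split; intros t.
  - eapply Rle_trans; [apply (Cmod_triangle_sub _ (f (t + b1)))|].
    rewrite (Cmod_sub_sym (f (t + b1))). specialize (H1 t). specialize (H3 t). lra.
  - eapply Rle_trans; [apply (Cmod_triangle_sub _ (g (t + b2)))|].
    rewrite (Cmod_sub_sym (g (t + b2))). specialize (H2 t). specialize (H4 t). lra.
Qed.

Lemma TB_plus f g : TB f -> TB g -> TB (fun t => f t + g t)%C.
Proof.
  intros Hf Hg eps Heps. destruct (TB_pair f g (eps / 2) Hf Hg) as [A HA]; [lra|].
  exists A. intros a. destruct (HA a) as [b [Hb [H1 H2]]]. exists b. split; auto.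
  intros t. replace (f (t + a)%R + g (t + a)%R - (f (t + b)%R + g (t + b)%R))%C with
    ((f (t + a)%R - f (t + b)%R) + (g (t + a)%R - g (t + b)%R))%C by ring.
  eapply Rle_trans; [apply Cmod_triangle|]. specialize (H1 t). specialize (H2 t). lra.
Qed.

Lemma TB_mult f g : TB f -> TB g -> TB (fun t => f t * g t)%C.
Proof.
  intros Hf Hg eps Heps.
  destruct (TB_bounded f Hf) as [Bf [HBf Hbf]]. destruct (TB_bounded g Hg) as [Bg [HBg Hbg]].
  destruct (TB_pair f g (eps / (Bf + Bg)) Hf Hg) as [A HA].
  { apply Rdiv_lt_0_compat; lra. }
  exists A. intros a. destruct (HA a) as [b [Hb [H1 H2]]]. exists b. split; auto.
  intros t. replace (f (t + a)%R * g (t + a)%R - (f (t + b)%R * g (t + b)%R))%C with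
    (f (t + a)%R * (g (t + a)%R - g (t + b)%R) + (f (t + a)%R - f (t + b)%R) * g (t + b)%R)%C by ring.
  eapply Rle_trans; [apply Cmod_triangle|]. rewrite !Cmod_mult.
  specialize (H1 t). specialize (H2 t).
  assert (K1 := Hbf (t + a)). assert (K2 := Hbg (t + b)).
  apply Rle_trans with (Bf * (eps / (Bf + Bg)) + (eps / (Bf + Bg)) * Bg).
  - apply Rplus_le_compat; apply Rmult_le_compat; auto using Cmod_ge_0.
  - right. field. lra.
Qed.

Lemma TB_const c : TB (fun _ => c).
Proof.
  intros eps Heps. exists (0 :: nil). intros a. exists 0. split; [left; auto|].
  intros t. replace (c - c)%C with (RtoC 0) by ring. rewrite Cmod_0; lra.
Qed.

Lemma TB_ext f g : (forall t, f t = g t) -> TB f -> TB g.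
Proof.
  intros E H eps Heps. destruct (H eps Heps) as [A HA]. exists A. intros a.
  destruct (HA a) as [b [Hb Ht]]. exists b; split; auto. intros t; rewrite <- !E; auto.
Qed.

Lemma TB_conj f : TB f -> TB (fun t => Cconj (f t)).
Proof.
  intros H eps Heps. destruct (H eps Heps) as [A HA]. exists A. intros a.
  destruct (HA a) as [b [Hb Ht]]. exists b; split; auto. intros t.
  replace (Cconj (f (t + a)%R) - Cconj (f (t + b)%R))%C with (Cconj (f (t + a)%R - f (t + b)%R))
    by (apply C_ext; simpl; ring).
  rewrite Cmod_conj; auto.
Qed.

Lemma cis_2PI_nat x (k : nat) : cis (x + 2 * INR k * PI) = cis x.
Proof. unfold cis. rewrite cos_period, sin_period. reflexivity. Qed.

Lemma cis_2PI_Z x (k : Z) : cis (x + 2 * IZR k * PI) = cis x.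
Proof.
  destruct (Z.le_gt_cases 0 k) as [Hk|Hk].
  - replace (IZR k) with (INR (Z.to_nat k)) by (rewrite INR_IZR_INZ, Z2Nat.id; auto).
    apply cis_2PI_nat.
  - replace x with (x + 2 * IZR k * PI + 2 * INR (Z.to_nat (- k)) * PI) at 2.
    + rewrite cis_2PI_nat. reflexivity.
    + rewrite INR_IZR_INZ, Z2Nat.id by lia. rewrite opp_IZR. ring.
Qed.

Lemma TB_cis l th : TB (fun t => cis (l * t + th)).
Proof.
  destruct (Req_dec l 0) as [->|Hl].
  { apply TB_ext with (2 := TB_const (cis th)). intros; f_equal; ring. }
  apply ap_TB; [apply Ccont_cis|].
  set (p := 2 * PI / Rabs l).
  assert (Hp : 0 < p). { apply Rdiv_lt_0_compat; [generalize PI_RGT_0; lra|apply Rabs_pos_lt; auto]. }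
  intros eps Heps. exists (p + p). split; [lra|]. intros x.
  destruct (archimed (x / p)) as [H1 H2]. set (k := up (x / p)) in *.
  assert (E : p * (x / p) = x) by (field; lra).
  exists (IZR k * p). split; [nra|]. intros t.
  assert (E2 : exists k' : Z, l * (t + IZR k * p) + th = (l * t + th) + 2 * IZR k' * PI).
  { unfold p, Rabs. destruct (Rcase_abs l); [exists (- k)%Z; rewrite opp_IZR|exists k]; field; auto. }
  destruct E2 as [k' ->]. rewrite cis_2PI_Z.
  replace (cis (l * t + th) - cis (l * t + th))%C with (RtoC 0) by ring. rewrite Cmod_0; lra.
Qed.

Lemma TB_unif_limit g :
  (forall eps, 0 < eps -> exists h, TB h /\ forall t, Cmod (g t - h t) <= eps) -> TB g.
Proof.
  intros H eps Heps. destruct (H (eps / 3)) as [h [Hh Hgh]]; [lra|].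
  destruct (Hh (eps / 3)) as [A HA]; [lra|]. exists A. intros a.
  destruct (HA a) as [b [Hb Ht]]. exists b; split; auto. intros t.
  eapply Rle_trans; [apply (Cmod_triangle_sub _ (h (t + a)))|].
  assert (K := Cmod_triangle_sub (h (t + a)) (h (t + b)) (g (t + b))).
  rewrite (Cmod_sub_sym (h (t + b))) in K.
  assert (K1 := Hgh (t + a)). assert (K2 := Hgh (t + b)). specialize (Ht t). lra.
Qed.

Lemma Ccont_unif_limit g :
  (forall eps, 0 < eps -> exists h, Ccont h /\ forall t, Cmod (g t - h t) <= eps) -> Ccont g.
Proof.
  intros H t. apply Ccont_at_eps. intros eps Heps.
  destruct (H (eps / 3)) as [h [Hh Hgh]]; [lra|].
  destruct (proj1 (Ccont_at_eps h t) (Hh t) (eps / 3)) as [d [Hd Hx]]; [lra|].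
  exists d; split; auto. intros x Hxt.
  eapply Rle_lt_trans; [apply (Cmod_triangle_sub _ (h x))|].
  assert (K := Cmod_triangle_sub (h x) (h t) (g t)).
  rewrite (Cmod_sub_sym (h t)) in K.
  assert (K1 := Hgh x). assert (K2 := Hgh t). specialize (Hx x Hxt). lra.
Qed.

(** [TB] is Bochner's form of almost periodicity: the translates are totally bounded. *)
Definition CAP (g : R -> C) : Prop := Ccont g /\ TB g.

Lemma CAP_plus f g : CAP f -> CAP g -> CAP (fun t => f t + g t)%C.
Proof. intros [] []; split; [apply Ccont_plus|apply TB_plus]; auto. Qed.

Lemma CAP_mult f g : CAP f -> CAP g -> CAP (fun t => f t * g t)%C.
Proof. intros [] []; split; [apply Ccont_mult|apply TB_mult]; auto. Qed.

Lemma CAP_const c : CAP (fun _ => c).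
Proof. split; [apply Ccont_const|apply TB_const]. Qed.

Lemma CAP_ext f g : (forall t, f t = g t) -> CAP f -> CAP g.
Proof. intros E []; split; [apply Ccont_ext with f|apply TB_ext with f]; auto. Qed.

Lemma CAP_cis l th : CAP (fun t => cis (l * t + th)).
Proof. split; [apply Ccont_cis|apply TB_cis]. Qed.

Lemma CAP_cis0 l : CAP (fun t => cis (l * t)).
Proof. apply CAP_ext with (2 := CAP_cis l 0). intros; rewrite Rplus_0_r; auto. Qed.

Lemma CAP_conj f : CAP f -> CAP (fun t => Cconj (f t)).
Proof. intros []; split; [apply Ccont_conj|apply TB_conj]; auto. Qed.

Lemma CAP_Csum n (F : nat -> R -> C) :
  (forall k, CAP (F k)) -> CAP (fun t => Csum n (fun k => F k t)).
Proof. intros H; induction n; simpl; [apply CAP_const|]. apply CAP_plus; auto. Qed.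

Lemma CAP_unif_limit g :
  (forall eps, 0 < eps -> exists h, CAP h /\ forall t, Cmod (g t - h t) <= eps) -> CAP g.
Proof.
  intros H; split; [apply Ccont_unif_limit|apply TB_unif_limit]; intros eps Heps;
  destruct (H eps Heps) as [h [[] ]]; exists h; auto.
Qed.

(** * Mean values *)

(** Uniformity in the left endpoint makes mean values visibly translation invariant. *)
Definition is_mean (g : R -> C) (m : C) : Prop := forall eps, 0 < eps ->
  exists T0, 0 < T0 /\ forall T, T0 <= T -> forall a,
    Cmod (CI g a (a + T) - RtoC T * m) <= eps * T.

Lemma mean_plus f g m n : Ccont f -> Ccont g -> is_mean f m -> is_mean g n ->
  is_mean (fun t => f t + g t)%C (m + n)%C.
Proof.
  intros Cf Cg Hf Hg eps Heps.
  destruct (Hf (eps / 2)) as [T1 [H1 K1]]; [lra|]. destruct (Hg (eps / 2)) as [T2 [H2 K2]]; [lra|].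
  exists (Rmax T1 T2). split; [apply Rlt_le_trans with (1 := H1), Rmax_l|].
  intros T HT a. assert (B1 := Rmax_l T1 T2). assert (B2 := Rmax_r T1 T2).
  rewrite CI_plus by (apply Cint_cont; auto).
  specialize (K1 T ltac:(lra) a). specialize (K2 T ltac:(lra) a).
  match goal with |- Cmod ?z <= _ => replace z with
    ((CI f a (a + T)%R - RtoC T * m) + (CI g a (a + T)%R - RtoC T * n))%C by ring end.
  eapply Rle_trans; [apply Cmod_triangle|]. lra.
Qed.

Lemma mean_scal c f m : Ccont f -> is_mean f m -> is_mean (fun t => c * f t)%C (c * m)%C.
Proof.
  intros Cf Hf eps Heps.
  assert (Hc := Cmod_ge_0 c).
  destruct (Hf (eps / (Cmod c + 1))) as [T1 [H1 K1]]; [apply Rdiv_lt_0_compat; lra|].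
  exists T1; split; auto. intros T HT a. rewrite CI_scal by (apply Cint_cont; auto).
  replace (c * CI f a (a + T)%R - RtoC T * (c * m))%C with (c * (CI f a (a + T)%R - RtoC T * m))%C by ring.
  rewrite Cmod_mult. specialize (K1 T HT a).
  apply Rle_trans with (Cmod c * (eps / (Cmod c + 1) * T)).
  - apply Rmult_le_compat_l; auto.
  - apply Rle_trans with ((Cmod c + 1) * (eps / (Cmod c + 1) * T)).
    + apply Rmult_le_compat_r; [|lra]. apply Rmult_le_pos; [|lra].
      apply Rlt_le, Rdiv_lt_0_compat; lra.
    + right; field; lra.
Qed.

Lemma mean_ext f g m : (forall t, f t = g t) -> is_mean f m -> is_mean g m.
Proof.
  intros E H eps Heps. destruct (H eps Heps) as [T0 [H0 K]]. exists T0; split; auto.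
  intros T HT a. rewrite (CI_ext g f) by auto. auto.
Qed.

Lemma mean_const c : is_mean (fun _ => c) c.
Proof.
  intros eps Heps. exists 1. split; [lra|]. intros T HT a. rewrite CI_const.
  replace (a + T - a) with T by ring.
  replace (RtoC T * c - RtoC T * c)%C with (RtoC 0) by ring. rewrite Cmod_0. nra.
Qed.

Lemma mean_shift f m s : Ccont f -> is_mean f m -> is_mean (fun t => f (t + s)) m.
Proof.
  intros Cf H eps Heps. destruct (H eps Heps) as [T0 [H0 K]]. exists T0; split; auto.
  intros T HT a. rewrite CI_shift by auto.
  replace (a + T + s) with (a + s + T) by ring. auto.
Qed.

Lemma mean_Csum n (F : nat -> R -> C) (m : nat -> C) :
  (forall k, Ccont (F k)) -> (forall k, is_mean (F k) (m k)) ->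
  is_mean (fun t => Csum n (fun k => F k t)) (Csum n m).
Proof.
  intros HC HM. induction n; simpl; [apply mean_const|].
  apply mean_plus; auto. apply Ccont_Csum; auto.
Qed.

Lemma mean_unique g m n : is_mean g m -> is_mean g n -> m = n.
Proof.
  intros Hm Hn. apply NNPP. intros Hne.
  assert (Hp : 0 < Cmod (m - n)).
  { apply Cmod_gt_0. intros E. apply Hne. replace m with ((m - n) + n)%C by ring. rewrite E. ring. }
  destruct (Hm (Cmod (m - n) / 4)) as [T1 [H1 K1]]; [lra|].
  destruct (Hn (Cmod (m - n) / 4)) as [T2 [H2 K2]]; [lra|].
  assert (B1 := Rmax_l T1 T2). assert (B2 := Rmax_r T1 T2). set (T := Rmax T1 T2) in *.
  specialize (K1 T B1 0). specialize (K2 T B2 0).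
  assert (K3 : Cmod (RtoC T * m - RtoC T * n) = T * Cmod (m - n)).
  { replace (RtoC T * m - RtoC T * n)%C with (RtoC T * (m - n))%C by ring.
    rewrite Cmod_mult, Cmod_R, Rabs_pos_eq; lra. }
  assert (K4 := Cmod_triangle_sub (RtoC T * m) (CI g 0 (0 + T)) (RtoC T * n)).
  rewrite (Cmod_sub_sym (RtoC T * m) (CI g 0 (0 + T))) in K4.
  assert (0 < T * Cmod (m - n)) by (apply Rmult_lt_0_compat; lra). lra.
Qed.

Lemma mean_re_le f m B : Ccont f -> is_mean f m -> (forall t, Re (f t) <= B) -> Re m <= B.
Proof.
  intros Cf H HB. apply Rnot_lt_le. intros Hlt.
  destruct (H ((Re m - B) / 2)) as [T [HT K]]; [lra|].
  specialize (K T (Rle_refl _) 0).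
  assert (K1 : Re (CI f 0 (0 + T)) <= (0 + T - 0) * B).
  { apply Re_CI_le; auto; [lra|]. apply Cint_cont; auto. }
  assert (K2 := re_le_Cmod (CI f 0 (0 + T) - RtoC T * m)%C).
  replace (Re (CI f 0 (0 + T)%R - RtoC T * m)%C) with (Re (CI f 0 (0 + T)%R) - T * Re m) in K2
    by (simpl; unfold Re, Im; ring).
  assert (K3 := Rle_trans _ _ _ K2 K).
  unfold Rabs in K3. destruct Rcase_abs in K3; nra.
Qed.

Lemma CI_block f m T e a n : Ccont f -> 0 < T ->
  (forall a, Cmod (CI f a (a + T) - m) <= e) ->
  Cmod (CI f a (a + INR n * T) - RtoC (INR n) * m) <= INR n * e.
Proof.
  intros Cf HT H. induction n.
  - simpl. rewrite Rmult_0_l, Rplus_0_r, CI_point, Rmult_0_l.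
    replace (RtoC 0 - RtoC 0 * m)%C with (RtoC 0) by ring. rewrite Cmod_0. lra.
  - rewrite S_INR. rewrite <- (CI_Chasles f a (a + INR n * T)) by (apply Cint_cont; auto).
    replace (a + (INR n + 1) * T) with (a + INR n * T + T) by ring.
    rewrite RtoC_plus.
    match goal with |- Cmod ?z <= _ => replace z with
      ((CI f a (a + INR n * T)%R - RtoC (INR n) * m) +
       (CI f (a + INR n * T)%R (a + INR n * T + T)%R - m))%C by ring end.
    eapply Rle_trans; [apply Cmod_triangle|]. specialize (H (a + INR n * T)). lra.
Qed.

Lemma nat_mult_decomp T T' : 0 < T -> 0 <= T' -> exists n r, T' = INR n * T + r /\ 0 <= r < T.
Proof.
  intros HT HT'. destruct (nfloor_ex (T' / T)) as [n Hn].
  { apply Rmult_le_pos; auto. apply Rlt_le, Rinv_0_lt_compat; auto. }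
  exists n, (T' - INR n * T). split; [ring|].
  assert (E : T' / T * T = T') by (field; lra). nra.
Qed.

(** A long window is cut into windows of length [T] and a remainder [r < T]. The remainder
    contributes at most [T * B] to the integral and at most [T * B] to [T' * m], together at most
    [e * T'] by the lower bound on [T']. *)
Lemma mean_window f B m T e : Ccont f -> (forall t, Cmod (f t) <= B) -> 0 < T -> 0 < e -> 0 < B ->
  (forall a, Cmod (CI f a (a + T) - RtoC T * m) <= e * T) -> Cmod m <= B ->
  forall T', 2 * T * B / e <= T' -> forall a,
    Cmod (CI f a (a + T') - RtoC T' * m) <= 2 * e * T'.
Proof.
  intros Cf HB HT He HBp H Hm T' HT' a.
  assert (HTp : 0 < T * B) by (apply Rmult_lt_0_compat; auto).
  assert (HT'2 : 2 * T * B <= e * T').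
  { apply Rmult_le_compat_l with (r := e) in HT'; [|lra].
    replace (e * (2 * T * B / e)) with (2 * T * B) in HT' by (field; lra). lra. }
  assert (HT'p : 0 < T') by nra.
  destruct (nat_mult_decomp T T' HT) as [n [r [E Hr]]]; [lra|].
  rewrite E at 1 2. rewrite <- Rplus_assoc.
  rewrite <- (CI_Chasles f a (a + INR n * T)) by (apply Cint_cont; auto).
  assert (K := CI_block f (RtoC T * m) T (e * T) a n Cf HT H).
  assert (K2 : Cmod (CI f (a + INR n * T) (a + INR n * T + r)) <= r * B).
  { replace r with (a + INR n * T + r - (a + INR n * T)) at 2 by ring.
    apply CI_bound; [lra|apply Cint_cont; auto|auto]. }
  assert (K3 : Cmod (RtoC r * m) <= r * B).
  { rewrite Cmod_mult, Cmod_R, Rabs_pos_eq by lra. apply Rmult_le_compat_l; lra. }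
  rewrite RtoC_plus, RtoC_mult.
  match goal with |- Cmod ?z <= _ => replace z with
      ((CI f a (a + INR n * T)%R - RtoC (INR n) * (RtoC T * m)) +
       (CI f (a + INR n * T)%R (a + INR n * T + r)%R - RtoC r * m))%C by ring end.
  eapply Rle_trans; [apply Cmod_triangle|].
  assert (K4 : Cmod (CI f (a + INR n * T)%R (a + INR n * T + r)%R - RtoC r * m) <= r * B + r * B).
  { eapply Rle_trans; [apply Cmod_triangle|]. rewrite Cmod_opp. lra. }
  assert (r * B <= T * B) by (apply Rmult_le_compat_r; lra).
  assert (INR n * T <= T') by lra.
  assert (INR n * (e * T) <= e * T') by nra.
  lra.
Qed.

(** An almost period between [a - b] and [a - b + l] moves the window at [b] onto the one at [a] up
    to two end pieces shorter than [l]. These cost at most [2 * l * B], which is at most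
    [eps / 2 * T] for the chosen threshold. *)
Lemma CAP_window f eps : CAP f -> 0 < eps -> exists T0, 0 < T0 /\ forall T, T0 <= T -> forall a b,
  Cmod (CI f a (a + T) - CI f b (b + T)) <= eps * T.
Proof.
  intros [Cf Tf] Heps. destruct (TB_bounded f Tf) as [B [HB Hb]].
  destruct (TB_ap f Tf (eps / 2)) as [l [Hl HA]]; [lra|].
  exists (4 * l * B / eps). assert (HlB : 0 < l * B) by (apply Rmult_lt_0_compat; auto).
  split; [apply Rdiv_lt_0_compat; lra|].
  intros T HT a b.
  assert (HT2 : 4 * l * B <= eps * T).
  { apply Rmult_le_compat_l with (r := eps) in HT; [|lra].
    replace (eps * (4 * l * B / eps)) with (4 * l * B) in HT by (field; lra). lra. }
  assert (HTp : 0 < T) by nra.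
  destruct (HA (a - b)) as [tau [Ht Htau]].
  assert (K1 : Cmod (CI f (b + tau) (b + T + tau) - CI f b (b + T)) <= eps / 2 * T).
  { rewrite <- CI_shift by auto. rewrite <- CI_minus by (apply Cint_cont; auto; apply Ccont_comp_shift; auto).
    replace (eps / 2 * T) with ((b + T - b) * (eps / 2)) by ring.
    apply CI_bound; [lra| |auto].
    apply Cint_cont, Ccont_minus; auto. apply Ccont_comp_shift; auto. }
  assert (K2 : Cmod (CI f a (b + tau)) <= (b + tau - a) * B).
  { apply CI_bound; [lra|apply Cint_cont; auto|auto]. }
  assert (K3 : Cmod (CI f (a + T) (b + T + tau)) <= (b + T + tau - (a + T)) * B).
  { apply CI_bound; [lra|apply Cint_cont; auto|auto]. }
  assert (E : (CI f a (a + T) = CI f a (b + tau) + CI f (b + tau) (b + T + tau) - CI f (a + T) (b + T + tau))%C).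
  { rewrite CI_Chasles by (apply Cint_cont; auto).
    rewrite <- (CI_Chasles f a (a + T) (b + T + tau)) by (apply Cint_cont; auto). ring. }
  rewrite E.
  match goal with |- Cmod ?z <= _ => replace z with
      ((CI f (b + tau)%R (b + T + tau)%R - CI f b (b + T)%R) +
       (CI f a (b + tau)%R - CI f (a + T)%R (b + T + tau)%R))%C by ring end.
  eapply Rle_trans; [apply Cmod_triangle|].
  assert (K4 : Cmod (CI f a (b + tau)%R - CI f (a + T)%R (b + T + tau)%R) <= l * B + l * B).
  { eapply Rle_trans; [apply Cmod_triangle|]. rewrite Cmod_opp.
    assert ((b + tau - a) * B <= l * B) by (apply Rmult_le_compat_r; lra).
    assert ((b + T + tau - (a + T)) * B <= l * B) by (apply Rmult_le_compat_r; lra). lra. }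
  lra.
Qed.

(** Completeness for a relation between tolerances and approximations: sampling at tolerances
    $1/(n+1)$ gives a Cauchy sequence, and its limit is then within [e] of every approximation of
    tolerance [e]. *)
Lemma C_complete_family (P : R -> C -> Prop) :
  (forall e, 0 < e -> exists m, P e m) ->
  (forall e e' m m', 0 < e -> 0 < e' -> P e m -> P e' m' -> Cmod (m - m') <= e + e') ->
  exists m0, forall e m, 0 < e -> P e m -> Cmod (m - m0) <= e.
Proof.
  intros Hex Hc.
  assert (Hn : forall n, 0 < / (INR n + 1)).
  { intros n. apply Rinv_0_lt_compat. generalize (pos_INR n); lra. }
  assert (Hsm : forall d, 0 < d -> exists N, forall n, (N <= n)%nat -> / (INR n + 1) < d).
  { intros d Hd. destruct (nfloor_ex (/ d)) as [N HN]; [apply Rlt_le, Rinv_0_lt_compat; auto|].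
    exists N. intros n Hn'. apply le_INR in Hn'. rewrite <- (Rinv_inv d).
    apply Rinv_lt_contravar; [|lra]. apply Rmult_lt_0_compat; [apply Rinv_0_lt_compat; auto|].
    generalize (pos_INR n); lra. }
  set (u := fun n => epsilon (inhabits (RtoC 0)) (P (/ (INR n + 1)))).
  assert (Hu : forall n, P (/ (INR n + 1)) (u n)).
  { intros n. apply epsilon_spec, Hex, Hn. }
  assert (Hcau : forall eps : posreal, exists N, forall n m, (N <= n)%nat -> (N <= m)%nat ->
    Cmod (u n - u m) < eps).
  { intros eps. destruct (Hsm (eps / 2)) as [N HN]; [generalize (cond_pos eps); lra|].
    exists N. intros n m H1 H2. eapply Rle_lt_trans; [apply (Hc _ _ _ _ (Hn n) (Hn m)); auto|].
    specialize (HN n H1) as K1. specialize (HN m H2) as K2. lra. }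
  assert (Hre : ex_finite_lim_seq (fun n => Re (u n))).
  { apply ex_lim_seq_cauchy_corr. intros eps. destruct (Hcau eps) as [N HN]. exists N. intros n m H1 H2.
    eapply Rle_lt_trans; [|apply (HN n m); auto]. apply (re_le_Cmod (u n - u m)%C). }
  assert (Him : ex_finite_lim_seq (fun n => Im (u n))).
  { apply ex_lim_seq_cauchy_corr. intros eps. destruct (Hcau eps) as [N HN]. exists N. intros n m H1 H2.
    eapply Rle_lt_trans; [|apply (HN n m); auto]. apply (im_le_Cmod (u n - u m)%C). }
  destruct Hre as [x Hx]. destruct Him as [y Hy].
  exists (x, y). intros e m He Hm. apply le_epsilon. intros d Hd.
  apply is_lim_seq_spec in Hx. apply is_lim_seq_spec in Hy.
  assert (Hd4 : 0 < d / 4) by lra.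
  destruct (Hx (mkposreal _ Hd4)) as [N1 H1]. destruct (Hy (mkposreal _ Hd4)) as [N2 H2].
  destruct (Hsm (d / 4) Hd4) as [N3 H3].
  set (n := (N1 + N2 + N3)%nat).
  specialize (H1 n ltac:(unfold n; lia)). specialize (H2 n ltac:(unfold n; lia)).
  specialize (H3 n ltac:(unfold n; lia)). simpl in H1, H2.
  assert (K1 := Hc _ _ _ _ He (Hn n) Hm (Hu n)).
  assert (K2 : Cmod (u n - (x, y)) <= d / 4 + d / 4).
  { eapply Rle_trans; [apply Cmod_le_re_im|]. simpl. unfold Re, Im in *. unfold Rminus in *. lra. }
  eapply Rle_trans; [apply (Cmod_triangle_sub _ (u n))|]. lra.
Qed.

(** By [CAP_window] the average over a single long window represents all windows of that length, and
    by [mean_window] all much longer ones. Such averages form a Cauchy family, whose limit is the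
    mean. *)
Lemma CAP_mean f : CAP f -> exists m, is_mean f m.
Proof.
  intros Hf. destruct (TB_bounded f (proj2 Hf)) as [B [HB Hb]].
  set (P := fun e m => exists T0, 0 < T0 /\ forall T, T0 <= T -> forall a,
    Cmod (CI f a (a + T) - RtoC T * m) <= e * T).
  assert (Hex : forall e, 0 < e -> exists m, P e m).
  { intros e He. destruct (CAP_window f (e / 2) Hf) as [T [HT HW]]; [lra|].
    assert (HTC : RtoC T <> RtoC 0) by (intros E; apply (f_equal fst) in E; simpl in E; lra).
    exists (CI f 0 (0 + T) / RtoC T)%C.
    replace e with (2 * (e / 2)) by field.
    exists (2 * T * B / (e / 2)). split.
    { apply Rdiv_lt_0_compat; [|lra]. assert (0 < T * B) by (apply Rmult_lt_0_compat; auto). lra. }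
    apply (mean_window f B _ T (e / 2) (proj1 Hf) Hb HT); [lra|lra| |].
    - intros a. replace (RtoC T * (CI f 0 (0 + T)%R / RtoC T))%C with (CI f 0 (0 + T)%R) by (field; auto).
      apply HW; lra.
    - rewrite Cmod_div by auto. rewrite Cmod_R, Rabs_pos_eq by lra.
      apply Rmult_le_reg_r with T; auto. unfold Rdiv. rewrite Rmult_assoc, Rinv_l, Rmult_1_r by lra.
      replace (B * T) with ((0 + T - 0) * B) by ring.
      apply CI_bound; [lra|apply Cint_cont, Hf|auto]. }
  assert (Hc : forall e e' m m', 0 < e -> 0 < e' -> P e m -> P e' m' -> Cmod (m - m') <= e + e').
  { intros e e' m m' He He' [T1 [H1 K1]] [T2 [H2 K2]].
    assert (B1 := Rmax_l T1 T2). assert (B2 := Rmax_r T1 T2). set (T := Rmax T1 T2) in *.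
    specialize (K1 T B1 0). specialize (K2 T B2 0).
    assert (K3 : Cmod (RtoC T * m - RtoC T * m') = T * Cmod (m - m')).
    { replace (RtoC T * m - RtoC T * m')%C with (RtoC T * (m - m'))%C by ring.
      rewrite Cmod_mult, Cmod_R, Rabs_pos_eq; lra. }
    assert (K4 := Cmod_triangle_sub (RtoC T * m) (CI f 0 (0 + T)) (RtoC T * m')).
    rewrite (Cmod_sub_sym (RtoC T * m) (CI f 0 (0 + T))) in K4.
    apply Rmult_le_reg_l with T; lra. }
  destruct (C_complete_family P Hex Hc) as [m0 Hm0].
  exists m0. intros eps Heps. destruct (Hex (eps / 2)) as [m Hm]; [lra|].
  specialize (Hm0 (eps / 2) m ltac:(lra) Hm).
  destruct Hm as [T0 [H0 K]]. exists T0; split; auto. intros T HT a. specialize (K T HT a).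
  replace (CI f a (a + T)%R - RtoC T * m0)%C with
    ((CI f a (a + T)%R - RtoC T * m) + RtoC T * (m - m0))%C by ring.
  eapply Rle_trans; [apply Cmod_triangle|]. rewrite Cmod_mult, Cmod_R, Rabs_pos_eq by lra.
  assert (T * Cmod (m - m0) <= T * (eps / 2)) by (apply Rmult_le_compat_l; lra). lra.
Qed.

Lemma mean_unif_limit g (m : C) : Ccont g ->
  (forall eps, 0 < eps -> exists h n, Ccont h /\ is_mean h n /\ Cmod (n - m) <= eps /\
     forall t, Cmod (g t - h t) <= eps) -> is_mean g m.
Proof.
  intros Cg H eps Heps. destruct (H (eps / 3)) as [h [n [Ch [Hn [Hnm Hgh]]]]]; [lra|].
  destruct (Hn (eps / 3)) as [T0 [H0 K]]; [lra|]. exists T0; split; auto. intros T HT a.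
  specialize (K T HT a).
  assert (K2 : Cmod (CI g a (a + T) - CI h a (a + T)) <= T * (eps / 3)).
  { rewrite <- CI_minus by (apply Cint_cont; auto).
    replace T with (a + T - a) at 2 by ring.
    apply CI_bound; [lra| |auto]. apply Cint_cont, Ccont_minus; auto. }
  replace (CI g a (a + T)%R - RtoC T * m)%C with
    ((CI g a (a + T)%R - CI h a (a + T)%R) + ((CI h a (a + T)%R - RtoC T * n) + RtoC T * (n - m)))%C by ring.
  eapply Rle_trans; [apply Cmod_triangle|].
  assert (K3 := Cmod_triangle (CI h a (a + T)%R - RtoC T * n) (RtoC T * (n - m))).
  rewrite Cmod_mult, Cmod_R, (Rabs_pos_eq T) in K3 by lra.
  assert (T * Cmod (n - m) <= T * (eps / 3)) by (apply Rmult_le_compat_l; lra). lra.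
Qed.

(** Translation by the half period [PI / l] changes the sign of the function but not its mean, so
    the mean equals its own negative. *)
Lemma mean_cis l : l <> 0 -> is_mean (fun t => cis (l * t)) (RtoC 0).
Proof.
  intros Hl. destruct (CAP_mean _ (CAP_cis0 l)) as [m Hm].
  assert (E : m = RtoC 0); [|rewrite <- E; auto].
  assert (H1 := mean_shift _ m (PI / l) (Ccont_cis0 l) Hm).
  assert (H2 := mean_scal (RtoC (-1)) _ m (Ccont_cis0 l) Hm).
  assert (E : m = (RtoC (-1) * m)%C).
  { apply (mean_unique (fun t => RtoC (-1) * cis (l * t))%C); auto.
    apply mean_ext with (2 := H1). intros t.
    replace (l * (t + PI / l)) with (l * t + PI) by (field; auto).
    unfold cis. rewrite neg_cos, neg_sin. apply C_ext; simpl; ring. }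
  destruct m as [x y]. injection E; intros. apply C_ext; simpl; lra.
Qed.

(** * The discrete Fourier transform *)

Lemma cis_period_nat (n : nat) : cis (2 * PI * INR n) = RtoC 1.
Proof.
  replace (2 * PI * INR n) with (0 + 2 * INR n * PI) by ring.
  rewrite cis_2PI_nat. apply cis_0.
Qed.

Lemma cis_neq_1 th : th <> 0 -> Rabs th < 2 * PI -> cis th <> RtoC 1.
Proof.
  intros H0 H E. assert (Hc : cos th = 1) by exact (f_equal fst E).
  replace th with (2 * (th / 2)) in Hc by field. rewrite cos_2a_sin in Hc.
  assert (Hs : sin (th / 2) = 0) by nra.
  apply Rabs_def2 in H.
  destruct (Rtotal_order th 0) as [Hl|[He|Hg]]; [|auto|].
  - assert (K := sin_gt_0 (- (th / 2))). rewrite sin_neg in K. lra.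
  - assert (K := sin_gt_0 (th / 2)). lra.
Qed.

Lemma geometric_cis th (N : nat) :
  ((cis th - RtoC 1) * Csum N (fun j => cis (INR j * th)))%C = (cis (INR N * th) - RtoC 1)%C.
Proof.
  induction N; simpl Csum.
  - rewrite Rmult_0_l, cis_0. ring.
  - rewrite Cmult_plus_distr_l, IHN, S_INR, Rmult_plus_distr_r, Rmult_1_l, cis_plus. ring.
Qed.

Lemma Cmult_integral_l (z w : C) : (z * w)%C = RtoC 0 -> z <> RtoC 0 -> w = RtoC 0.
Proof.
  intros E Hz. replace w with (/ z * (z * w))%C by (field; auto). rewrite E. ring.
Qed.

Lemma dft_orthogonal N k l : (k < N)%nat -> (l < N)%nat -> k <> l ->
  Csum N (fun j => cis (INR j * (2 * PI * (INR k - INR l) / INR N))) = RtoC 0.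
Proof.
  intros Hk Hl Hkl. set (th := 2 * PI * (INR k - INR l) / INR N).
  assert (HN : 0 < INR N) by (apply lt_0_INR; lia).
  assert (HP := PI_RGT_0).
  assert (H1 := lt_INR _ _ Hk). assert (H2 := lt_INR _ _ Hl).
  assert (H3 := pos_INR k). assert (H4 := pos_INR l).
  assert (H5 : INR k <> INR l) by (intros E; apply Hkl, INR_eq; auto).
  apply Cmult_integral_l with (cis th - RtoC 1)%C.
  - rewrite geometric_cis. unfold th.
    replace (INR N * (2 * PI * (INR k - INR l) / INR N)) with (2 * PI * INR k + - (2 * PI * INR l)) by (field; lra).
    rewrite cis_plus, cis_opp, !cis_period_nat. apply C_ext; simpl; ring.
  - intros E. apply (cis_neq_1 th).
    + unfold th. intros E2. assert (E3 : 2 * PI * (INR k - INR l) = 0).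
      { replace (2 * PI * (INR k - INR l)) with (2 * PI * (INR k - INR l) / INR N * INR N) by (field; lra).
        rewrite E2; ring. }
      apply Rmult_integral in E3. lra.
    + unfold th. unfold Rdiv. rewrite !Rabs_mult, (Rabs_pos_eq 2), (Rabs_pos_eq PI), (Rabs_pos_eq (/ INR N))
        by (try lra; apply Rlt_le, Rinv_0_lt_compat; auto).
      rewrite Rmult_assoc. rewrite <- (Rmult_1_r (2 * PI)) at 2.
      apply Rmult_lt_compat_l; [lra|].
      apply Rmult_lt_reg_r with (INR N); auto.
      rewrite Rmult_assoc, Rinv_l, Rmult_1_l, Rmult_1_r by lra. apply Rabs_def1; lra.
    + replace (cis th) with ((cis th - RtoC 1) + RtoC 1)%C by ring. rewrite E. ring.
Qed.

(** The factor [/ INR N] makes these averages against characters, the discrete analogue of Fourier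
    coefficients. Hence the same factor stands on one side of [plancherel] only. *)
Definition dft (N : nat) (y : nat -> C) (j : nat) : C :=
  (RtoC (/ INR N) * Csum N (fun k => y k * cis (- (2 * PI * INR j * INR k / INR N))))%C.

Lemma Csum_Csum_mult n m F G :
  (Csum n F * Csum m G)%C = Csum n (fun i => Csum m (fun j => F i * G j)%C).
Proof.
  induction n; simpl; [ring|]. rewrite <- IHn, Csum_scal. ring.
Qed.

Lemma plancherel N y : (0 < N)%nat ->
  Rsum N (fun j => Cmod (dft N y j) ^ 2) = / INR N * Rsum N (fun k => Cmod (y k) ^ 2).
Proof.
  intros HN0. assert (HN : 0 < INR N) by (apply lt_0_INR; lia).
  apply RtoC_inj. rewrite RtoC_mult, !RtoC_Rsum.
  set (w := fun k l => (y k * Cconj (y l))%C).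
  transitivity (RtoC (/ INR N * / INR N) *
    Csum N (fun k => Csum N (fun l => w k l * Csum N (fun j => cis (INR j * (2 * PI * (INR l - INR k) / INR N))))))%C.
  - rewrite <- Csum_scal.
    transitivity (Csum N (fun j => Csum N (fun k => Csum N (fun l =>
      RtoC (/ INR N * / INR N) * (w k l * cis (INR j * (2 * PI * (INR l - INR k) / INR N))))))%C).
    + apply Csum_ext. intros j Hj. rewrite Cmod2_conj. unfold dft.
      rewrite Cmult_conj, Cconj_Csum.
      replace (Cconj (RtoC (/ INR N))) with (RtoC (/ INR N)) by (apply C_ext; simpl; ring).
      match goal with |- (?a * ?b * (?a * ?c))%C = _ => replace (a * b * (a * c))%C with (a * a * (b * c))%C by ring end.
      rewrite Csum_Csum_mult, <- RtoC_mult, <- Csum_scal. apply Csum_ext. intros k Hk.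
      rewrite <- Csum_scal. apply Csum_ext. intros l Hl. f_equal.
      rewrite Cmult_conj, <- cis_opp, Ropp_involutive. unfold w.
      replace (INR j * (2 * PI * (INR l - INR k) / INR N)) with
        (- (2 * PI * INR j * INR k / INR N) + 2 * PI * INR j * INR l / INR N) by (field; lra).
      rewrite cis_plus. ring.
    + rewrite Csum_swap. apply Csum_ext. intros k Hk. rewrite Csum_swap, <- Csum_scal.
      apply Csum_ext. intros l Hl. rewrite <- !Csum_scal. reflexivity.
  - rewrite RtoC_mult, <- !Csum_scal. apply Csum_ext. intros k Hk.
    rewrite (Csum_single N _ k Hk).
    + unfold w. rewrite (Csum_ext N _ (fun _ => RtoC 1)).
      * rewrite Csum_const, Cmod2_conj, RtoC_inv by lra. field.
        intros E; apply (f_equal fst) in E; simpl in E; lra.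
      * intros j Hj. replace (INR j * (2 * PI * (INR k - INR k) / INR N)) with 0 by (field; lra). apply cis_0.
    + intros l Hl Hkl. rewrite dft_orthogonal by auto. ring.
Qed.

Lemma Csum_periodic_shift N F m : (forall k, F (k + N)%nat = F k) ->
  Csum N (fun k => F (k + m)%nat) = Csum N F.
Proof.
  intros HF. induction m.
  - apply Csum_ext. intros; rewrite Nat.add_0_r; auto.
  - rewrite <- IHm.
    assert (K := Csum_shift1 N (fun k => F (k + m)%nat)). simpl in K.
    rewrite (Nat.add_comm N m), HF in K.
    rewrite (Csum_ext N _ (fun k => F (S (k + m)))) by (intros; f_equal; lia).
    replace (Csum N (fun k => F (k + m)%nat)) with
      ((Csum N (fun k => F (k + m)%nat) + F m) - F m)%C by ring.
    rewrite K. ring.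
Qed.

(** As a function of the shift [m], the cyclic correlation has the transform [dft N X j] times the
    conjugate of [dft N Y j]. Plancherel's identity on both sides turns a uniform bound for the
    first factor into a mean square bound. [Y] is read on one period only, so periodicity concerns
    [X] alone. *)
Lemma dft_correlation N X Y M : (0 < N)%nat -> (forall k, X (k + N)%nat = X k) ->
  (forall j, (j < N)%nat -> Cmod (dft N X j) <= M) ->
  / INR N * Rsum N (fun m =>
    Cmod (RtoC (/ INR N) * Csum N (fun k => X (k + m)%nat * Cconj (Y k)))%C ^ 2)
  <= M ^ 2 * (/ INR N * Rsum N (fun k => Cmod (Y k) ^ 2)).
Proof.
  intros HN0 HX HM. assert (HN : 0 < INR N) by (apply lt_0_INR; lia).
  rewrite <- !plancherel by auto. rewrite <- Rsum_scal. apply Rsum_le. intros j Hj.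
  assert (E : dft N (fun m => RtoC (/ INR N) * Csum N (fun k => X (k + m)%nat * Cconj (Y k)))%C j =
              (dft N X j * Cconj (dft N Y j))%C).
  { unfold dft at 1.
    transitivity (RtoC (/ INR N) * Csum N (fun m => Csum N (fun k =>
      RtoC (/ INR N) * (Cconj (Y k) * (X (k + m)%nat * cis (- (2 * PI * INR j * INR m / INR N)))))))%C.
    { f_equal. apply Csum_ext. intros m Hm. rewrite Csum_scal.
      rewrite <- Cmult_assoc. f_equal. rewrite Cmult_comm, <- Csum_scal. apply Csum_ext; intros; ring. }
    rewrite Csum_swap.
    unfold dft at 2. rewrite Cmult_conj, Cconj_Csum.
    replace (Cconj (RtoC (/ INR N))) with (RtoC (/ INR N)) by (apply C_ext; simpl; ring).
    match goal with |- _ = (?a * (?b * ?c))%C => replace (a * (b * c))%C with (b * (a * c))%C by ring end.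
    f_equal. rewrite <- Csum_scal. apply Csum_ext. intros k Hk.
    rewrite Csum_scal, Csum_scal, Cmult_conj, <- cis_opp, Ropp_involutive. unfold dft.
    rewrite <- (Csum_periodic_shift N
      (fun m => X m * cis (- (2 * PI * INR j * INR m / INR N)))%C k).
    - transitivity (RtoC (/ INR N) * (Cconj (Y k) * (cis (2 * PI * INR j * INR k / INR N) *
        Csum N (fun m => X (m + k)%nat * cis (- (2 * PI * INR j * INR (m + k) / INR N))))))%C; [|ring].
      f_equal. f_equal. rewrite <- Csum_scal. apply Csum_ext. intros m Hm.
      rewrite plus_INR, (Nat.add_comm k m).
      replace (- (2 * PI * INR j * INR m / INR N)) with
        (2 * PI * INR j * INR k / INR N + - (2 * PI * INR j * (INR m + INR k) / INR N)) by (field; lra).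
      rewrite cis_plus. ring.
    - intros m. rewrite HX, plus_INR. f_equal.
      replace (- (2 * PI * INR j * (INR m + INR N) / INR N)) with
        (- (2 * PI * INR j * INR m / INR N) + - (2 * PI * INR j)) by (field; lra).
      rewrite cis_plus, cis_opp, cis_opp, cis_period_nat. apply C_ext; simpl; ring. }
  rewrite E, Cmod_mult, Cmod_conj, Rpow_mult_distr.
  apply Rmult_le_compat_r; [apply pow2_ge_0|]. apply pow_incr. split; auto using Cmod_ge_0.
Qed.

(** * Riemann sums and exponential sums *)

Lemma Cmod_cis_sub_1 x : Cmod (cis x - RtoC 1) <= Rabs x.
Proof.
  assert (E : Cmod (cis x - RtoC 1) ^ 2 = (2 * sin (x / 2)) ^ 2).
  { rewrite Cmod2_alt. simpl.
    replace (cos x) with (1 - 2 * sin (x / 2) * sin (x / 2)) by (rewrite <- cos_2a_sin; f_equal; field).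
    replace (sin x) with (2 * sin (x / 2) * cos (x / 2)) by (rewrite <- sin_2a; f_equal; field).
    assert (K := sin2_cos2 (x / 2)). unfold Rsqr in K.
    transitivity (4 * (sin (x / 2) * sin (x / 2)) * (sin (x / 2) * sin (x / 2) + cos (x / 2) * cos (x / 2))).
    - ring.
    - rewrite K. ring. }
  assert (Hp : forall y, 0 < y -> Rabs (sin y) <= y).
  { intros y Hy. assert (K1 := sin_lt_x y Hy). apply Rabs_le. split; [|lra].
    destruct (Rle_dec y PI).
    - assert (0 <= sin y) by (apply sin_ge_0; lra). lra.
    - assert (H1 := SIN_bound y). assert (H2 := PI2_1). lra. }
  assert (Hs : Rabs (sin (x / 2)) <= Rabs (x / 2)).
  { destruct (Rtotal_order x 0) as [H|[->|H]].
    - rewrite (Rabs_left (x / 2)), <- Rabs_Ropp, <- sin_neg by lra. apply Hp; lra.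
    - replace (0 / 2) with 0 by field. rewrite sin_0. lra.
    - rewrite (Rabs_pos_eq (x / 2)) by lra. apply Hp; lra. }
  assert (E2 : Cmod (cis x - RtoC 1) = Rabs (2 * sin (x / 2))).
  { rewrite <- sqrt_Rsqr_abs, <- (sqrt_Rsqr (Cmod _)) by apply Cmod_ge_0.
    f_equal. unfold Rsqr. simpl in E. lra. }
  rewrite E2, Rabs_mult, (Rabs_pos_eq 2) by lra.
  unfold Rdiv in Hs. rewrite (Rabs_mult x), (Rabs_pos_eq (/ 2)) in Hs by lra. fold (x / 2) in Hs. lra.
Qed.

Lemma Cmod_cis_sub x y : Cmod (cis x - cis y) <= Rabs (x - y).
Proof.
  replace (cis x - cis y)%C with (cis y * (cis (x - y) - RtoC 1))%C.
  - rewrite Cmod_mult, Cmod_cis, Rmult_1_l. apply Cmod_cis_sub_1.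
  - replace (cis x) with (cis (y + (x - y))) by (f_equal; ring). rewrite cis_plus. ring.
Qed.

Lemma Riemann_sum (F : R -> C) N d e : Ccont F -> 0 < d ->
  (forall s t, 0 <= t - s <= d -> Cmod (F t - F s) <= e) ->
  forall a, Cmod (RtoC d * Csum N (fun k => F (INR k * d + a)) - CI F a (a + INR N * d)) <= INR N * d * e.
Proof.
  intros CF Hd H a. induction N.
  - simpl. rewrite Rmult_0_l, Rplus_0_r, CI_point.
    replace (RtoC d * RtoC 0 - RtoC 0)%C with (RtoC 0) by ring. rewrite Cmod_0. lra.
  - rewrite S_INR. simpl Csum.
    rewrite <- (CI_Chasles F a (a + INR N * d)) by (apply Cint_cont; auto).
    assert (K : Cmod (CI (fun t => F t - F (INR N * d + a)%R)%C (a + INR N * d) (a + (INR N + 1) * d))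
      <= (a + (INR N + 1) * d - (a + INR N * d)) * e).
    { apply CI_bound.
      - nra.
      - apply Cint_cont, Ccont_minus; auto. apply Ccont_const.
      - intros t Ht. apply H. lra. }
    rewrite CI_minus, CI_const in K by (apply Cint_cont; auto; apply Ccont_const).
    replace (a + (INR N + 1) * d - (a + INR N * d)) with d in K by ring.
    match goal with |- Cmod ?z <= _ => replace z with
      ((RtoC d * Csum N (fun k => F (INR k * d + a)%R) - CI F a (a + INR N * d)%R) -
       (CI F (a + INR N * d)%R (a + (INR N + 1) * d)%R - RtoC d * F (INR N * d + a)%R))%C by ring end.
    eapply Rle_trans; [apply Cmod_triangle|]. rewrite Cmod_opp. lra.
Qed.

Lemma Csum_shift_bound N F q B : (forall k, Cmod (F k) <= B) ->
  Cmod (Csum N (fun k => F (k + q)%nat) - Csum N F) <= 2 * INR q * B.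
Proof.
  intros HB. induction q.
  - rewrite (Csum_ext N (fun k => F (k + 0)%nat) F) by (intros; rewrite Nat.add_0_r; auto).
    replace (Csum N F - Csum N F)%C with (RtoC 0) by ring. rewrite Cmod_0. simpl; lra.
  - rewrite S_INR.
    assert (K := Csum_shift1 N (fun k => F (k + q)%nat)). simpl in K.
    rewrite (Csum_ext N _ (fun k => F (S (k + q)))) by (intros; f_equal; lia).
    replace (Csum N (fun k => F (S (k + q))) - Csum N F)%C with
      ((Csum N (fun k => F (k + q)%nat) - Csum N F) + (F (N + q)%nat - F q))%C.
    + eapply Rle_trans; [apply Cmod_triangle|].
      assert (K2 : Cmod (F (N + q)%nat - F q) <= B + B).
      { eapply Rle_trans; [apply Cmod_triangle|]. rewrite Cmod_opp. apply Rplus_le_compat; auto. }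
      lra.
    + replace (Csum N (fun k => F (S (k + q)))) with
        ((F q + Csum N (fun k => F (S (k + q)))) - F q)%C by ring.
      rewrite <- K. ring.
Qed.

(** Comparing the sum with its translate by [q] steps, where [q * |th|] lies in [[PI/2, 3PI/2]],
    so that [|1 - e^(-i q th)| >= 1]. *)
Lemma exp_sum_high (g : R -> C) B d D e : 0 < d -> (forall t, Cmod (g t) <= B) ->
  (forall s t, Rabs (s - t) < D -> Cmod (g s - g t) <= e) ->
  forall th N, 0 < Rabs th <= PI -> PI / 2 * d / Rabs th + d < D ->
    Cmod (Csum N (fun k => g (INR k * d)%R * cis (- (INR k * th)))%C) <=
    2 * (D / d) * B + INR N * e.
Proof.
  intros Hd HB Hu th N Hth HD. assert (HP := PI_RGT_0).
  assert (HB0 : 0 <= B) by (eapply Rle_trans; [apply Cmod_ge_0|apply (HB 0)]).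
  assert (Hq : exists q : nat, PI / 2 <= INR q * Rabs th <= PI / 2 + Rabs th).
  { destruct (nfloor_ex (PI / 2 / Rabs th)) as [n Hn].
    { apply Rlt_le, Rdiv_lt_0_compat; lra. }
    exists (S n). rewrite S_INR.
    assert (E : PI / 2 / Rabs th * Rabs th = PI / 2) by (field; lra). nra. }
  destruct Hq as [q Hq].
  assert (Hqd : INR q * d < D).
  { apply Rle_lt_trans with (2 := HD). apply Rmult_le_reg_r with (Rabs th); [lra|].
    replace ((PI / 2 * d / Rabs th + d) * Rabs th) with ((PI / 2 + Rabs th) * d) by (field; lra). nra. }
  set (F := fun k => (g (INR k * d)%R * cis (- (INR k * th)))%C).
  assert (HF : forall k, Cmod (F k) <= B).
  { intros k. unfold F. rewrite Cmod_mult, Cmod_cis, Rmult_1_r; auto. }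
  set (z := cis (- (INR q * th))).
  assert (Hz : 1 <= Cmod (RtoC 1 - z)).
  { eapply Rle_trans; [|apply re_bound]. simpl. unfold z, Re; simpl. rewrite cos_neg.
    assert (Hc : cos (INR q * th) <= 0).
    { replace (cos (INR q * th)) with (cos (INR q * Rabs th)).
      - apply cos_le_0; lra.
      - unfold Rabs. destruct Rcase_abs; [|auto]. rewrite <- cos_neg. f_equal; ring. }
    lra. }
  (* The translated sum differs from the original by [q] terms at each end. What remains is the
     variation of [g] over the distance [q * d], which is less than [D]. *)
  assert (E : ((RtoC 1 - z) * Csum N F =
     - (Csum N (fun k => F (k + q)%nat) - Csum N F) +
     Csum N (fun k => (g (INR (k + q) * d)%R - g (INR k * d)%R) * cis (- (INR (k + q) * th))))%C).
  { transitivity (Csum N F - z * Csum N F)%C; [ring|].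
    rewrite <- Csum_scal.
    rewrite (Csum_ext N (fun k => z * F k)%C (fun k => F (k + q)%nat +
      RtoC (-1) * ((g (INR (k + q) * d)%R - g (INR k * d)%R) * cis (- (INR (k + q) * th))))%C).
    - rewrite Csum_plus, Csum_scal, RtoC_m1. ring.
    - intros k Hk. unfold F, z. rewrite RtoC_m1, plus_INR.
      replace (- ((INR k + INR q) * th)) with (- (INR q * th) + - (INR k * th)) by ring.
      rewrite cis_plus. ring. }
  apply Rle_trans with (Cmod ((RtoC 1 - z) * Csum N F)%C).
  { rewrite Cmod_mult. assert (K := Cmod_ge_0 (Csum N F)). nra. }
  rewrite E. eapply Rle_trans; [apply Cmod_triangle|]. rewrite Cmod_opp.
  apply Rplus_le_compat.
  - eapply Rle_trans; [apply (Csum_shift_bound N F q B HF)|].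
    apply Rmult_le_compat_r; auto. apply Rmult_le_compat_l; [lra|].
    apply Rmult_le_reg_r with d; auto. unfold Rdiv. rewrite Rmult_assoc, Rinv_l; lra.
  - apply Cmod_Csum_le. intros k Hk. rewrite Cmod_mult, Cmod_cis, Rmult_1_r.
    apply Hu. rewrite plus_INR.
    replace ((INR k + INR q) * d - INR k * d) with (INR q * d) by ring.
    rewrite Rabs_pos_eq; auto. apply Rmult_le_pos; [apply pos_INR|lra].
Qed.

(** * Uniqueness: almost periodic functions with vanishing mean values *)

Definition twist (g : R -> C) (nu t : R) : C := (g t * cis (- nu * t))%C.

Lemma Ccont_twist g nu : Ccont g -> Ccont (twist g nu).
Proof. intros H. apply Ccont_mult; auto. apply Ccont_cis0. Qed.

Lemma CAP_twist g nu : CAP g -> CAP (twist g nu).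
Proof. intros H. apply CAP_mult; auto. apply CAP_cis0. Qed.

Lemma Cmod_twist g nu t : Cmod (twist g nu t) = Cmod (g t).
Proof. unfold twist. rewrite Cmod_mult, Cmod_cis; ring. Qed.

(** A window that is good for [nu0] stays good for nearby [nu]: once the phase at the left end of
    the window is split off, the two twists differ on it by at most [B * |nu - nu0| * T0].
    Compactness of [[-L, L]] then bounds the windows needed. *)
Lemma low_frequency_uniform g B : Ccont g -> 0 < B -> (forall t, Cmod (g t) <= B) ->
  (forall nu, is_mean (twist g nu) (RtoC 0)) ->
  forall e L, 0 < e -> exists T1, 0 < T1 /\ forall T nu, T1 <= T -> Rabs nu <= L ->
    Cmod (CI (twist g nu) 0 T) <= e * T.
Proof.
  intros Cg HB Hb Hm e L He.
  set (Q := fun nu T0 => 0 < T0 /\ forall a, Cmod (CI (twist g nu) a (a + T0)) <= e / 4 * T0).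
  assert (HQ : forall nu, exists T0, Q nu T0).
  { intros nu. destruct (Hm nu (e / 4)) as [T0 [H0 K]]; [lra|]. exists T0. split; auto.
    intros a. specialize (K T0 (Rle_refl _) a).
    replace (CI (twist g nu) a (a + T0)%R - RtoC T0 * RtoC 0)%C with (CI (twist g nu) a (a + T0)%R) in K by ring.
    auto. }
  set (tau := fun nu => epsilon (inhabits 0) (Q nu)).
  assert (Ht : forall nu, Q nu (tau nu)) by (intros; apply epsilon_spec, HQ).
  set (c := e / (4 * B)). assert (Hc : 0 < c) by (apply Rdiv_lt_0_compat; lra).
  assert (Hd : forall nu, 0 < c / tau nu).
  { intros nu. apply Rdiv_lt_0_compat; auto. apply Ht. }
  (* The gauge [c / tau nu] serves twice: closeness to [nu0] keeps the twists within [B * c = e / 4]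
     on the window, and the lower bound [d] for the gauge becomes the upper bound [c / d] for the
     window lengths. *)
  destruct (compactness_value_1d (- L) L (fun nu => mkposreal _ (Hd nu))) as [d HdL].
  assert (Hd0 := cond_pos d).
  assert (Hcd : 0 < c / d) by (apply Rdiv_lt_0_compat; auto).
  exists (2 * (c / d) * B / (e / 2)). split.
  { apply Rdiv_lt_0_compat; [|lra]. assert (0 < c / d * B) by (apply Rmult_lt_0_compat; auto). lra. }
  intros T nu HT Hnu. apply NNPP. intros Hneg.
  apply (HdL nu). { apply Rabs_le_between; auto. }
  intros [nu0 [_ [H1 H2]]]. simpl in H1, H2. apply Hneg.
  destruct (Ht nu0) as [Ht0 Hw]. set (T0 := tau nu0) in *.
  assert (HT0 : T0 <= c / d).
  { apply Rmult_le_reg_r with d; auto. unfold Rdiv at 1. rewrite Rmult_assoc, Rinv_l, Rmult_1_r by lra.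
    apply Rmult_le_compat_r with (r := T0) in H2; [|lra]. unfold Rdiv in H2.
    rewrite Rmult_assoc, Rinv_l, Rmult_1_r in H2 by lra. lra. }
  assert (HW : forall a, Cmod (CI (twist g nu) a (a + T0) - RtoC T0 * RtoC 0) <= e / 2 * T0).
  { intros a.
    assert (K : Cmod (CI (fun t => twist g nu t - cis (- (nu - nu0) * a) * twist g nu0 t)%C a (a + T0))
       <= (a + T0 - a) * (e / 4)).
    { apply CI_bound; [lra| |].
      - apply Cint_cont, Ccont_minus; [apply Ccont_twist; auto|].
        apply Ccont_mult; [apply Ccont_const|apply Ccont_twist; auto].
      - intros t Hta. unfold twist.
        replace (g t * cis (- nu * t) - cis (- (nu - nu0) * a) * (g t * cis (- nu0 * t)))%C with
          (g t * cis (- nu0 * t) * (cis (- (nu - nu0) * t) - cis (- (nu - nu0) * a)))%C.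
        + rewrite !Cmod_mult, Cmod_cis, Rmult_1_r.
          apply Rle_trans with (B * (c / T0 * T0)).
          * apply Rmult_le_compat; auto using Cmod_ge_0.
            eapply Rle_trans; [apply Cmod_cis_sub|].
            replace (- (nu - nu0) * t - - (nu - nu0) * a) with (- ((nu - nu0) * (t - a))) by ring.
            rewrite Rabs_Ropp, Rabs_mult. apply Rmult_le_compat; auto using Rabs_pos; [lra|].
            rewrite Rabs_pos_eq; lra.
          * unfold c. right. field. lra.
        + replace (- nu * t) with (- nu0 * t + - (nu - nu0) * t) by ring. rewrite cis_plus. ring. }
    rewrite CI_minus, CI_scal in K by auto using Cint_cont, Cint_scal, Ccont_twist.
    replace (CI (twist g nu) a (a + T0)%R - RtoC T0 * RtoC 0)%C with
      ((CI (twist g nu) a (a + T0)%R - cis (- (nu - nu0) * a) * CI (twist g nu0) a (a + T0)%R) +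
        cis (- (nu - nu0) * a) * CI (twist g nu0) a (a + T0)%R)%C by ring.
    eapply Rle_trans; [apply Cmod_triangle|]. rewrite Cmod_mult, Cmod_cis, Rmult_1_l.
    specialize (Hw a). lra. }
  assert (K := mean_window (twist g nu) B (RtoC 0) T0 (e / 2) (Ccont_twist g nu Cg)
    (fun t => eq_ind_r (fun x => x <= B) (Hb t) (Cmod_twist g nu t)) Ht0 ltac:(lra) HB HW).
  rewrite Cmod_0 in K. specialize (K ltac:(lra) T).
  replace (CI (twist g nu) 0 T) with (CI (twist g nu) 0 (0 + T) - RtoC T * RtoC 0)%C
    by (rewrite Rplus_0_l; ring).
  replace (e * T) with (2 * (e / 2) * T) by field. apply K.
  eapply Rle_trans; [|exact HT]. unfold Rdiv at 1 3. apply Rmult_le_compat_r; [apply Rlt_le, Rinv_0_lt_compat; lra|].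
  apply Rmult_le_compat_r; lra.
Qed.

(** Two regimes, separated at angular frequency [L = 2 * PI / D]. Above it a translation by less
    than [D] changes the phase enough for [exp_sum_high]; below it the sum is a Riemann sum of an
    integral that [low_frequency_uniform] makes small. The mesh is taken fine enough for both. *)
Lemma dft_small g : CAP g -> (forall nu, is_mean (twist g nu) (RtoC 0)) ->
  forall c, 0 < c -> exists T1, 0 < T1 /\ forall T, T1 <= T -> exists d0, 0 < d0 /\
    forall N, (0 < N)%nat -> T / INR N <= d0 -> forall j, (j < N)%nat ->
      Cmod (dft N (fun k => g (INR k * (T / INR N))%R) j) <= c.
Proof.
  intros Hg Hm c Hc. assert (HP := PI_RGT_0).
  destruct (TB_bounded g (proj2 Hg)) as [B [HB Hb]].
  destruct (TB_ucont g (proj1 Hg) (proj2 Hg) (c / 4)) as [D [HD Hu]]; [lra|].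
  set (L := 2 * PI / D). assert (HL : 0 < L) by (apply Rdiv_lt_0_compat; lra).
  destruct (low_frequency_uniform g B (proj1 Hg) HB Hb Hm (c / 2) L) as [Tb [HTb Hlow]]; [lra|].
  exists (Rmax Tb (8 * D * B / c)). split; [apply Rlt_le_trans with (1 := HTb), Rmax_l|].
  intros T HT.
  assert (HT1 : Tb <= T) by (eapply Rle_trans; [apply Rmax_l|exact HT]).
  assert (HT2 : 8 * D * B / c <= T) by (eapply Rle_trans; [apply Rmax_r|exact HT]).
  assert (HT2' : 8 * D * B <= T * c).
  { apply Rmult_le_compat_r with (r := c) in HT2; [|lra]. unfold Rdiv in HT2.
    rewrite Rmult_assoc, Rinv_l, Rmult_1_r in HT2; lra. }
  assert (HBL : 0 < B * L) by (apply Rmult_lt_0_compat; auto).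
  exists (Rmin (D / 4) (c / (4 * (B * L)))). split.
  { apply Rmin_pos; [lra|]. apply Rdiv_lt_0_compat; lra. }
  intros N HN0 Hd j Hj. assert (HN : 0 < INR N) by (apply lt_0_INR; lia).
  set (d := T / INR N) in *. assert (Hd0 : 0 < d) by (apply Rdiv_lt_0_compat; lra).
  assert (Hd1 : d <= D / 4) by (eapply Rle_trans; [exact Hd|apply Rmin_l]).
  assert (Hd2 : d <= c / (4 * (B * L))) by (eapply Rle_trans; [exact Hd|apply Rmin_r]).
  assert (Hd3 : B * L * d <= c / 4).
  { apply Rmult_le_compat_l with (r := B * L) in Hd2; [|lra].
    replace (B * L * (c / (4 * (B * L)))) with (c / 4) in Hd2 by (field; lra). auto. }
  assert (HNd : INR N * d = T) by (unfold d; field; lra).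
  set (th0 := 2 * PI * INR j / INR N).
  assert (Hth0 : 0 <= th0 <= 2 * PI).
  { unfold th0. assert (H1 := lt_INR _ _ Hj). assert (H2 := pos_INR j). split.
    - apply Rmult_le_pos; [|apply Rlt_le, Rinv_0_lt_compat; auto]. nra.
    - apply Rmult_le_reg_r with (INR N); auto. unfold Rdiv. rewrite Rmult_assoc, Rinv_l by lra. nra. }
  (* Indices [j] above [N / 2] are negative frequencies in disguise: at integer points the angle
     matters only modulo [2 * PI]. *)
  assert (Hth : exists th, Rabs th <= PI /\ forall k, cis (- (2 * PI * INR j * INR k / INR N)) = cis (- (INR k * th))).
  { destruct (Rle_dec th0 PI).
    - exists th0. split; [rewrite Rabs_pos_eq; lra|]. intros k. f_equal. unfold th0. field. lra.
    - exists (th0 - 2 * PI). split; [rewrite Rabs_left1; lra|]. intros k.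
      replace (- (INR k * (th0 - 2 * PI))) with (- (2 * PI * INR j * INR k / INR N) + 2 * INR k * PI)
        by (unfold th0; field; lra).
      rewrite cis_2PI_nat; auto. }
  destruct Hth as [th [Hth Ek]].
  assert (Ed : dft N (fun k => g (INR k * d)%R) j =
    (RtoC (/ INR N) * Csum N (fun k => g (INR k * d)%R * cis (- (INR k * th))))%C).
  { unfold dft. f_equal. apply Csum_ext. intros k Hk. rewrite Ek. reflexivity. }
  rewrite Ed, Cmod_mult, Cmod_R, Rabs_pos_eq by (apply Rlt_le, Rinv_0_lt_compat; auto).
  apply Rmult_le_reg_l with (INR N); auto. rewrite <- Rmult_assoc, Rinv_r, Rmult_1_l by lra.
  destruct (Rle_dec (L * d) (Rabs th)) as [Hhi|Hlo].
  - assert (Hth2 : 0 < Rabs th) by nra.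
    eapply Rle_trans.
    { apply (exp_sum_high g B d D (c / 4) Hd0 Hb Hu th N (conj Hth2 Hth)).
      assert (K : PI / 2 * d / Rabs th <= D / 4).
      { apply Rmult_le_reg_r with (Rabs th); auto. unfold Rdiv at 1.
        rewrite Rmult_assoc, Rinv_l, Rmult_1_r by lra.
        apply Rle_trans with (D / 4 * (L * d)); [|apply Rmult_le_compat_l; lra].
        right. unfold L. field. lra. }
      lra. }
    assert (2 * (D / d) * B <= INR N * (c / 4)); [|nra].
    apply Rmult_le_reg_r with d; auto.
    replace (2 * (D / d) * B * d) with (2 * D * B) by (field; lra).
    replace (INR N * (c / 4) * d) with (T * c / 4) by (rewrite <- HNd; field). lra.
  - set (nu := th / d).
    assert (Hnu : Rabs nu <= L).
    { unfold nu, Rdiv. rewrite Rabs_mult, (Rabs_pos_eq (/ d)) by (apply Rlt_le, Rinv_0_lt_compat; auto).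
      apply Rmult_le_reg_r with d; auto. rewrite Rmult_assoc, Rinv_l; lra. }
    assert (Et : forall k, (g (INR k * d)%R * cis (- (INR k * th)))%C = twist g nu (INR k * d + 0)).
    { intros k. unfold twist, nu. rewrite Rplus_0_r. f_equal. f_equal. field. lra. }
    rewrite (Csum_ext N _ (fun k => twist g nu (INR k * d + 0))) by auto.
    assert (K1 : forall s t, 0 <= t - s <= d -> Cmod (twist g nu t - twist g nu s) <= c / 2).
    { intros s t Hst. unfold twist.
      replace (g t * cis (- nu * t) - g s * cis (- nu * s))%C with
        (g t * (cis (- nu * t) - cis (- nu * s)) + (g t - g s) * cis (- nu * s))%C by ring.
      eapply Rle_trans; [apply Cmod_triangle|]. rewrite !Cmod_mult, Cmod_cis, Rmult_1_r.
      assert (Ka : Cmod (g t - g s) <= c / 4).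
      { apply Hu. rewrite Rabs_pos_eq; lra. }
      assert (Kb : Cmod (g t) * Cmod (cis (- nu * t) - cis (- nu * s)) <= B * (L * d)).
      { apply Rmult_le_compat; auto using Cmod_ge_0.
        eapply Rle_trans; [apply Cmod_cis_sub|].
        replace (- nu * t - - nu * s) with (- (nu * (t - s))) by ring.
        rewrite Rabs_Ropp, Rabs_mult. apply Rmult_le_compat; auto using Rabs_pos.
        rewrite Rabs_pos_eq; lra. }
      lra. }
    assert (K2 := Riemann_sum (twist g nu) N d (c / 2) (Ccont_twist g nu (proj1 Hg)) Hd0 K1 0).
    rewrite HNd, Rplus_0_l in K2.
    specialize (Hlow T nu HT1 Hnu).
    set (S := Csum N (fun k => twist g nu (INR k * d + 0))) in *.
    assert (K3 : Cmod (RtoC d * S) <= T * c).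
    { replace (RtoC d * S)%C with ((RtoC d * S - CI (twist g nu) 0 T) + CI (twist g nu) 0 T)%C by ring.
      eapply Rle_trans; [apply Cmod_triangle|]. lra. }
    rewrite Cmod_mult, Cmod_R, Rabs_pos_eq in K3 by lra.
    apply Rmult_le_reg_l with d; auto. nra.
Qed.

(** Any translation carries the large value at [t0] to within [D / 2] of the value of one of
    finitely many translates of [g]. The sum of these translates of $|g|^2$ is thus at least $D^2/4$
    everywhere, while its mean is [n] times [m]. *)
Lemma mean_sq_pos g t0 m : CAP g -> g t0 <> RtoC 0 -> is_mean (fun t => g t * Cconj (g t))%C m -> 0 < Re m.
Proof.
  intros Hg H0 Hm. assert (HD : 0 < Cmod (g t0)) by (apply Cmod_gt_0; auto).
  set (D := Cmod (g t0)) in *.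
  destruct (proj2 Hg (D / 2)) as [A HA]; [lra|].
  set (h := fun t => (g t * Cconj (g t))%C) in *.
  assert (Ch : Ccont h) by (apply Ccont_mult; [|apply Ccont_conj]; apply Hg).
  set (n := length A).
  set (F := fun t => Csum n (fun i => h (t + nth i A 0))).
  assert (HF : is_mean (fun t => RtoC (-1) * F t)%C (RtoC (-1) * Csum n (fun _ => m))%C).
  { apply mean_scal.
    - apply Ccont_Csum. intros k. apply Ccont_comp_shift; auto.
    - apply (mean_Csum n (fun i t => h (t + nth i A 0))).
      + intros k. apply Ccont_comp_shift; auto.
      + intros k. apply mean_shift; auto. }
  apply (mean_re_le _ _ (- (D ^ 2 / 4))) in HF.
  - rewrite Csum_const in HF. simpl in HF.
    assert (Hn := pos_INR n).
    assert (E : Re (RtoC (-1) * (RtoC (INR n) * m))%C = - (INR n * Re m)) by (simpl; unfold Re; ring).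
    assert (HD2 : 0 < D ^ 2) by (apply pow_lt; auto).
    change (Re (RtoC (-1) * (RtoC (INR n) * m))%C <= - (D ^ 2 / 4)) in HF. rewrite E in HF.
    apply Rnot_le_lt. intros Hle. assert (INR n * Re m <= 0) by nra. lra.
  - apply Ccont_mult; [apply Ccont_const|]. apply Ccont_Csum. intros k. apply Ccont_comp_shift; auto.
  - intros t. destruct (HA (t0 - t)) as [b [Hb Hgb]]. specialize (Hgb t).
    replace (t + (t0 - t)) with t0 in Hgb by ring.
    assert (K1 : D / 2 <= Cmod (g (t + b))).
    { assert (K := Cmod_rev_triangle (g t0) (g (t + b))). fold D in K. lra. }
    assert (Eh : forall s, Re (h s) = Cmod (g s) ^ 2).
    { intros s. unfold h. rewrite <- Cmod2_conj. reflexivity. }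
    replace (Re (RtoC (-1) * F t)%C) with (- Re (F t)) by (simpl; unfold Re; ring).
    apply Ropp_le_contravar. unfold F. rewrite Re_Csum.
    destruct (In_nth A b 0 Hb) as [i [Hi Ei]].
    apply Rle_trans with (Re (h (t + nth i A 0))).
    + rewrite Eh, Ei. assert (0 <= D / 2) by lra. nra.
    + apply (Rsum_ge_term n (fun i => Re (h (t + nth i A 0)))); auto.
      intros k Hk. rewrite Eh. apply pow2_ge_0.
Qed.

(** Sample [g] at [N] points of a long almost period [T]. Finitely many translates [b_i] approximate
    all translates of [g], so for every shift [m] some correlation of [g] (shifted by [m]) with
    [g] (shifted by [b_i]) is close to the mean of [|g|^2]. By Plancherel the mean square over [m]
    of each correlation is at most [max_j |c_j|^2] times a constant, where the [c_j] are the
    discrete Fourier coefficients, and these are uniformly small. *)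
Theorem CAP_zero_means g : CAP g -> (forall nu, is_mean (twist g nu) (RtoC 0)) ->
  forall t, g t = RtoC 0.
Proof.
  intros Hg Hm t0. apply NNPP. intros H0.
  destruct (TB_bounded g (proj2 Hg)) as [B [HB Hb]].
  set (h := fun t => (g t * Cconj (g t))%C).
  assert (Hh : CAP h) by (apply CAP_mult, CAP_conj; auto).
  assert (Eh : forall s, h s = RtoC (Cmod (g s) ^ 2)).
  { intros s. unfold h. rewrite <- Cmod2_conj. reflexivity. }
  destruct (CAP_mean h Hh) as [m Hmh].
  assert (Hmu := mean_sq_pos g t0 m Hg H0 Hmh). set (mu := Re m) in *.
  destruct (Hmh (mu / 4)) as [T1 [HT1 HW]]; [lra|].
  (* Wrapping around the almost period and replacing a translate by a centre cost [eps * B] each,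
     together [mu / 16]. The Riemann sum and the mean value cost [mu / 2], so the correlation keeps
     a modulus above [mu / 4]. *)
  set (eps := mu / (32 * B)). assert (Heps : 0 < eps) by (apply Rdiv_lt_0_compat; lra).
  assert (EB : eps * B = mu / 32) by (unfold eps; field; lra).
  destruct (proj2 Hg eps Heps) as [A HA]. set (n := length A).
  (* The [n] mean square bounds together must stay below what each single shift contributes. The
     number [n] of translates is fixed before [T] and [N], so [c] may depend on it. *)
  assert (Hc : exists c, 0 < c /\ INR n * (c ^ 2 * B ^ 2) < (mu / 4) ^ 2).
  { assert (Hn := pos_INR n).
    exists (mu / (4 * B * (INR n + 1))).
    assert (Hd : 0 < 4 * B * (INR n + 1)) by (apply Rmult_lt_0_compat; lra).
    split; [apply Rdiv_lt_0_compat; auto|].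
    replace (INR n * ((mu / (4 * B * (INR n + 1))) ^ 2 * B ^ 2)) with
      ((mu / 4) ^ 2 * (INR n / (INR n + 1) ^ 2)) by (field; lra).
    rewrite <- (Rmult_1_r ((mu / 4) ^ 2)) at 2. apply Rmult_lt_compat_l; [apply pow_lt; lra|].
    apply Rmult_lt_reg_r with ((INR n + 1) ^ 2); [apply pow_lt; lra|].
    unfold Rdiv. rewrite Rmult_assoc, Rinv_l by (apply pow_nonzero; lra). nra. }
  destruct Hc as [c [Hc Hcn]].
  destruct (dft_small g Hg Hm c Hc) as [T2 [HT2 Hdft]].
  destruct (TB_ap g (proj2 Hg) eps Heps) as [l [Hl Hap]].
  destruct (Hap (Rmax T1 T2)) as [T [HT Hper]].
  assert (B1 := Rmax_l T1 T2). assert (B2 := Rmax_r T1 T2).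
  destruct (Hdft T ltac:(lra)) as [d0 [Hd0 Hsm]].
  destruct (TB_ucont h (proj1 Hh) (proj2 Hh) (mu / 4)) as [d1 [Hd1 Hu]]; [lra|].
  assert (HN : exists N : nat, (0 < N)%nat /\ T / INR N <= d0 /\ T / INR N < d1).
  { assert (Hmin : 0 < Rmin d0 d1) by (apply Rmin_pos; auto).
    destruct (nfloor_ex (T / Rmin d0 d1)) as [k Hk]; [apply Rlt_le, Rdiv_lt_0_compat; lra|].
    exists (S k). assert (HS : 0 < INR (S k)) by (apply lt_0_INR; lia).
    assert (K : T / INR (S k) < Rmin d0 d1).
    { apply Rmult_lt_reg_r with (INR (S k)); auto. unfold Rdiv.
      rewrite Rmult_assoc, Rinv_l, Rmult_1_r by lra. rewrite S_INR in *.
      replace T with (T / Rmin d0 d1 * Rmin d0 d1) at 1 by (field; lra). nra. }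
    assert (M1 := Rmin_l d0 d1). assert (M2 := Rmin_r d0 d1).
    split; [lia|]. lra. }
  destruct HN as [N [HN0 [HNd0 HNd1]]]. assert (HN : 0 < INR N) by (apply lt_0_INR; lia).
  specialize (Hsm N HN0 HNd0). set (d := T / INR N) in *.
  assert (Hd : 0 < d) by (apply Rdiv_lt_0_compat; lra).
  assert (HNd : INR N * d = T) by (unfold d; field; lra).
  (* Periodised samples, so that shifts are cyclic and [dft_correlation] applies. Since [T] is an
     almost period, wrapping once changes a sample by at most [eps], and the indices [k + m] stay
     below [2 * N]. *)
  set (X := fun k : nat => g (INR (k mod N) * d)).
  set (Y := fun i (k : nat) => g (INR k * d + nth i A 0)).
  assert (HX : forall k, X (k + N)%nat = X k).
  { intros k. unfold X. f_equal. f_equal. f_equal.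
    replace (k + N)%nat with (k + 1 * N)%nat by lia. apply Nat.Div0.mod_add. }
  assert (HXd : forall j, (j < N)%nat -> Cmod (dft N X j) <= c).
  { intros j Hj. specialize (Hsm j Hj). unfold dft in *.
    rewrite (Csum_ext N _ (fun k => g (INR k * d)%R * cis (- (2 * PI * INR j * INR k / INR N)))%C); auto.
    intros k Hk. unfold X. rewrite Nat.mod_small; auto. }
  assert (HXg : forall k, (k < 2 * N)%nat -> Cmod (X k - g (INR k * d)) <= eps).
  { intros k Hk. unfold X. destruct (Nat.lt_ge_cases k N) as [Hlt|Hge].
    - rewrite Nat.mod_small by auto.
      match goal with |- Cmod ?z <= _ => replace z with (RtoC 0) by ring end. rewrite Cmod_0; lra.
    - replace k with ((k - N) + 1 * N)%nat at 1 by lia. rewrite Nat.Div0.mod_add, Nat.mod_small by lia.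
      rewrite Cmod_sub_sym. specialize (Hper (INR (k - N) * d)).
      replace (INR (k - N) * d + T) with (INR k * d) in Hper; auto.
      rewrite minus_INR by auto. rewrite <- HNd. ring. }
  set (R := fun i m => (RtoC (/ INR N) * Csum N (fun k => X (k + m)%nat * Cconj (Y i k)))%C).
  assert (Hup : forall i, / INR N * Rsum N (fun m => Cmod (R i m) ^ 2) <= c ^ 2 * B ^ 2).
  { intros i. eapply Rle_trans; [apply (dft_correlation N X (Y i) c HN0 HX HXd)|].
    apply Rmult_le_compat_l; [apply pow2_ge_0|].
    apply Rmult_le_reg_l with (INR N); auto. rewrite <- Rmult_assoc, Rinv_r, Rmult_1_l by lra.
    rewrite <- Rsum_const. apply Rsum_le. intros k Hk. apply pow_incr. split; [apply Cmod_ge_0|apply Hb]. }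
  assert (Hlow : forall k, (k < N)%nat -> (mu / 4) ^ 2 <= Rsum n (fun i => Cmod (R i k) ^ 2)).
  { intros q Hq. destruct (HA (INR q * d)) as [b [Hbin Hgb]].
    destruct (In_nth A b 0 Hbin) as [i [Hi Ei]].
    apply Rle_trans with (Cmod (R i q) ^ 2).
    2: { apply (Rsum_ge_term n (fun i => Cmod (R i q) ^ 2)); auto. intros; apply pow2_ge_0. }
    apply pow_incr. split; [lra|].
    set (S := Csum N (fun k => h (INR k * d + INR q * d))).
    assert (K1 : Cmod (R i q - RtoC (/ INR N) * S) <= mu / 16).
    { unfold R, S.
      match goal with |- Cmod (?a * ?b - ?a * ?c) <= _ => replace (a * b - a * c)%C with (a * (b + RtoC (-1) * c))%C
        by (rewrite RtoC_m1; ring) end.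
      rewrite <- Csum_scal, <- Csum_plus, Cmod_mult, Cmod_R, Rabs_pos_eq by (apply Rlt_le, Rinv_0_lt_compat; auto).
      apply Rmult_le_reg_l with (INR N); auto. rewrite <- Rmult_assoc, Rinv_r, Rmult_1_l by lra.
      apply Cmod_Csum_le. intros k Hk. unfold h, Y. rewrite Ei, RtoC_m1.
      assert (P1 := HXg (k + q)%nat ltac:(lia)). rewrite plus_INR, Rmult_plus_distr_r in P1.
      assert (P2 := Hgb (INR k * d)).
      set (u := g (INR k * d + INR q * d)) in *. set (v := g (INR k * d + b)) in *.
      replace (X (k + q)%nat * Cconj v + - RtoC 1 * (u * Cconj u))%C with
        ((X (k + q)%nat - u) * Cconj v + u * Cconj (v - u))%C by (rewrite Cminus_conj; ring).
      eapply Rle_trans; [apply Cmod_triangle|]. rewrite !Cmod_mult, !Cmod_conj.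
      rewrite (Cmod_sub_sym v).
      assert (Q1 : Cmod (X (k + q)%nat - u) * Cmod v <= eps * B)
        by (apply Rmult_le_compat; auto using Cmod_ge_0; apply Hb).
      assert (Q2 : Cmod u * Cmod (u - v) <= B * eps)
        by (apply Rmult_le_compat; auto using Cmod_ge_0; apply Hb).
      lra. }
    assert (K2 := Riemann_sum h N d (mu / 4) (proj1 Hh) Hd
      (fun s t Hst => Hu t s ltac:(rewrite Rabs_pos_eq; lra)) (INR q * d)).
    fold S in K2. rewrite HNd in K2.
    specialize (HW T ltac:(lra) (INR q * d)).
    assert (K3 : Cmod (RtoC d * S - RtoC T * m) <= mu / 2 * T).
    { eapply Rle_trans; [apply (Cmod_triangle_sub _ (CI h (INR q * d) (INR q * d + T)))|]. lra. }
    assert (K4 := re_le_Cmod (RtoC d * S - RtoC T * m)%C).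
    replace (Re (RtoC d * S - RtoC T * m)%C) with (d * Re S - T * mu) in K4
      by (unfold mu; simpl; unfold Re, Im; ring).
    assert (K4' := Rle_trans _ _ _ K4 K3).
    assert (K5 : mu / 2 * T <= d * Re S) by (unfold Rabs in K4'; destruct Rcase_abs in K4'; lra).
    assert (K6 : mu / 2 <= Re (RtoC (/ INR N) * S)%C).
    { replace (Re (RtoC (/ INR N) * S)%C) with (/ INR N * Re S) by (simpl; unfold Re, Im; ring).
      apply Rmult_le_reg_l with T; [lra|]. rewrite <- HNd at 2.
      replace (INR N * d * (/ INR N * Re S)) with (d * Re S) by (field; lra). lra. }
    assert (K7 := re_bound (RtoC (/ INR N) * S)%C).
    assert (K8 := Cmod_rev_triangle (RtoC (/ INR N) * S)%C (R i q)).
    rewrite Cmod_sub_sym in K8. lra. }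
  assert (K1 : INR N * (mu / 4) ^ 2 <= Rsum N (fun k => Rsum n (fun i => Cmod (R i k) ^ 2))).
  { rewrite <- Rsum_const. apply Rsum_le; auto. }
  rewrite Rsum_swap in K1.
  assert (K2 : Rsum n (fun i => Rsum N (fun k => Cmod (R i k) ^ 2)) <= INR n * (INR N * (c ^ 2 * B ^ 2))).
  { rewrite <- Rsum_const. apply Rsum_le. intros i Hi. specialize (Hup i).
    apply Rmult_le_reg_l with (/ INR N); [apply Rinv_0_lt_compat; auto|].
    rewrite <- Rmult_assoc, Rinv_l, Rmult_1_l by lra. auto. }
  assert (K3 : INR N * (INR n * (c ^ 2 * B ^ 2)) < INR N * (mu / 4) ^ 2) by (apply Rmult_lt_compat_l; auto).
  lra.
Qed.

(** * Linear independence over the rationals *)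

(** The formal combination [l] evaluated with [th y] in place of each element [y]. [Qcomb] is
    convertible to the case of the identity, so one set of lemmas serves for both. *)
Definition Qval (th : R -> R) (l : list (Q * R)) : R :=
  fold_right (fun p acc => Q2R (fst p) * th (snd p) + acc) 0 l.

(** [Q_lin_indep] speaks of lists without repeated elements, whereas representations in [Q_span] may
    repeat them. Collecting equal elements bridges the gap. *)
Fixpoint add_term (q : Q) (x : R) (l : list (Q * R)) : list (Q * R) :=
  match l with
  | nil => (q, x) :: nil
  | (q', y) :: l' => if Req_EM_T x y then (q + q', y)%Q :: l' else (q', y) :: add_term q x l'
  end.

Lemma Qval_add_term th q x l : Qval th (add_term q x l) = Q2R q * th x + Qval th l.
Proof.
  induction l as [|[q' y] l IH]; simpl; auto.
  destruct (Req_EM_T x y) as [->|]; simpl.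
  - rewrite Q2R_plus. ring.
  - rewrite IH. ring.
Qed.

Lemma In_add_term q x l y : In y (map snd (add_term q x l)) -> y = x \/ In y (map snd l).
Proof.
  induction l as [|[q' z] l IH]; simpl; [intuition|].
  destruct (Req_EM_T x z) as [->|]; simpl; intuition.
Qed.

Lemma NoDup_add_term q x l : NoDup (map snd l) -> NoDup (map snd (add_term q x l)).
Proof.
  induction l as [|[q' z] l IH]; simpl; intros H.
  - repeat constructor; auto.
  - inversion H; subst. destruct (Req_EM_T x z) as [->|Hxz]; simpl; auto.
    constructor; auto. intros Hin. apply In_add_term in Hin. destruct Hin; auto.
Qed.

Lemma Qcomb_merge (L : R -> Prop) (th : R -> R) (l : list (Q * R)) : List.Forall L (map snd l) ->
  exists l', NoDup (map snd l') /\ List.Forall L (map snd l') /\ Qcomb l' = Qcomb l /\ Qval th l' = Qval th l.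
Proof.
  induction l as [|[q x] l IH]; simpl; intros H.
  - exists nil. repeat split; constructor.
  - inversion H; subst. destruct (IH H3) as [l' [H4 [H5 [H6 H7]]]].
    exists (add_term q x l'). repeat split.
    + apply NoDup_add_term; auto.
    + apply List.Forall_forall. intros y Hy. apply In_add_term in Hy. destruct Hy as [->|Hy]; auto.
      rewrite List.Forall_forall in H5; auto.
    + change (Qval (fun x => x) (add_term q x l') = Q2R q * x + Qcomb l).
      rewrite Qval_add_term. rewrite <- H6. reflexivity.
    + rewrite Qval_add_term, H7. reflexivity.
Qed.

Lemma Qval_zero (L : R -> Prop) (th : R -> R) l : Q_lin_indep L -> List.Forall L (map snd l) ->
  Qcomb l = 0 -> Qval th l = 0.
Proof.
  intros HL Hl H0. destruct (Qcomb_merge L th l Hl) as [l' [H1 [H2 [H3 H4]]]].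
  rewrite H0 in H3. assert (K := HL l' H1 H2 H3). rewrite <- H4.
  clear - K. induction l' as [|[q x] l IH]; simpl in *; auto.
  inversion K; subst. rewrite IH by auto. rewrite (Qeq_eqR q 0) by auto.
  rewrite RMicromega.Q2R_0. ring.
Qed.

Lemma Qval_app th l l' : Qval th (l ++ l') = Qval th l + Qval th l'.
Proof. induction l as [|[q x] l IH]; simpl; [ring|]. rewrite IH. ring. Qed.

Definition scale_terms (c : Q) (l : list (Q * R)) : list (Q * R) :=
  map (fun p => (c * fst p, snd p)%Q) l.

Lemma Qval_scale th c l : Qval th (scale_terms c l) = Q2R c * Qval th l.
Proof. induction l as [|[q x] l IH]; simpl; [ring|]. rewrite IH, Q2R_mult. ring. Qed.

Lemma snd_scale c l : map snd (scale_terms c l) = map snd l.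
Proof. unfold scale_terms. rewrite map_map. reflexivity. Qed.

Lemma Q2R_m1 : Q2R (-1) = -1.
Proof. unfold Q2R; simpl; field. Qed.

(** An independent set is a basis of its span, so values on it may be prescribed freely. A
    representation is chosen for each element; the difference of two representations is a
    combination equal to zero, so by [Qval_zero] the choice does not matter. *)
Lemma Q_linear_extension (L : R -> Prop) (th : R -> R) : Q_lin_indep L ->
  exists psi, Q_linear_on (Q_span L) psi /\ forall x, L x -> psi x = th x.
Proof.
  intros HL.
  set (rep := fun x l => List.Forall L (map snd l) /\ Qcomb l = x).
  set (psi := fun x => Qval th (epsilon (inhabits nil) (rep x))).
  assert (Hpsi : forall x l, rep x l -> psi x = Qval th l).
  { intros x l Hl. assert (Hr : rep x (epsilon (inhabits nil) (rep x))) by (apply epsilon_spec; exists l; auto).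
    unfold psi. set (l0 := epsilon _ _) in *. destruct Hl as [H1 H2]. destruct Hr as [H3 H4].
    assert (K : Qval th (l0 ++ scale_terms (-1) l) = 0).
    { apply (Qval_zero L); auto.
      - rewrite map_app, snd_scale. apply List.Forall_app; auto.
      - change (Qval (fun x => x) (l0 ++ scale_terms (-1) l) = 0).
        rewrite Qval_app, Qval_scale, Q2R_m1.
        change (Qcomb l0 + -1 * Qcomb l = 0). rewrite H2, H4. ring. }
    rewrite Qval_app, Qval_scale, Q2R_m1 in K. lra. }
  exists psi. split; [split|].
  - intros x y [l1 [H1 H2]] [l2 [H3 H4]].
    assert (H5 : rep (x + y) (l1 ++ l2)).
    { split; [rewrite map_app; apply List.Forall_app; auto|].
      change (Qval (fun x => x) (l1 ++ l2) = x + y). rewrite Qval_app.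
      change (Qcomb l1 + Qcomb l2 = x + y). rewrite H2, H4; auto. }
    rewrite (Hpsi x l1 (conj H1 H2)), (Hpsi y l2 (conj H3 H4)), (Hpsi _ _ H5). apply Qval_app.
  - intros q x [l1 [H1 H2]].
    assert (H5 : rep (Q2R q * x) (scale_terms q l1)).
    { split; [rewrite snd_scale; auto|].
      change (Qval (fun x => x) (scale_terms q l1) = Q2R q * x). rewrite Qval_scale.
      change (Q2R q * Qcomb l1 = Q2R q * x). rewrite H2; auto. }
    rewrite (Hpsi x l1 (conj H1 H2)), (Hpsi _ _ H5). apply Qval_scale.
  - intros x Hx. rewrite (Hpsi x ((1%Q, x) :: nil)).
    + simpl. rewrite RMicromega.Q2R_1. ring.
    + split; simpl; [repeat constructor; auto|]. rewrite RMicromega.Q2R_1. ring.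
Qed.

Lemma Q2R_Z (z : Z) : Q2R (inject_Z z) = IZR z.
Proof. unfold Q2R; simpl. field. Qed.

Lemma Q_span_0 L : Q_span L 0.
Proof. exists nil. split; [constructor|reflexivity]. Qed.

Lemma Q_span_elt (L : R -> Prop) x : L x -> Q_span L x.
Proof.
  intros Hx. exists ((1%Q, x) :: nil). split; simpl; [repeat constructor; auto|].
  rewrite RMicromega.Q2R_1. ring.
Qed.

Lemma Q_span_plus L x y : Q_span L x -> Q_span L y -> Q_span L (x + y).
Proof.
  intros [l1 [H1 H2]] [l2 [H3 H4]]. exists (l1 ++ l2). split.
  - rewrite map_app; apply List.Forall_app; auto.
  - change (Qval (fun x => x) (l1 ++ l2) = x + y); rewrite Qval_app.
    change (Qcomb l1 + Qcomb l2 = x + y); rewrite H2, H4; auto.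
Qed.

Lemma Q_span_Z L x (z : Z) : Q_span L x -> Q_span L (IZR z * x).
Proof.
  intros [l1 [H1 H2]]. exists (scale_terms (inject_Z z) l1). split.
  - rewrite snd_scale; auto.
  - change (Qval (fun x => x) (scale_terms (inject_Z z) l1) = IZR z * x). rewrite Qval_scale, Q2R_Z.
    change (IZR z * Qcomb l1 = IZR z * x). rewrite H2; auto.
Qed.

Lemma Q_indep_0 (L : R -> Prop) : Q_lin_indep L -> ~ L 0.
Proof.
  intros HL H0. assert (K := HL ((1%Q, 0) :: nil)). simpl in K.
  assert (F : List.Forall (fun q => (q == 0)%Q) (1%Q :: nil)).
  { apply K; [repeat constructor; auto|repeat constructor; auto|ring]. }
  inversion F; subst. discriminate.
Qed.

(** The coordinate functional of the basis element [x], used to tell which frequencies can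
    coincide. *)
Definition is_coord (L : R -> Prop) (x : R) (chi : R -> R) : Prop :=
  Q_linear_on (Q_span L) chi /\ chi x = 1 /\ forall y, L y -> y <> x -> chi y = 0.

Lemma coord_exists (L : R -> Prop) x : Q_lin_indep L -> L x -> exists chi, is_coord L x chi.
Proof.
  intros HL Hx.
  destruct (Q_linear_extension L (fun y => if Req_EM_T y x then 1 else 0) HL) as [chi [H1 H2]].
  exists chi. split; auto. split.
  - rewrite H2 by auto. destruct (Req_EM_T x x); lra.
  - intros y Hy Hyx. rewrite H2 by auto. destruct (Req_EM_T y x); lra.
Qed.

Lemma coord_Z (L : R -> Prop) chi (z : Z) x : Q_linear_on (Q_span L) chi -> Q_span L x ->
  chi (IZR z * x) = IZR z * chi x.
Proof. intros [_ H] Hx. rewrite <- Q2R_Z. apply H; auto. Qed.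

Lemma coord_0 (L : R -> Prop) chi : Q_linear_on (Q_span L) chi -> chi 0 = 0.
Proof.
  intros H. replace 0 with (IZR 0 * 0) at 1 by ring.
  rewrite (coord_Z L chi) by (auto; apply Q_span_0). ring.
Qed.

(** * Bohr's inequality *)

(** [0], an element of [L], or one of these translated by integer multiples of the elements of [ls]:
    the frequencies that can occur in [f] times a product of Fejer kernels. *)
Fixpoint spectrum (L : R -> Prop) (ls : list R) (nu : R) : Prop :=
  match ls with
  | nil => nu = 0 \/ L nu
  | x :: ls' => exists d : Z, spectrum L ls' (nu - IZR d * x)
  end.

Lemma spectrum_span (L : R -> Prop) ls nu : List.Forall L ls -> spectrum L ls nu -> Q_span L nu.
Proof.
  revert nu. induction ls as [|x ls IH]; simpl; intros nu HF H.
  - destruct H as [->|H]; [apply Q_span_0|apply Q_span_elt; auto].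
  - inversion HF; subst. destruct H as [d Hd].
    replace nu with ((nu - IZR d * x) + IZR d * x) by ring.
    apply Q_span_plus; auto. apply Q_span_Z, Q_span_elt; auto.
Qed.

(** Integer multiples of the elements of [ls] have coordinate zero at [x], so only the initial
    frequency, [0] or a single element of [L], counts. *)
Lemma spectrum_coord (L : R -> Prop) ls nu x chi : List.Forall L ls -> spectrum L ls nu ->
  is_coord L x chi -> ~ In x ls -> chi nu = 0 \/ chi nu = 1.
Proof.
  revert nu. induction ls as [|y ls IH]; simpl; intros nu HF H Hc Hx.
  - destruct H as [->|H]; [left; apply (coord_0 L); apply Hc|].
    destruct (Req_EM_T nu x) as [->|Hn]; [right|left]; apply Hc; auto.
  - inversion HF; subst. destruct H as [d Hd].
    assert (K := IH _ H3 Hd Hc ltac:(auto)).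
    assert (E : chi nu = chi (nu - IZR d * y)).
    { replace nu with ((nu - IZR d * y) + IZR d * y) at 1 by ring.
      destruct Hc as [H1 [H4 H5]]. rewrite (proj1 H1).
      - rewrite (coord_Z L chi) by (auto; apply Q_span_elt; auto). rewrite (H5 y) by auto. ring.
      - apply spectrum_span with ls; auto.
      - apply Q_span_Z, Q_span_elt; auto. }
    rewrite E; auto.
Qed.

(** Only one element of [L] enters besides the multiples of [ls]. If it is [x], it cannot also be
    [x']. *)
Lemma spectrum_coord2 (L : R -> Prop) ls nu x chi x' chi' : List.Forall L ls -> spectrum L ls nu ->
  is_coord L x chi -> ~ In x ls -> is_coord L x' chi' -> ~ In x' ls -> L x -> x <> x' ->
  chi nu = 1 -> chi' nu = 0.
Proof.
  revert nu. induction ls as [|y ls IH]; simpl; intros nu HF H Hc Hx Hc' Hx' HLx Hne H1.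
  - destruct H as [->|H]; [apply (coord_0 L); apply Hc'|].
    destruct (Req_EM_T nu x) as [->|Hn]; [apply Hc'; auto|].
    rewrite (proj2 (proj2 Hc)) in H1 by auto. lra.
  - inversion HF; subst. destruct H as [d Hd].
    assert (E : forall z c, is_coord L z c -> y <> z -> c nu = c (nu - IZR d * y)).
    { intros z c Hcz Hyz. replace nu with ((nu - IZR d * y) + IZR d * y) at 1 by ring.
      destruct Hcz as [G1 [G4 G5]]. rewrite (proj1 G1).
      - rewrite (coord_Z L c) by (auto; apply Q_span_elt; auto). rewrite (G5 y) by auto. ring.
      - apply spectrum_span with ls; auto.
      - apply Q_span_Z, Q_span_elt; auto. }
    rewrite (E x' chi') by auto. apply (IH (nu - IZR d * y)); auto.
    rewrite <- (E x chi); auto.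
Qed.

(** The main diagonal has [n] entries and the one beside it [n - 1]: this is the origin of the
    weight [(n - 1) / n] of the first harmonic of a Fejer kernel. *)
Lemma double_sum_two_diagonals n F A B : (0 < n)%nat ->
  (forall k, F k k = A) -> (forall k, F k (S k) = B) ->
  (forall k q, q <> k -> q <> S k -> F k q = RtoC 0) ->
  Csum n (fun k => Csum n (fun q => F k q)) = (RtoC (INR n) * A + RtoC (INR n - 1) * B)%C.
Proof.
  intros Hn HA HB H0. destruct n as [|p]; [lia|].
  transitivity (Csum p (fun _ => A + B) + A)%C.
  - change (Csum (S p) (fun k => Csum (S p) (fun q => F k q))) with
      (Csum p (fun k => Csum (S p) (fun q => F k q)) + Csum (S p) (fun q => F p q))%C.
    f_equal.
    + apply Csum_ext. intros k Hk.
      rewrite (Csum_ext _ _ (fun q => (if Nat.eq_dec q k then A else RtoC 0) + (if Nat.eq_dec q (S k) then B else RtoC 0))%C).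
      * rewrite Csum_plus. rewrite (Csum_single (S p) _ k), (Csum_single (S p) _ (S k)); try lia.
        -- destruct (Nat.eq_dec k k); [|lia]. destruct (Nat.eq_dec (S k) (S k)); [auto|lia].
        -- intros q Hq Hne. destruct (Nat.eq_dec q (S k)); [lia|auto].
        -- intros q Hq Hne. destruct (Nat.eq_dec q k); [lia|auto].
      * intros q Hq. destruct (Nat.eq_dec q k) as [->|H1].
        -- rewrite HA. destruct (Nat.eq_dec k (S k)); [lia|ring].
        -- destruct (Nat.eq_dec q (S k)) as [->|H2]; [rewrite HB; ring|rewrite H0; auto; ring].
    + rewrite (Csum_single (S p) _ p); auto. intros q Hq Hne. apply H0; lia.
  - rewrite Csum_const, S_INR. replace (INR p + 1 - 1) with (INR p) by ring.
    rewrite RtoC_plus. ring.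
Qed.

(** The Fejer kernel $\frac1n\bigl|\sum_{k<n}e^{ikx}\bigr|^2$, expanded so that its harmonics
    [k - q] are visible; [fejer_nonneg] folds the square again. *)
Definition fejer (n : nat) (x : R) : C :=
  (RtoC (/ INR n) * Csum n (fun k => Csum n (fun q => cis ((INR k - INR q) * x))))%C.

Lemma fejer_nonneg n x : exists r, 0 <= r /\ fejer n x = RtoC r.
Proof.
  exists (/ INR n * Cmod (Csum n (fun k => cis (INR k * x))) ^ 2). split.
  - destruct n; [simpl; rewrite Cmod_0; lra|].
    apply Rmult_le_pos; [|apply pow2_ge_0]. apply Rlt_le, Rinv_0_lt_compat, lt_0_INR; lia.
  - rewrite RtoC_mult, Cmod2_conj, Cconj_Csum, Csum_Csum_mult. unfold fejer. f_equal.
    apply Csum_ext. intros k _. apply Csum_ext. intros q _.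
    rewrite <- cis_opp, <- cis_plus. f_equal. ring.
Qed.

Fixpoint kernel (n : nat) (l : list (R * R)) (t : R) : C :=
  match l with
  | nil => RtoC 1
  | (x, th) :: l' => (fejer n (x * t - th) * kernel n l' t)%C
  end.

Lemma kernel_nonneg n l t : exists r, 0 <= r /\ kernel n l t = RtoC r.
Proof.
  induction l as [|[x th] l [r [Hr IH]]]; simpl.
  - exists 1. split; [lra|auto].
  - destruct (fejer_nonneg n (x * t - th)) as [s [Hs Es]]. exists (s * r).
    split; [apply Rmult_le_pos; auto|]. rewrite RtoC_mult, IH, Es. reflexivity.
Qed.

Lemma Ccont_kernel n l : Ccont (kernel n l).
Proof.
  induction l as [|[x th] l IH]; simpl; [apply Ccont_const|].
  apply Ccont_mult; auto. unfold fejer. apply Ccont_mult; [apply Ccont_const|].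
  apply (Ccont_Csum n (fun k t => Csum n (fun q => cis ((INR k - INR q) * (x * t - th))))). intros k.
  apply (Ccont_Csum n (fun q t => cis ((INR k - INR q) * (x * t - th)))). intros q.
  apply Ccont_ext with (2 := Ccont_cis ((INR k - INR q) * x) (- ((INR k - INR q) * th))).
  intros t. f_equal. ring.
Qed.

(** The Fourier coefficient at [nu] of the kernel times a function with coefficients [a]: the
    harmonic [k - q] of the factor at [x] shifts the frequency by [(k - q) * x] and brings the phase
    of [th]. *)
Fixpoint kernel_coef (n : nat) (a : R -> C) (l : list (R * R)) (nu : R) : C :=
  match l with
  | nil => a nu
  | (x, th) :: l' => (RtoC (/ INR n) * Csum n (fun k => Csum n (fun q =>
      cis (- (INR k - INR q) * th) * kernel_coef n a l' (nu - (INR k - INR q) * x)%R)))%C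
  end.

Lemma mean_kernel n f a l : Ccont f -> (forall nu, is_mean (twist f nu) (a nu)) ->
  forall nu, is_mean (fun t => kernel n l t * twist f nu t)%C (kernel_coef n a l nu).
Proof.
  intros Cf Hm. induction l as [|[x th] l IH]; simpl; intros nu.
  - apply mean_ext with (2 := Hm nu). intros; ring.
  - assert (Cl : forall nu, Ccont (fun t => kernel n l t * twist f nu t)%C).
    { intros mu. apply Ccont_mult; [apply Ccont_kernel|apply Ccont_twist; auto]. }
    apply mean_ext with (fun t => RtoC (/ INR n) * Csum n (fun k => Csum n (fun q =>
      cis (- (INR k - INR q) * th) * (kernel n l t * twist f (nu - (INR k - INR q) * x)%R t))))%C.
    + intros t. unfold fejer. rewrite <- !Cmult_assoc. f_equal.
      rewrite Cmult_comm, <- Csum_scal. apply Csum_ext. intros k _.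
      rewrite <- Csum_scal. apply Csum_ext. intros q _. unfold twist.
      replace (- (nu - (INR k - INR q) * x) * t) with (- nu * t + (INR k - INR q) * x * t) by ring.
      replace ((INR k - INR q) * (x * t - th)) with ((INR k - INR q) * x * t + - (INR k - INR q) * th) by ring.
      rewrite !cis_plus. ring.
    + assert (C2 : forall k q, Ccont (fun t => cis (- (INR k - INR q) * th) *
        (kernel n l t * twist f (nu - (INR k - INR q) * x)%R t))%C).
      { intros k q. apply Ccont_mult; [apply Ccont_const|auto]. }
      assert (C1 : forall k, Ccont (fun t => Csum n (fun q => cis (- (INR k - INR q) * th) *
        (kernel n l t * twist f (nu - (INR k - INR q) * x)%R t)))%C).
      { intros k. apply (Ccont_Csum n (fun q t => cis (- (INR k - INR q) * th) *
        (kernel n l t * twist f (nu - (INR k - INR q) * x)%R t))%C). auto. }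
      apply mean_scal.
      * apply (Ccont_Csum n (fun k t => Csum n (fun q => cis (- (INR k - INR q) * th) *
        (kernel n l t * twist f (nu - (INR k - INR q) * x)%R t)))%C). auto.
      * apply (mean_Csum n (fun k t => Csum n (fun q => cis (- (INR k - INR q) * th) *
        (kernel n l t * twist f (nu - (INR k - INR q) * x)%R t)))%C); auto. intros k.
        apply (mean_Csum n (fun q t => cis (- (INR k - INR q) * th) *
        (kernel n l t * twist f (nu - (INR k - INR q) * x)%R t))%C); auto. intros q.
        apply mean_scal; auto.
Qed.

Lemma kernel_coef_spectrum L n a l nu : (forall mu, a mu <> RtoC 0 -> mu = 0 \/ L mu) ->
  kernel_coef n a l nu <> RtoC 0 -> spectrum L (map fst l) nu.
Proof.
  intros Ha. revert nu. induction l as [|[x th] l IH]; simpl; intros nu H; auto.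
  apply NNPP. intros Hno. apply H.
  rewrite Csum_0; [ring|]. intros k _. apply Csum_0. intros q _.
  replace (kernel_coef n a l (nu - (INR k - INR q) * x)) with (RtoC 0); [ring|].
  apply NNPP. intros Hne. apply Hno. exists (Z.of_nat k - Z.of_nat q)%Z.
  rewrite minus_IZR, <- !INR_IZR_INZ. apply IH; auto.
Qed.

Lemma Z_coord (k q : nat) : INR k - INR q = IZR (Z.of_nat k - Z.of_nat q).
Proof. rewrite minus_IZR, <- !INR_IZR_INZ. reflexivity. Qed.

(** A nonzero harmonic [m] of the factor at [y] would require the frequency [x - m * y], with
    coordinate 1 at [x] and [- m] at [y]; [spectrum_coord2] forbids this. The [n] diagonal terms
    cancel the factor [/ INR n]. *)
Lemma kernel_coef_fresh L n a l x : (0 < n)%nat -> Q_lin_indep L ->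
  (forall mu, a mu <> RtoC 0 -> mu = 0 \/ L mu) ->
  NoDup (map fst l) -> List.Forall L (map fst l) -> L x -> ~ In x (map fst l) ->
  kernel_coef n a l x = a x.
Proof.
  intros Hn HL Ha. assert (HnR : 0 < INR n) by (apply lt_0_INR; auto).
  induction l as [|[y th] l IH]; simpl; intros Hnd HF Hx Hin; auto.
  inversion Hnd; subst. inversion HF; subst.
  destruct (coord_exists L x HL Hx) as [chi Hchi].
  destruct (coord_exists L y HL H3) as [chi' Hchi'].
  assert (Hz : forall k q, k <> q -> kernel_coef n a l (x - (INR k - INR q) * y) = RtoC 0).
  { intros k q Hkq. apply NNPP. intros Hne. apply (kernel_coef_spectrum L) in Hne; auto.
    assert (Hxy : x <> y) by (intros E; apply Hin; auto).
    assert (E : forall z c, is_coord L z c -> c (x - (INR k - INR q) * y) = c x - (INR k - INR q) * c y).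
    { intros z c [G _]. unfold Rminus at 1. rewrite Ropp_mult_distr_l.
      replace (- (INR k - INR q)) with (IZR (Z.of_nat q - Z.of_nat k)) by (rewrite <- Z_coord; ring).
      rewrite (proj1 G), (coord_Z L c) by (auto using Q_span_elt, Q_span_Z).
      rewrite <- Z_coord. ring. }
    assert (K1 : chi (x - (INR k - INR q) * y) = 1).
    { rewrite (E x chi Hchi). destruct Hchi as [_ [-> G]]. rewrite G by auto. ring. }
    assert (K2 := spectrum_coord2 L _ _ x chi y chi' H4 Hne Hchi ltac:(auto) Hchi' H1 Hx Hxy K1).
    rewrite (E y chi' Hchi') in K2. destruct Hchi' as [_ [G1 G2]]. rewrite G1, G2 in K2 by auto.
    apply Hkq, INR_eq. lra. }
  rewrite (double_sum_two_diagonals n _ (a x) (RtoC 0)); auto.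
  - rewrite RtoC_inv by lra. field. intros E. apply RtoC_inj in E. lra.
  - intros k. replace (- (INR k - INR k) * th) with 0 by ring.
    replace (x - (INR k - INR k) * y) with x by ring. rewrite cis_0, IH; auto. ring.
  - intros k. rewrite Hz by lia. ring.
  - intros k q H5 H6. rewrite Hz by auto. ring.
Qed.

Definition Lsum (l : list (R * R)) (F : R * R -> C) : C := fold_right (fun p acc => (F p + acc)%C) (RtoC 0) l.

(** At frequency zero the harmonic [k - q] leads to [(q - k) * y], whose coordinate at [y] must be 0
    or 1. The first case is the diagonal; the second, [q = S k], meets the frequency [y], where
    [kernel_coef_fresh] gives the original coefficient. *)
Lemma kernel_coef_0 L n a l : (0 < n)%nat -> Q_lin_indep L ->
  (forall mu, a mu <> RtoC 0 -> mu = 0 \/ L mu) ->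
  NoDup (map fst l) -> List.Forall L (map fst l) ->
  kernel_coef n a l 0 = (a 0%R + RtoC ((INR n - 1) / INR n) * Lsum l (fun p => cis (snd p) * a (fst p)))%C.
Proof.
  intros Hn HL Ha. assert (HnR : 0 < INR n) by (apply lt_0_INR; auto).
  induction l as [|[y th] l IH]; simpl; intros Hnd HF; [ring|].
  inversion Hnd; subst. inversion HF; subst.
  destruct (coord_exists L y HL H3) as [chi Hchi].
  assert (Hz : forall k q, q <> k -> q <> S k -> kernel_coef n a l (0 - (INR k - INR q) * y) = RtoC 0).
  { intros k q Hkq HkS. apply NNPP. intros Hne. apply (kernel_coef_spectrum L) in Hne; auto.
    assert (K := spectrum_coord L _ _ y chi H4 Hne Hchi H1).
    replace (0 - (INR k - INR q) * y) with (IZR (Z.of_nat q - Z.of_nat k) * y) in K by (rewrite <- Z_coord; ring).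
    rewrite (coord_Z L chi) in K by (try apply Hchi; apply Q_span_elt; auto).
    rewrite (proj1 (proj2 Hchi)), <- Z_coord in K.
    destruct K as [K|K]; [apply Hkq|apply HkS]; apply INR_eq; [|rewrite S_INR]; lra. }
  rewrite (double_sum_two_diagonals n _ (kernel_coef n a l 0) (cis th * a y)%C); auto.
  - rewrite IH by auto.
    replace ((INR n - 1) / INR n) with (/ INR n * (INR n - 1)) by (field; lra).
    rewrite RtoC_mult.
    assert (E : (RtoC (/ INR n) * RtoC (INR n))%C = RtoC 1) by (rewrite <- RtoC_mult, Rinv_l; auto; lra).
    match goal with |- (?u * (?v * ?w + ?p * ?q))%C = _ => transitivity ((u * v) * w + u * p * q)%C; [ring|] end.
    rewrite E. ring.
  - intros k. replace (- (INR k - INR k) * th) with 0 by ring.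
    replace (0 - (INR k - INR k) * y) with 0 by ring. rewrite cis_0. ring.
  - intros k. rewrite S_INR. replace (- (INR k - (INR k + 1)) * th) with th by ring.
    replace (0 - (INR k - (INR k + 1)) * y) with y by ring.
    rewrite (kernel_coef_fresh L); auto.
  - intros k q H5 H6. rewrite Hz by auto. ring.
Qed.

Lemma Lsum_ext l F G : (forall p, In p l -> F p = G p) -> Lsum l F = Lsum l G.
Proof.
  induction l; simpl; intros H; auto. rewrite H, IHl; auto.
Qed.

Lemma Lsum_scal l c F : Lsum l (fun p => c * F p)%C = (c * Lsum l F)%C.
Proof. induction l; simpl; [ring|]. rewrite IHl. ring. Qed.

(** Multiply [B - f >= 0] by a product of Fejer kernels centred at the prescribed phases. By
    independence only the first harmonics of the kernels meet the spectrum of [f], with weight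
    [(n - 1) / n], which tends to [1]. *)
Theorem Bohr_inequality (L : R -> Prop) f a l B : Q_lin_indep L -> Ccont f ->
  (forall nu, is_mean (twist f nu) (a nu)) -> (forall nu, a nu <> RtoC 0 -> L nu) ->
  (forall t, Re (f t) <= B) -> NoDup (map fst l) -> List.Forall L (map fst l) ->
  Re (Lsum l (fun p => cis (snd p) * a (fst p)))%C <= B.
Proof.
  intros HL Cf Hm Ha HB Hnd HF.
  assert (HL0 := Q_indep_0 L HL).
  set (s := Re (Lsum l (fun p => cis (snd p) * a (fst p)))%C).
  assert (Hn : forall n, (0 < n)%nat -> (INR n - 1) / INR n * s <= B).
  { intros n Hn0.
    set (g := fun t => (RtoC B - f t)%C).
    (* The coefficients of [B - f]. The constant brings in the frequency [0], which is outside [L]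
       by independence. *)
    set (b := fun nu => ((if Req_EM_T nu 0 then RtoC B else RtoC 0) + RtoC (-1) * a nu)%C).
    assert (Cg : Ccont g) by (apply Ccont_minus; auto; apply Ccont_const).
    assert (Hg : forall nu, is_mean (twist g nu) (b nu)).
    { intros nu. apply mean_ext with (fun t => RtoC B * cis (- nu * t) + RtoC (-1) * twist f nu t)%C.
      { intros t. unfold twist, g. rewrite RtoC_m1. ring. }
      apply mean_plus.
      - apply Ccont_mult; [apply Ccont_const|apply Ccont_cis0].
      - apply Ccont_mult; [apply Ccont_const|apply Ccont_twist; auto].
      - destruct (Req_EM_T nu 0) as [->|Hnu].
        + apply mean_ext with (fun _ => RtoC B); [|apply mean_const].
          intros t. replace (- 0 * t) with 0 by ring. rewrite cis_0. ring.
        + replace (RtoC 0) with (RtoC B * RtoC 0)%C by ring.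
          apply mean_scal; [apply Ccont_cis0|apply mean_cis; lra].
      - apply mean_scal; auto. apply Ccont_twist; auto. }
    assert (Hb : forall mu, b mu <> RtoC 0 -> mu = 0 \/ L mu).
    { intros mu H. unfold b in H. destruct (Req_EM_T mu 0); auto. right.
      apply Ha. intros E. apply H. rewrite E. ring. }
    assert (K := mean_kernel n g b l Cg Hg 0).
    assert (K2 : Re (RtoC (-1) * kernel_coef n b l 0)%C <= 0).
    { apply (mean_re_le (fun t => RtoC (-1) * (kernel n l t * twist g 0 t))%C).
      - apply Ccont_mult; [apply Ccont_const|]. apply Ccont_mult; [apply Ccont_kernel|apply Ccont_twist; auto].
      - apply mean_scal; auto. apply Ccont_mult; [apply Ccont_kernel|apply Ccont_twist; auto].
      - intros t. destruct (kernel_nonneg n l t) as [r [Hr ->]]. unfold twist, g.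
        replace (- 0 * t) with 0 by ring. rewrite cis_0.
        replace (Re (RtoC (-1) * (RtoC r * ((RtoC B - f t) * RtoC 1))))%C with (- (r * (B - Re (f t))))
          by (simpl; unfold Re; ring).
        specialize (HB t). assert (0 <= r * (B - Re (f t))) by (apply Rmult_le_pos; lra). lra. }
    rewrite (kernel_coef_0 L n b l Hn0 HL Hb Hnd HF) in K2.
    assert (E0 : b 0 = RtoC B).
    { unfold b. destruct (Req_EM_T 0 0); [|lra].
      replace (a 0) with (RtoC 0); [ring|]. apply NNPP. intros H. apply HL0, Ha. auto. }
    assert (E1 : Lsum l (fun p => cis (snd p) * b (fst p))%C =
      (RtoC (-1) * Lsum l (fun p => cis (snd p) * a (fst p)))%C).
    { rewrite <- Lsum_scal. apply Lsum_ext. intros p Hp.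
      assert (Hp0 : fst p <> 0).
      { intros E. apply HL0. rewrite <- E. rewrite List.Forall_forall in HF. apply HF, in_map; auto. }
      unfold b. destruct (Req_EM_T (fst p) 0); [lra|ring]. }
    rewrite E0, E1 in K2.
    match type of K2 with Re ?z <= 0 => replace (Re z) with (- B + (INR n - 1) / INR n * s) in K2 end.
    - lra.
    - unfold s. simpl. unfold Re, Im. ring. }
  apply Rnot_lt_le. intros Hlt.
  (* If [s] exceeded [B], then [n = k + 1] would be above [|s| / (s - B)], and [(n - 1) / n * s]
     would already exceed [B]. *)
  destruct (nfloor_ex (Rabs s / (s - B))) as [k Hk].
  { apply Rmult_le_pos; [apply Rabs_pos|apply Rlt_le, Rinv_0_lt_compat; lra]. }
  specialize (Hn (S k) ltac:(lia)). rewrite S_INR in Hn.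
  assert (Hk0 := pos_INR k).
  assert (E : Rabs s = Rabs s / (s - B) * (s - B)) by (field; lra).
  assert (K : Rabs s < (INR k + 1) * (s - B)) by nra.
  assert (E2 : (INR k + 1) * ((INR k + 1 - 1) / (INR k + 1) * s) = (INR k + 1) * s - s) by (field; lra).
  assert (K3 : (INR k + 1) * ((INR k + 1 - 1) / (INR k + 1) * s) <= (INR k + 1) * B)
    by (apply Rmult_le_compat_l; lra).
  assert (K4 := Rle_abs s). lra.
Qed.

(** * Taylor's formula for the complex exponential *)

Lemma is_derive_Re_Cexp (w z : C) (t : R) :
  is_derive (fun t : R => Re (w * Cexp (RtoC t * z))) t (Re (w * z * Cexp (RtoC t * z))).
Proof.
  destruct w as [w1 w2]. destruct z as [x y].
  apply is_derive_ext with (fun t => exp (t * x) * (w1 * cos (t * y) - w2 * sin (t * y))).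
  - intros s. simpl. unfold Re, Im; simpl.
    replace (s * x - 0 * y) with (s * x) by ring. replace (s * y + 0 * x) with (s * y) by ring. ring.
  - auto_derive; auto. simpl. unfold Re, Im; simpl.
    replace (t * x - 0 * y) with (t * x) by ring. replace (t * y + 0 * x) with (t * y) by ring. ring.
Qed.

Lemma Derive_n_Re_Cexp (w z : C) m (t : R) :
  is_derive_n (fun t : R => Re (w * Cexp (RtoC t * z))) m t (Re (w * z ^ m * Cexp (RtoC t * z))).
Proof.
  revert t. induction m as [|m IHm]; intros t.
  - replace (w * z ^ 0)%C with w by (simpl; ring). reflexivity.
  - change (is_derive (fun x => Derive_n (fun t : R => Re (w * Cexp (RtoC t * z))) m x) t
      (Re (w * (z * z ^ m) * Cexp (RtoC t * z)))).
    apply is_derive_ext with (fun t : R => Re (w * z ^ m * Cexp (RtoC t * z))).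
    + intros s. symmetry. apply (is_derive_n_unique _ m s). auto.
    + replace (w * (z * z ^ m) * Cexp (RtoC t * z))%C with ((w * z ^ m) * z * Cexp (RtoC t * z))%C by ring.
      apply is_derive_Re_Cexp.
Qed.

Definition exp_term (z : C) (j : nat) : C := (RtoC (/ INR (Factorial.fact j)) * z ^ j)%C.

Lemma sum_f_R0_Rsum F n : sum_f_R0 F n = Rsum (S n) F.
Proof. induction n; simpl in *; [ring|]. rewrite IHn. reflexivity. Qed.

(** A rotation [w] makes the remainder real and nonnegative, so the real Taylor-Lagrange formula
    applies on [[0, 1]] to the real part of $w e^{tz}$. Its derivatives are again of this form, with
    [w] replaced by $wz^m$. *)
Lemma Cexp_Taylor (z : C) k :
  Cmod (Cexp z - Csum (S k) (exp_term z)) <= Cmod z ^ S k / INR (Factorial.fact (S k)) * exp (Rabs (Re z)).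
Proof.
  destruct (unit_phase (Cexp z - Csum (S k) (exp_term z))%C) as [th Hth].
  set (w := cis th) in *.
  destruct (Taylor_Lagrange (fun t : R => Re (w * Cexp (RtoC t * z))) k 0 1) as [zeta [Hz HT]].
  - lra.
  - intros t _ m _. destruct m; simpl; auto.
    exists (Re (w * z ^ S m * Cexp (RtoC t * z))).
    apply (Derive_n_Re_Cexp w z (S m) t).
  - rewrite (is_derive_n_unique _ _ _ _ (Derive_n_Re_Cexp w z (S k) zeta)) in HT.
    rewrite sum_f_R0_Rsum in HT.
    rewrite (Rsum_ext _ _ (fun m => Re (w * exp_term z m))) in HT.
    2:{ intros m _. rewrite (is_derive_n_unique _ _ _ _ (Derive_n_Re_Cexp w z m 0)).
        replace (RtoC 0 * z)%C with (RtoC 0) by ring.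
        assert (E0 : Cexp (RtoC 0) = RtoC 1).
        { rewrite Cexp_cis. simpl. unfold Re, Im; simpl. rewrite exp_0, cis_0. ring. }
        rewrite E0, Rminus_0_r, pow1. unfold exp_term.
        replace (w * (RtoC (/ INR (Factorial.fact m)) * z ^ m))%C with (RtoC (/ INR (Factorial.fact m)) * (w * z ^ m * RtoC 1))%C by ring.
        unfold Rdiv. rewrite Rmult_1_l. generalize (w * z ^ m * RtoC 1)%C. intros [a b]; simpl. unfold Re; simpl. ring. }
    rewrite <- Re_Csum, Csum_scal in HT.
    replace (RtoC 1 * z)%C with z in HT by ring.
    rewrite Rminus_0_r, pow1 in HT.
    assert (E : Cmod (Cexp z - Csum (S k) (exp_term z)) =
       1 / INR (Factorial.fact (S k)) * Re (w * z ^ S k * Cexp (RtoC zeta * z))%C).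
    { transitivity (Re (RtoC (Cmod (Cexp z - Csum (S k) (exp_term z))))); [reflexivity|].
      rewrite <- Hth.
      replace (w * (Cexp z - Csum (S k) (exp_term z)))%C with (w * Cexp z - w * Csum (S k) (exp_term z))%C by ring.
      change (Re (w * Cexp z)%C - Re (w * Csum (S k) (exp_term z))%C =
        1 / INR (Factorial.fact (S k)) * Re (w * z ^ S k * Cexp (RtoC zeta * z))%C).
      rewrite HT. ring. }
    rewrite E. assert (Hf : 0 < INR (Factorial.fact (S k))) by apply INR_fact_lt_0.
    assert (K : Re (w * z ^ S k * Cexp (RtoC zeta * z))%C <= Cmod z ^ S k * exp (Rabs (Re z))).
    { eapply Rle_trans; [apply re_bound|]. rewrite !Cmod_mult, Cmod_pow, Cmod_Cexp. unfold w. rewrite Cmod_cis, Rmult_1_l.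
      apply Rmult_le_compat_l; [apply pow_le, Cmod_ge_0|].
      assert (K : Re (RtoC zeta * z)%C <= Rabs (Re z)).
      { replace (Re (RtoC zeta * z)%C) with (zeta * Re z) by (simpl; unfold Re, Im; ring).
        eapply Rle_trans; [apply Rle_abs|]. rewrite Rabs_mult, (Rabs_pos_eq zeta) by lra.
        assert (K := Rabs_pos (Re z)). nra. }
      destruct K as [K| ->]; [apply Rlt_le, exp_increasing; auto|lra]. }
    apply Rmult_le_compat_l with (r := / INR (Factorial.fact (S k))) in K; [|apply Rlt_le, Rinv_0_lt_compat; auto].
    unfold Rdiv. lra.
Qed.

Lemma pow_div_fact_le_exp x k : 0 <= x -> x ^ k / INR (Factorial.fact k) <= exp x.
Proof.
  intros Hx. eapply Rle_trans; [|apply (exp_ge_taylor x k Hx)].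
  rewrite sum_f_R0_Rsum.
  apply (Rsum_ge_term (S k) (fun k => x ^ k / INR (Factorial.fact k)) k); [|lia].
  intros j _. apply Rmult_le_pos; [apply pow_le; auto|].
  apply Rlt_le, Rinv_0_lt_compat, INR_fact_lt_0.
Qed.

(** * Cauchy's theorem for rectangles *)

Lemma nested_intervals (a b : nat -> R) : (forall n, a n <= a (S n)) -> (forall n, b (S n) <= b n) ->
  (forall n, a n <= b n) -> exists u, forall n, a n <= u <= b n.
Proof.
  intros Ha Hb Hab.
  assert (Ha' : forall n m, (n <= m)%nat -> a n <= a m).
  { intros n m H. induction H; [lra|]. eapply Rle_trans; eauto. }
  assert (Hb' : forall n m, (n <= m)%nat -> b m <= b n).
  { intros n m H. induction H; [lra|]. eapply Rle_trans; eauto. }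
  assert (Hall : forall n m, a n <= b m).
  { intros n m. apply Rle_trans with (a (n + m)%nat); [apply Ha'; lia|].
    apply Rle_trans with (b (n + m)%nat); [auto|apply Hb'; lia]. }
  destruct (completeness (fun x => exists n, x = a n)) as [u [H1 H2]].
  - exists (b 0%nat). intros x [n ->]. auto.
  - exists (a 0%nat). exists 0%nat. auto.
  - exists u. intros n. split; [apply H1; exists n; auto|]. apply H2. intros x [m ->]. auto.
Qed.

(** Bisection as an induction principle over rectangles similar to the given one, [q] being the
    ratio: a failure would propagate to nested quarters shrinking to a point, against the local
    hypothesis. It serves both Goursat's theorem and the existence of minima. *)
Lemma rectangle_bisection (W H x0 y0 : R) (P : R -> R -> R -> Prop) : 0 < W -> 0 < H ->
  (forall x y q, 0 < q -> x0 <= x -> x + q * W <= x0 + W -> y0 <= y -> y + q * H <= y0 + H ->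
     P x y (q / 2) -> P (x + q / 2 * W) y (q / 2) -> P x (y + q / 2 * H) (q / 2) ->
     P (x + q / 2 * W) (y + q / 2 * H) (q / 2) -> P x y q) ->
  (forall u v, x0 <= u <= x0 + W -> y0 <= v <= y0 + H -> exists d, 0 < d /\
     forall x y q, 0 < q < d -> x <= u <= x + q * W -> y <= v <= y + q * H ->
       x0 <= x -> x + q * W <= x0 + W -> y0 <= y -> y + q * H <= y0 + H -> P x y q) ->
  P x0 y0 1.
Proof.
  intros HW HH Hsplit Hloc. apply NNPP. intros Hneg.
  set (good := fun (n : nat) (p : R * R) => let q := (/ 2) ^ n in
    x0 <= fst p /\ fst p + q * W <= x0 + W /\ y0 <= snd p /\ snd p + q * H <= y0 + H /\ ~ P (fst p) (snd p) q).
  set (step := fun (n : nat) (p p' : R * R) => good (S n) p' /\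
    fst p <= fst p' /\ fst p' + (/ 2) ^ S n * W <= fst p + (/ 2) ^ n * W /\
    snd p <= snd p' /\ snd p' + (/ 2) ^ S n * H <= snd p + (/ 2) ^ n * H).
  assert (Hq : forall n, 0 < (/ 2) ^ n) by (intros; apply pow_lt; lra).
  assert (Hstep : forall n p, good n p -> exists p', step n p p').
  { intros n [x y] [H1 [H2 [H3 [H4 H5]]]]. simpl in *.
    specialize (Hq n). assert (Eq : (/ 2) ^ S n = (/ 2) ^ n / 2) by (simpl; field).
    set (q := (/ 2) ^ n) in *.
    assert (HqW : 0 < q * W) by (apply Rmult_lt_0_compat; auto).
    assert (HqH : 0 < q * H) by (apply Rmult_lt_0_compat; auto).
    apply NNPP. intros Hno. apply H5. apply Hsplit; auto; apply NNPP; intros HP; apply Hno.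
    - exists (x, y). unfold step, good; rewrite Eq; fold q; simpl; repeat split; auto; lra.
    - exists (x + q / 2 * W, y). unfold step, good; rewrite Eq; fold q; simpl; repeat split; auto; lra.
    - exists (x, y + q / 2 * H). unfold step, good; rewrite Eq; fold q; simpl; repeat split; auto; lra.
    - exists (x + q / 2 * W, y + q / 2 * H). unfold step, good; rewrite Eq; fold q; simpl; repeat split; auto; lra. }
  set (s := fix s (n : nat) : R * R := match n with
    | O => (x0, y0) | S m => epsilon (inhabits (0, 0)) (step m (s m)) end).
  assert (Hgood : forall n, good n (s n)).
  { induction n.
    - unfold good; simpl. rewrite !Rmult_1_l. repeat split; auto; lra.
    - destruct (Hstep n (s n) IHn) as [p' Hp']. simpl.
      apply (epsilon_spec (inhabits (0, 0)) (step n (s n))). exists p'; auto. }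
  assert (Hs : forall n, step n (s n) (s (S n))).
  { intros n. simpl. apply (epsilon_spec (inhabits (0, 0)) (step n (s n))). apply Hstep; auto. }
  destruct (nested_intervals (fun n => fst (s n)) (fun n => fst (s n) + (/ 2) ^ n * W)) as [u Hu].
  { intros n; apply (Hs n). } { intros n; apply (Hs n). }
  { intros n. assert (0 < (/ 2) ^ n * W) by (apply Rmult_lt_0_compat; auto). lra. }
  destruct (nested_intervals (fun n => snd (s n)) (fun n => snd (s n) + (/ 2) ^ n * H)) as [v Hv].
  { intros n; apply (Hs n). } { intros n; apply (Hs n). }
  { intros n. assert (0 < (/ 2) ^ n * H) by (apply Rmult_lt_0_compat; auto). lra. }
  destruct (Hloc u v) as [d [Hd Hloc']].
  { specialize (Hu 0%nat). simpl in Hu. lra. } { specialize (Hv 0%nat). simpl in Hv. lra. }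
  destruct (pow_lt_1_zero (/ 2) ltac:(rewrite Rabs_pos_eq; lra) d Hd) as [n Hn].
  specialize (Hn n (Nat.le_refl n)). rewrite Rabs_pos_eq in Hn by (apply Rlt_le; auto).
  destruct (Hgood n) as [H1 [H2 [H3 [H4 H5]]]]. apply H5. apply Hloc'; auto.
Qed.

Definition Cdiff (f : C -> C) (s : C) : Prop := exists l, forall eps, 0 < eps ->
  exists d, 0 < d /\ forall z, Cmod (z - s) < d ->
    Cmod (f z - f s - (z - s) * l) <= eps * Cmod (z - s).

Lemma ex_derive_Cdiff f s : @ex_derive C_AbsRing C_NormedModule f s -> Cdiff f s.
Proof.
  intros [l [_ Hl]]. exists l. intros eps Heps.
  assert (K := Hl s (fun P HP => HP) (mkposreal eps Heps)).
  destruct K as [d Hd]. exists d. split; [apply cond_pos|]. intros z Hz.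
  assert (Hb : @ball (AbsRing_UniformSpace C_AbsRing) s d z) by exact Hz.
  exact (Hd z Hb).
Qed.

Lemma Cdiff_continuous f s : Cdiff f s -> forall eps, 0 < eps -> exists d, 0 < d /\
  forall z, Cmod (z - s) < d -> Cmod (f z - f s) <= eps.
Proof.
  intros [l Hl] eps Heps. destruct (Hl 1 Rlt_0_1) as [d [Hd H]].
  assert (Hlp := Cmod_ge_0 l).
  exists (Rmin d (eps / (Cmod l + 1))). split.
  { apply Rmin_pos; auto. apply Rdiv_lt_0_compat; lra. }
  intros z Hz. assert (H1 := Rlt_le_trans _ _ _ Hz (Rmin_l _ _)).
  assert (H2 := Rlt_le_trans _ _ _ Hz (Rmin_r _ _)). specialize (H z H1).
  replace (f z - f s)%C with ((f z - f s - (z - s) * l) + (z - s) * l)%C by ring.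
  eapply Rle_trans; [apply Cmod_triangle|]. rewrite Cmod_mult.
  apply Rmult_lt_compat_r with (r := Cmod l + 1) in H2; [|lra].
  unfold Rdiv in H2. rewrite Rmult_assoc, Rinv_l in H2 by lra. lra.
Qed.

Lemma Cdiff_mult f g s : Cdiff f s -> Cdiff g s -> Cdiff (fun z => f z * g z)%C s.
Proof.
  intros Hf Hg. destruct (Cdiff_continuous g s Hg 1 Rlt_0_1) as [d0 [Hd0 H0]].
  destruct Hf as [l Hl]. destruct Hg as [m Hm]. exists (l * g s + f s * m)%C.
  intros eps Heps.
  set (M := Cmod (g s) + 1 + Cmod (f s) + Cmod l * (Cmod m + 1)).
  assert (P1 := Cmod_ge_0 (g s)). assert (P2 := Cmod_ge_0 (f s)).
  assert (P3 := Cmod_ge_0 l). assert (P4 := Cmod_ge_0 m).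
  assert (HM : 0 < M) by (unfold M; nra).
  set (e := eps / (3 * M)). assert (He : 0 < e) by (apply Rdiv_lt_0_compat; lra).
  assert (EM : e * M = eps / 3) by (unfold e; field; lra).
  destruct (Hl e He) as [d1 [Hd1 H1]]. destruct (Hm e He) as [d2 [Hd2 H2]].
  destruct (Hm 1 Rlt_0_1) as [d3 [Hd3 H3]].
  exists (Rmin (Rmin d0 d1) (Rmin (Rmin d2 d3) e)). split; [repeat apply Rmin_pos; auto|].
  intros z Hz. assert (Z1 := Rlt_le_trans _ _ _ Hz (Rmin_l _ _)).
  assert (Z2 := Rlt_le_trans _ _ _ Hz (Rmin_r _ _)).
  assert (Y0 := Rlt_le_trans _ _ _ Z1 (Rmin_l _ _)). assert (Y1 := Rlt_le_trans _ _ _ Z1 (Rmin_r _ _)).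
  assert (Z3 := Rlt_le_trans _ _ _ Z2 (Rmin_l _ _)). assert (Ye := Rlt_le_trans _ _ _ Z2 (Rmin_r _ _)).
  assert (Y2 := Rlt_le_trans _ _ _ Z3 (Rmin_l _ _)). assert (Y3 := Rlt_le_trans _ _ _ Z3 (Rmin_r _ _)).
  specialize (H0 z Y0). specialize (H1 z Y1). specialize (H2 z Y2). specialize (H3 z Y3).
  set (h := Cmod (z - s)) in *. assert (Hh : 0 <= h) by apply Cmod_ge_0.
  assert (G1 : Cmod (g z) <= Cmod (g s) + 1).
  { assert (K := Cmod_rev_triangle (g z) (g s)). lra. }
  assert (G2 : Cmod (g z - g s) <= (Cmod m + 1) * h).
  { replace (g z - g s)%C with ((g z - g s - (z - s) * m) + (z - s) * m)%C by ring.
    eapply Rle_trans; [apply Cmod_triangle|]. rewrite Cmod_mult. fold h. lra. }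
  replace (f z * g z - f s * g s - (z - s) * (l * g s + f s * m))%C with
    ((f z - f s - (z - s) * l) * g z + (f s * (g z - g s - (z - s) * m) + (z - s) * l * (g z - g s)))%C by ring.
  eapply Rle_trans; [apply Cmod_triangle|].
  eapply Rle_trans; [apply Rplus_le_compat_l, Cmod_triangle|]. rewrite !Cmod_mult. fold h.
  assert (T1 : Cmod (f z - f s - (z - s) * l) * Cmod (g z) <= (e * h) * (Cmod (g s) + 1))
    by (apply Rmult_le_compat; auto using Cmod_ge_0).
  assert (T2 : Cmod (f s) * Cmod (g z - g s - (z - s) * m) <= Cmod (f s) * (e * h))
    by (apply Rmult_le_compat_l; auto).
  assert (T3 : h * Cmod l * Cmod (g z - g s) <= e * (Cmod l * (Cmod m + 1)) * h).
  { apply Rle_trans with (e * Cmod l * ((Cmod m + 1) * h)); [|right; ring].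
    apply Rmult_le_compat; auto using Cmod_ge_0.
    - apply Rmult_le_pos; auto.
    - apply Rmult_le_compat_r; lra. }
  assert (T4 : e * M * h <= eps * h) by (apply Rmult_le_compat_r; lra).
  unfold M in T4. lra.
Qed.

Lemma Cdiff_Cexp c s : Cdiff (fun z => Cexp (c * z)) s.
Proof.
  exists (c * Cexp (c * s))%C. intros eps Heps.
  set (A := Cmod (Cexp (c * s))). set (b := Cmod c).
  assert (HA : 0 <= A) by apply Cmod_ge_0. assert (Hb : 0 <= b) by apply Cmod_ge_0.
  set (K := A * b ^ 2 * exp b). assert (HK : 0 <= K).
  { unfold K. apply Rmult_le_pos; [apply Rmult_le_pos; auto; apply pow2_ge_0|apply Rlt_le, exp_pos]. }
  exists (Rmin 1 (eps / (K + 1))). split.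
  { apply Rmin_pos; [lra|]. apply Rdiv_lt_0_compat; lra. }
  intros z Hz. assert (H1 := Rlt_le_trans _ _ _ Hz (Rmin_l _ _)).
  assert (H2 := Rlt_le_trans _ _ _ Hz (Rmin_r _ _)).
  set (h := Cmod (z - s)) in *. assert (Hh : 0 <= h) by apply Cmod_ge_0.
  set (w := (c * (z - s))%C).
  assert (Hw : Cmod w = b * h) by apply Cmod_mult.
  replace (Cexp (c * z) - Cexp (c * s) - (z - s) * (c * Cexp (c * s)))%C with
    (Cexp (c * s) * (Cexp w - Csum 2 (exp_term w)))%C.
  2:{ replace (c * z)%C with (c * s + w)%C by (unfold w; ring). rewrite Cexp_plus.
      unfold exp_term; simpl. unfold w. rewrite Rinv_1. ring. }
  rewrite Cmod_mult. fold A.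
  assert (T := Cexp_Taylor w 1). rewrite Hw in T.
  assert (E : exp (Rabs (Re w)) <= exp b).
  { assert (Rabs (Re w) <= b).
    { eapply Rle_trans; [apply re_le_Cmod|]. rewrite Hw. nra. }
    destruct H as [H| ->]; [apply Rlt_le, exp_increasing; auto|lra]. }
  assert (T2 : Cmod (Cexp w - Csum 2 (exp_term w)) <= (b * h) ^ 2 * exp b).
  { eapply Rle_trans; [exact T|]. simpl (INR _).
    assert (P : 0 <= (b * h) ^ 2) by apply pow2_ge_0.
    apply Rmult_le_compat; auto; [|apply Rlt_le, exp_pos|]; lra. }
  apply Rle_trans with (A * ((b * h) ^ 2 * exp b)); [apply Rmult_le_compat_l; auto|].
  replace (A * ((b * h) ^ 2 * exp b)) with (K * h * h) by (unfold K; ring).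
  apply Rmult_le_compat_r; auto.
  apply Rmult_lt_compat_r with (r := K + 1) in H2; [|lra].
  unfold Rdiv in H2. rewrite Rmult_assoc, Rinv_l in H2 by lra. nra.
Qed.

Definition contour (f : C -> C) (x1 x2 y1 y2 : R) : C :=
  (CI (fun t => f (t, y1)) x1 x2 + Ci * CI (fun t => f (x2, t)) y1 y2
   - CI (fun t => f (t, y2)) x1 x2 - Ci * CI (fun t => f (x1, t)) y1 y2)%C.

(** Integrability is asked on all horizontal and vertical segments, not only on the boundary, so
    that it passes to the subrectangles of a bisection. *)
Definition rect_int (f : C -> C) (x1 x2 y1 y2 : R) : Prop :=
  (forall a b y, x1 <= a -> a <= b -> b <= x2 -> y1 <= y <= y2 -> Cint (fun t => f (t, y)) a b) /\
  (forall a b x, y1 <= a -> a <= b -> b <= y2 -> x1 <= x <= x2 -> Cint (fun t => f (x, t)) a b).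

Lemma contour_minus f g x1 x2 y1 y2 : x1 <= x2 -> y1 <= y2 -> rect_int f x1 x2 y1 y2 -> rect_int g x1 x2 y1 y2 ->
  contour (fun z => f z - g z)%C x1 x2 y1 y2 = (contour f x1 x2 y1 y2 - contour g x1 x2 y1 y2)%C.
Proof.
  intros Hx Hy [F1 F2] [G1 G2]. unfold contour.
  assert (a1 := F1 x1 x2 y1 ltac:(lra) Hx ltac:(lra) ltac:(lra)).
  assert (a2 := G1 x1 x2 y1 ltac:(lra) Hx ltac:(lra) ltac:(lra)).
  assert (a3 := F1 x1 x2 y2 ltac:(lra) Hx ltac:(lra) ltac:(lra)).
  assert (a4 := G1 x1 x2 y2 ltac:(lra) Hx ltac:(lra) ltac:(lra)).
  assert (b1 := F2 y1 y2 x1 ltac:(lra) Hy ltac:(lra) ltac:(lra)).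
  assert (b2 := G2 y1 y2 x1 ltac:(lra) Hy ltac:(lra) ltac:(lra)).
  assert (b3 := F2 y1 y2 x2 ltac:(lra) Hy ltac:(lra) ltac:(lra)).
  assert (b4 := G2 y1 y2 x2 ltac:(lra) Hy ltac:(lra) ltac:(lra)).
  rewrite (CI_minus _ _ _ _ a1 a2), (CI_minus _ _ _ _ a3 a4), (CI_minus _ _ _ _ b1 b2), (CI_minus _ _ _ _ b3 b4).
  ring.
Qed.

Lemma contour_bound f x1 x2 y1 y2 B : x1 <= x2 -> y1 <= y2 -> rect_int f x1 x2 y1 y2 ->
  (forall x y, x1 <= x <= x2 -> y1 <= y <= y2 -> Cmod (f (x, y)) <= B) ->
  Cmod (contour f x1 x2 y1 y2) <= 2 * ((x2 - x1) + (y2 - y1)) * B.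
Proof.
  intros Hx Hy [F1 F2] HB. unfold contour.
  assert (K1 : Cmod (CI (fun t => f (t, y1)) x1 x2) <= (x2 - x1) * B)
    by (apply CI_bound; auto; [apply F1; lra|intros; apply HB; lra]).
  assert (K2 : Cmod (CI (fun t => f (t, y2)) x1 x2) <= (x2 - x1) * B)
    by (apply CI_bound; auto; [apply F1; lra|intros; apply HB; lra]).
  assert (K3 : Cmod (CI (fun t => f (x2, t)) y1 y2) <= (y2 - y1) * B)
    by (apply CI_bound; auto; [apply F2; lra|intros; apply HB; lra]).
  assert (K4 : Cmod (CI (fun t => f (x1, t)) y1 y2) <= (y2 - y1) * B)
    by (apply CI_bound; auto; [apply F2; lra|intros; apply HB; lra]).
  unfold Cminus.
  eapply Rle_trans; [apply Cmod_triangle|]. rewrite Cmod_opp, Cmod_mult, Cmod_Ci.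
  eapply Rle_trans; [apply Rplus_le_compat_r, Cmod_triangle|]. rewrite Cmod_opp.
  eapply Rle_trans; [apply Rplus_le_compat_r, Rplus_le_compat_r, Cmod_triangle|]. rewrite Cmod_mult, Cmod_Ci.
  lra.
Qed.

Lemma Ccont_RtoC : Ccont (fun t => RtoC t).
Proof. intros t; split; [apply continuous_id|apply continuous_const]. Qed.

Lemma CI_RtoC a b : CI (fun t => RtoC t) a b = RtoC ((b ^ 2 - a ^ 2) / 2).
Proof.
  apply C_ext; simpl.
  - apply is_RInt_unique.
    replace ((b * (b * 1) - a * (a * 1)) / 2) with (b ^ 2 / 2 - a ^ 2 / 2) by (simpl; field).
    apply (is_RInt_derive (V := R_CompleteNormedModule) (fun x => x ^ 2 / 2) (fun x => x)).
    + intros x _. auto_derive; auto. field.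
    + intros x _. apply continuous_id.
  - rewrite RInt_const. unfold scal; simpl; unfold mult; simpl. ring.
Qed.

Lemma Cpair (x y : R) : (x, y) = (RtoC x + Ci * RtoC y)%C.
Proof. apply C_ext; simpl; ring. Qed.

Lemma Ccont_affine c0 c : Ccont (fun t => c0 + c * RtoC t)%C.
Proof. apply Ccont_plus; [apply Ccont_const|apply Ccont_mult; [apply Ccont_const|apply Ccont_RtoC]]. Qed.

Lemma CI_affine c0 c a b : CI (fun t => c0 + c * RtoC t)%C a b =
  (RtoC (b - a) * c0 + c * RtoC ((b ^ 2 - a ^ 2) / 2))%C.
Proof.
  rewrite CI_plus, CI_const, CI_scal, CI_RtoC; auto using Cint_cont, Ccont_const, Ccont_mult, Ccont_RtoC, Cint_scal.
Qed.

Lemma rect_int_affine c0 c x1 x2 y1 y2 : rect_int (fun z => c0 + c * z)%C x1 x2 y1 y2.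
Proof.
  split; intros; apply Cint_cont.
  - apply Ccont_ext with (2 := Ccont_affine (c0 + c * (Ci * RtoC y)) c). intros t. rewrite (Cpair t y). ring.
  - apply Ccont_ext with (2 := Ccont_affine (c0 + c * RtoC x) (c * Ci)). intros t. rewrite (Cpair x t). ring.
Qed.

Lemma contour_affine c0 c x1 x2 y1 y2 : contour (fun z => c0 + c * z)%C x1 x2 y1 y2 = RtoC 0.
Proof.
  unfold contour.
  assert (E1 : forall y, CI (fun t => c0 + c * (t, y))%C x1 x2 =
    (RtoC (x2 - x1) * (c0 + c * (Ci * RtoC y)) + c * RtoC ((x2 ^ 2 - x1 ^ 2) / 2))%C).
  { intros y. rewrite <- CI_affine. apply CI_ext. intros t _. rewrite (Cpair t y). ring. }
  assert (E2 : forall x, CI (fun t => c0 + c * (x, t))%C y1 y2 =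
    (RtoC (y2 - y1) * (c0 + c * RtoC x) + c * Ci * RtoC ((y2 ^ 2 - y1 ^ 2) / 2))%C).
  { intros y. rewrite <- CI_affine. apply CI_ext. intros t _. rewrite (Cpair y t). ring. }
  rewrite !E1, !E2. destruct c0 as [p q], c as [r s]. apply C_ext; simpl; field.
Qed.

Lemma contour_split f x1 x2 x3 y1 y2 y3 : x1 <= x2 <= x3 -> y1 <= y2 <= y3 -> rect_int f x1 x3 y1 y3 ->
  contour f x1 x3 y1 y3 = (contour f x1 x2 y1 y2 + contour f x2 x3 y1 y2 +
    contour f x1 x2 y2 y3 + contour f x2 x3 y2 y3)%C.
Proof.
  intros Hx Hy [F1 F2]. unfold contour.
  rewrite <- (CI_Chasles (fun t => f (t, y1)) x1 x2 x3) by (apply F1; lra).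
  rewrite <- (CI_Chasles (fun t => f (t, y3)) x1 x2 x3) by (apply F1; lra).
  rewrite <- (CI_Chasles (fun t => f (x1, t)) y1 y2 y3) by (apply F2; lra).
  rewrite <- (CI_Chasles (fun t => f (x3, t)) y1 y2 y3) by (apply F2; lra).
  ring.
Qed.

Lemma Cdiff_rect_int f x1 x2 y1 y2 :
  (forall x y, x1 <= x <= x2 -> y1 <= y <= y2 -> Cdiff f (x, y)) -> rect_int f x1 x2 y1 y2.
Proof.
  intros H. split; intros; apply Cint_cont_on; auto; intros t Ht; apply Ccont_at_eps; intros eps Heps.
  - destruct (Cdiff_continuous f (t, y) (H t y ltac:(lra) ltac:(lra)) (eps / 2)) as [d [Hd K]]; [lra|].
    exists d. split; auto. intros x Hx. apply Rle_lt_trans with (eps / 2); [|lra]. apply K.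
    replace ((x, y) - (t, y))%C with (RtoC (x - t)) by (apply C_ext; simpl; ring). rewrite Cmod_R; auto.
  - destruct (Cdiff_continuous f (x, t) (H x t ltac:(lra) ltac:(lra)) (eps / 2)) as [d [Hd K]]; [lra|].
    exists d. split; auto. intros y Hy. apply Rle_lt_trans with (eps / 2); [|lra]. apply K.
    replace ((x, y) - (x, t))%C with (Ci * RtoC (y - t))%C by (apply C_ext; simpl; ring).
    rewrite Cmod_mult, Cmod_Ci, Cmod_R, Rmult_1_l; auto.
Qed.

Lemma rect_int_minus f g x1 x2 y1 y2 : rect_int f x1 x2 y1 y2 -> rect_int g x1 x2 y1 y2 ->
  rect_int (fun z => f z - g z)%C x1 x2 y1 y2.
Proof. intros [F1 F2] [G1 G2]; split; intros; apply Cint_minus; auto. Qed.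

Lemma rect_int_sub f x1 x2 y1 y2 x1' x2' y1' y2' : rect_int f x1 x2 y1 y2 ->
  x1 <= x1' -> x2' <= x2 -> y1 <= y1' -> y2' <= y2 -> rect_int f x1' x2' y1' y2'.
Proof. intros [F1 F2] H1 H2 H3 H4; split; intros; [apply F1|apply F2]; lra. Qed.

(** The bound [e * q ^ 2] is preserved by joining four quarters, because $4(q/2)^2=q^2$. Near a
    point [f] may be replaced by its deviation from the affine approximation, whose contour integral
    is zero; this deviation and the perimeter are both of order [q]. *)
Theorem Goursat f x0 y0 W H : 0 < W -> 0 < H ->
  (forall x y, x0 <= x <= x0 + W -> y0 <= y <= y0 + H -> Cdiff f (x, y)) ->
  contour f x0 (x0 + W) y0 (y0 + H) = RtoC 0.
Proof.
  intros HW HH Hf.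
  assert (Hint := Cdiff_rect_int f _ _ _ _ Hf).
  assert (Hall : forall e, 0 < e -> Cmod (contour f x0 (x0 + W) y0 (y0 + H)) <= e).
  { intros e He.
    set (P := fun x y q => Cmod (contour f x (x + q * W) y (y + q * H)) <= e * q ^ 2).
    assert (K : P x0 y0 1).
    { apply (rectangle_bisection W H x0 y0 P); auto.
      - intros x y q Hq X1 X2 Y1 Y2 P1 P2 P3 P4. unfold P in *.
        assert (HqW : 0 < q * W) by (apply Rmult_lt_0_compat; auto).
        assert (HqH : 0 < q * H) by (apply Rmult_lt_0_compat; auto).
        rewrite (contour_split f x (x + q / 2 * W) (x + q * W) y (y + q / 2 * H) (y + q * H));
          [|lra|lra|apply (rect_int_sub f x0 (x0 + W) y0 (y0 + H)); auto].
        replace (x + q / 2 * W + q / 2 * W) with (x + q * W) in P2, P4 by field.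
        replace (y + q / 2 * H + q / 2 * H) with (y + q * H) in P3, P4 by field.
        eapply Rle_trans; [apply Cmod_triangle|].
        eapply Rle_trans; [apply Rplus_le_compat_r, Cmod_triangle|].
        eapply Rle_trans; [apply Rplus_le_compat_r, Rplus_le_compat_r, Cmod_triangle|].
        replace (e * q ^ 2) with (e * (q / 2) ^ 2 + e * (q / 2) ^ 2 + e * (q / 2) ^ 2 + e * (q / 2) ^ 2) by field.
        lra.
      - intros u v Hu Hv. destruct (Hf u v Hu Hv) as [l Hl].
        (* The deviation is at most [c * q * (W + H)] and the perimeter is [2 * q * (W + H)]; their
           product is exactly [e * q ^ 2]. *)
        set (c := e / (2 * (W + H) ^ 2)).
        assert (HWH : 0 < (W + H) ^ 2) by (apply pow_lt; lra).
        assert (Hc : 0 < c) by (apply Rdiv_lt_0_compat; lra).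
        destruct (Hl c Hc) as [d [Hd Hld]].
        exists (d / (W + H)). split; [apply Rdiv_lt_0_compat; lra|].
        intros x y q [Hq Hqd] X Y X1 X2 Y1 Y2. unfold P.
        assert (HqW : 0 < q * W) by (apply Rmult_lt_0_compat; auto).
        assert (HqH : 0 < q * H) by (apply Rmult_lt_0_compat; auto).
        assert (Hqd' : q * (W + H) < d).
        { apply Rmult_lt_compat_r with (r := W + H) in Hqd; [|lra].
          unfold Rdiv in Hqd. rewrite Rmult_assoc, Rinv_l in Hqd; lra. }
        set (c0 := (f (u, v) - l * (u, v))%C).
        assert (Ri : rect_int f x (x + q * W) y (y + q * H))
          by (apply (rect_int_sub f x0 (x0 + W) y0 (y0 + H)); auto).
        assert (Ra := rect_int_affine c0 l x (x + q * W) y (y + q * H)).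
        assert (E : contour f x (x + q * W) y (y + q * H) =
          contour (fun z => f z - (c0 + l * z))%C x (x + q * W) y (y + q * H)).
        { rewrite (contour_minus f (fun z => c0 + l * z)%C) by (auto; lra). rewrite contour_affine. ring. }
        rewrite E.
        eapply Rle_trans.
        { apply contour_bound with (B := c * (q * (W + H))); [lra|lra|apply rect_int_minus; auto|].
          intros x' y' Hx' Hy'.
          assert (Hz : Cmod ((x', y') - (u, v)) <= q * (W + H)).
          { eapply Rle_trans; [apply Cmod_le_re_im|]. simpl. unfold Rminus in *.
            assert (Rabs (x' + - u) <= q * W) by (apply Rabs_le; lra).
            assert (Rabs (y' + - v) <= q * H) by (apply Rabs_le; lra). lra. }
          replace (f (x', y') - (c0 + l * (x', y')))%C with
            (f (x', y') - f (u, v) - ((x', y') - (u, v)) * l)%C by (unfold c0; ring).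
          eapply Rle_trans; [apply Hld; lra|]. apply Rmult_le_compat_l; lra. }
        right. unfold c. field. lra. }
    unfold P in K. rewrite !Rmult_1_l in K. simpl in K. lra. }
  apply Cmod_eq_0. apply Rle_antisym; [|apply Cmod_ge_0].
  apply le_epsilon. intros e He. rewrite Rplus_0_l. auto.
Qed.

(** * Fourier coefficients of almost periodic functions on a strip *)

Definition in_strip (alpha beta : Rbar) (sigma : R) : Prop := Rbar_lt alpha sigma /\ Rbar_lt sigma beta.

Lemma in_strip_exists alpha beta : Rbar_lt alpha beta -> exists sigma, in_strip alpha beta sigma.
Proof.
  unfold in_strip. destruct alpha as [a| |], beta as [b| |]; simpl; intros H; try contradiction.
  - exists ((a + b) / 2). lra.
  - exists (a + 1). split; auto. lra.
  - exists (b - 1). split; auto. lra.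
  - exists 0. auto.
Qed.

Lemma in_strip_between alpha beta x y z : in_strip alpha beta x -> in_strip alpha beta y ->
  x <= z <= y -> in_strip alpha beta z.
Proof.
  intros [H1 _] [_ H2] [H3 H4]. split.
  - apply Rbar_lt_le_trans with x; auto.
  - apply Rbar_le_lt_trans with y; auto.
Qed.

Lemma AP_Cdiff alpha beta f x y : AP alpha beta f -> in_strip alpha beta x -> Cdiff f (x, y).
Proof. intros [H _] Hx. apply ex_derive_Cdiff, H. exact Hx. Qed.

Lemma Cdiff_line f x t : Cdiff f (x, t) -> Ccont_at (fun t => f (x, t)) t.
Proof.
  intros H. apply Ccont_at_eps. intros eps Heps.
  destruct (Cdiff_continuous f (x, t) H (eps / 2)) as [d [Hd K]]; [lra|].
  exists d. split; auto. intros y Hy. apply Rle_lt_trans with (eps / 2); [|lra]. apply K.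
  replace ((x, y) - (x, t))%C with (Ci * RtoC (y - t))%C by (apply C_ext; simpl; ring).
  rewrite Cmod_mult, Cmod_Ci, Cmod_R, Rmult_1_l; auto.
Qed.

Lemma Cdiff_hline f x y : Cdiff f (x, y) -> Ccont_at (fun t => f (t, y)) x.
Proof.
  intros H. apply Ccont_at_eps. intros eps Heps.
  destruct (Cdiff_continuous f (x, y) H (eps / 2)) as [d [Hd K]]; [lra|].
  exists d. split; auto. intros t Ht. apply Rle_lt_trans with (eps / 2); [|lra]. apply K.
  replace ((t, y) - (x, y))%C with (RtoC (t - x))%C by (apply C_ext; simpl; ring).
  rewrite Cmod_R; auto.
Qed.

Lemma vertical_shift (x t tau : R) : ((x, t) + Ci * RtoC tau)%C = (x, t + tau).
Proof. apply C_ext; simpl; ring. Qed.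

Lemma AP_line_CAP alpha beta f x : AP alpha beta f -> in_strip alpha beta x -> CAP (fun t => f (x, t)).
Proof.
  intros Hf Hx.
  assert (Hc : Ccont (fun t => f (x, t))).
  { intros t. apply Cdiff_line, (AP_Cdiff alpha beta); auto. }
  split; auto. apply ap_TB; auto.
  intros eps Heps. destruct (proj2 Hf eps x x Heps (proj1 Hx) (Rle_refl x) (proj2 Hx)) as [l [Hl H]].
  exists l. split; auto. intros y. destruct (H y) as [tau [Ht K]]. exists tau. split; auto.
  intros t. specialize (K (x, t) ltac:(simpl; unfold Re; simpl; lra)). rewrite vertical_shift in K. exact K.
Qed.

Lemma segment_bounded f x1 x2 y : (forall x, x1 <= x <= x2 -> Cdiff f (x, y)) ->
  exists M, 0 < M /\ forall x, x1 <= x <= x2 -> Cmod (f (x, y)) <= M.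
Proof.
  intros H.
  destruct (bounded_continuity (V := R_NormedModule) (fun x => Re (f (x, y))) x1 x2) as [M1 H1].
  { intros x Hx. apply (Cdiff_hline f x y); auto. }
  destruct (bounded_continuity (V := R_NormedModule) (fun x => Im (f (x, y))) x1 x2) as [M2 H2].
  { intros x Hx. apply (Cdiff_hline f x y); auto. }
  exists (Rabs M1 + Rabs M2 + 1). split.
  { generalize (Rabs_pos M1) (Rabs_pos M2); lra. }
  intros x Hx. eapply Rle_trans; [apply Cmod_le_re_im|].
  specialize (H1 x Hx). specialize (H2 x Hx).
  change (Rabs (Re (f (x, y))) < M1) in H1. change (Rabs (Im (f (x, y))) < M2) in H2.
  generalize (Rle_abs M1) (Rle_abs M2). lra.
Qed.

Definition exp_twist (f : C -> C) (l : R) (s : C) : C := (f s * Cexp (- RtoC l * s))%C.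

Lemma exp_twist_line f l x t : exp_twist f l (x, t) = (RtoC (exp (- l * x)) * twist (fun t => f (x, t)) l t)%C.
Proof. unfold exp_twist, twist. rewrite <- RtoC_opp, Cexp_line. ring. Qed.

(** Cauchy's theorem on [[x1, x2] x [0, tau]] with [tau] an almost period: the horizontal sides
    stay bounded as [tau] grows. *)
Lemma mean_indep_abscissa alpha beta f l x1 x2 m1 m2 : AP alpha beta f ->
  in_strip alpha beta x1 -> in_strip alpha beta x2 -> x1 < x2 ->
  is_mean (fun t => exp_twist f l (x1, t)) m1 -> is_mean (fun t => exp_twist f l (x2, t)) m2 -> m1 = m2.
Proof.
  intros Hf S1 S2 Hx M1 M2.
  assert (Hst : forall x, x1 <= x <= x2 -> in_strip alpha beta x).
  { intros x Hx'. apply in_strip_between with x1 x2; auto. }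
  set (g := exp_twist f l).
  assert (Dg : forall x y, x1 <= x <= x2 -> Cdiff g (x, y)).
  { intros x y Hx'. apply Cdiff_mult; [apply (AP_Cdiff alpha beta); auto|apply Cdiff_Cexp]. }
  destruct (segment_bounded f x1 x2 0) as [B [HB Hb]].
  { intros x Hx'. apply (AP_Cdiff alpha beta); auto. }
  set (E := exp (Rabs l * (Rabs x1 + Rabs x2))).
  assert (HE : 0 < E) by apply exp_pos.
  assert (Hexp : forall x y, x1 <= x <= x2 -> Cmod (Cexp (- RtoC l * (x, y))) <= E).
  { intros x y Hx'. rewrite Cmod_Cexp. unfold E.
    assert (K : Re (- RtoC l * (x, y))%C <= Rabs l * (Rabs x1 + Rabs x2)).
    { replace (Re (- RtoC l * (x, y))%C) with (- (l * x)) by (simpl; unfold Re; simpl; ring).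
      eapply Rle_trans; [apply Rle_abs|]. rewrite Rabs_Ropp, Rabs_mult.
      apply Rmult_le_compat_l; [apply Rabs_pos|]. unfold Rabs.
      destruct (Rcase_abs x), (Rcase_abs x1), (Rcase_abs x2); lra. }
    destruct K as [K| ->]; [apply Rlt_le, exp_increasing; auto|lra]. }
  apply NNPP. intros Hne.
  assert (HD : 0 < Cmod (m1 - m2)).
  { apply Cmod_gt_0. intros K. apply Hne. replace m1 with ((m1 - m2) + m2)%C by ring. rewrite K. ring. }
  set (D := Cmod (m1 - m2)) in *.
  destruct (M1 (D / 8)) as [T1 [HT1 K1]]; [lra|]. destruct (M2 (D / 8)) as [T2 [HT2 K2]]; [lra|].
  (* On the side at height [tau], [f] is within 1 of its values at height 0, hence [B + 1]; [E]
     bounds the exponential factor on the whole strip between the two lines. *)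
  set (M := (B + 1) * E). assert (HM : 0 < M) by (apply Rmult_lt_0_compat; lra).
  destruct (proj2 Hf 1 x1 x2 Rlt_0_1 (proj1 S1) (Rlt_le _ _ Hx) (proj2 S2)) as [len [Hlen Hap]].
  set (X := Rmax (Rmax T1 T2) (8 * (x2 - x1) * M / D)).
  destruct (Hap X) as [tau [Htau Hper]].
  assert (X1 : Rmax T1 T2 <= X) by apply Rmax_l.
  assert (X2 : 8 * (x2 - x1) * M / D <= X) by apply Rmax_r.
  assert (Y1 := Rmax_l T1 T2). assert (Y2 := Rmax_r T1 T2).
  assert (Htp : 0 < tau) by lra.
  specialize (K1 tau ltac:(lra) 0). specialize (K2 tau ltac:(lra) 0).
  assert (G := Goursat g x1 0 (x2 - x1) tau ltac:(lra) Htp).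
  replace (x1 + (x2 - x1)) with x2 in G by ring.
  specialize (G (fun x y Hx' _ => Dg x y Hx')). unfold contour in G.
  assert (Hh : forall y, (y = 0 \/ y = tau) -> Cmod (CI (fun t => g (t, y)) x1 x2) <= (x2 - x1) * M).
  { intros y Hy. apply CI_bound; [lra| |].
    - apply Cint_cont_on; [lra|]. intros t Ht. apply Cdiff_hline, Dg; auto.
    - intros x Hx'. unfold g, exp_twist. rewrite Cmod_mult. apply Rmult_le_compat; auto using Cmod_ge_0.
      destruct Hy as [->| ->]; [specialize (Hb x Hx'); lra|].
      specialize (Hper (x, 0) ltac:(simpl; unfold Re; simpl; lra)).
      rewrite vertical_shift, Rplus_0_l in Hper.
      assert (K := Cmod_rev_triangle (f (x, tau)) (f (x, 0))). specialize (Hb x Hx'). lra. }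
  assert (H0 := Hh 0 ltac:(auto)). assert (Ht := Hh tau ltac:(auto)).
  set (A := CI (fun t => g (t, 0)) x1 x2) in *. set (A' := CI (fun t => g (t, tau)) x1 x2) in *.
  rewrite Rplus_0_l in G, K1, K2. fold g in K1, K2. fold A A' in G.
  set (V1 := CI (fun t => g (x1, t)) 0 tau) in *. set (V2 := CI (fun t => g (x2, t)) 0 tau) in *.
  (* Cauchy's theorem expresses the difference of the vertical integrals by the two horizontal ones,
     a bound independent of [tau]. Different means would make this difference grow linearly in
     [tau]. *)
  assert (K3 : Cmod (V1 - V2) <= 2 * ((x2 - x1) * M)).
  { replace (V1 - V2)%C with (- Ci * (A - A') + Ci * (A + Ci * V2 - A' - Ci * V1))%C.
    - rewrite G. replace (- Ci * (A - A') + Ci * RtoC 0)%C with (- (Ci * (A - A')))%C by ring.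
      rewrite Cmod_opp, Cmod_mult, Cmod_Ci, Rmult_1_l.
      eapply Rle_trans; [apply Cmod_triangle|]. rewrite Cmod_opp. lra.
    - assert (Eci : (Ci * Ci = - RtoC 1)%C) by (apply C_ext; simpl; ring).
      transitivity (Ci * Ci * (V2 - V1))%C; [ring|]. rewrite Eci. ring. }
  assert (K4 : tau * D <= 2 * ((x2 - x1) * M) + D / 4 * tau).
  { replace (tau * D) with (Cmod (RtoC tau * m1 - RtoC tau * m2)).
    - replace (RtoC tau * m1 - RtoC tau * m2)%C with
        (- (V1 - RtoC tau * m1) + ((V1 - V2) + (V2 - RtoC tau * m2)))%C by ring.
      eapply Rle_trans; [apply Cmod_triangle|]. rewrite Cmod_opp.
      assert (K5 := Cmod_triangle (V1 - V2) (V2 - RtoC tau * m2)). lra.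
    - replace (RtoC tau * m1 - RtoC tau * m2)%C with (RtoC tau * (m1 - m2))%C by ring.
      rewrite Cmod_mult, Cmod_R, Rabs_pos_eq by lra. reflexivity. }
  assert (K5 : 8 * (x2 - x1) * M < tau * D).
  { assert (K6 : 8 * (x2 - x1) * M / D < tau) by lra.
    apply Rmult_lt_compat_r with (r := D) in K6; auto. unfold Rdiv in K6.
    rewrite Rmult_assoc, Rinv_l, Rmult_1_r in K6 by lra. auto. }
  assert (K6 : 0 < tau * D) by (apply Rmult_lt_0_compat; auto). lra.
Qed.

Lemma mean_filterlim g m : Ccont g -> is_mean g m ->
  filterlim (fun T => RtoC (/ (2 * T)) * @RInt C_R_CompleteNormedModule g (- T) T)%C
    (Rbar_locally p_infty) (@locally C_UniformSpace m).
Proof.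
  intros Cg Hm. apply filterlim_locally. intros eps.
  destruct (Hm (eps / 2)) as [T0 [HT0 K]]; [generalize (cond_pos eps); lra|].
  exists T0. intros T HT. apply C_NormedModule_mixin_compat1.
  rewrite RInt_C_CI by (apply Cint_cont; auto).
  specialize (K (2 * T) ltac:(lra) (- T)). replace (- T + 2 * T) with T in K by ring.
  change (Cmod (RtoC (/ (2 * T)) * CI g (- T) T - m) < eps).
  replace (RtoC (/ (2 * T)) * CI g (- T) T - m)%C with (RtoC (/ (2 * T)) * (CI g (- T) T - RtoC (2 * T) * m))%C.
  - rewrite Cmod_mult, Cmod_R, Rabs_pos_eq by (apply Rlt_le, Rinv_0_lt_compat; lra).
    apply Rmult_lt_reg_l with (2 * T); [lra|].
    rewrite <- Rmult_assoc, Rinv_r, Rmult_1_l by lra. generalize (cond_pos eps). nra.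
  - transitivity (RtoC (/ (2 * T)) * CI g (- T) T - RtoC (/ (2 * T)) * RtoC (2 * T) * m)%C; [ring|].
    rewrite <- RtoC_mult, Rinv_l by lra. ring.
Qed.

Lemma fourier_mean_mean alpha beta f l x m : AP alpha beta f -> in_strip alpha beta x ->
  is_mean (fun t => exp_twist f l (x, t)) m ->
  filterlim (fourier_mean f l x) (Rbar_locally p_infty) (@locally C_UniformSpace m).
Proof.
  intros Hf Hx Hm.
  assert (Cg : Ccont (fun t => exp_twist f l (x, t))).
  { apply Ccont_ext with (fun t => RtoC (exp (- l * x)) * twist (fun t => f (x, t)) l t)%C.
    - intros t. rewrite exp_twist_line; auto.
    - apply Ccont_mult; [apply Ccont_const|apply Ccont_twist, (AP_line_CAP alpha beta); auto]. }
  apply filterlim_ext with (2 := mean_filterlim _ m Cg Hm).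
  intros T. unfold fourier_mean. f_equal. apply (RInt_ext (V := C_R_CompleteNormedModule)).
  intros t _. unfold exp_twist. f_equal. f_equal. ring.
Qed.

(** The means on all lines coincide, so their common value satisfies [is_fourier_coef], and
    uniqueness of limits identifies it with the value of [iota]. The factor [exp (l * x)] appears
    because [twist] removes only the oscillating part of $e^{ls}$. *)
Theorem fourier_coef_mean alpha beta f l x : Rbar_lt alpha beta -> AP alpha beta f -> in_strip alpha beta x ->
  is_mean (twist (fun t => f (x, t)) l) (RtoC (exp (l * x)) * fourier_coef alpha beta f l)%C.
Proof.
  intros Hab Hf Hx.
  assert (Hex : forall y, in_strip alpha beta y -> exists m, is_mean (fun t => exp_twist f l (y, t)) m).
  { intros y Hy. apply CAP_mean.
    apply CAP_ext with (fun t => RtoC (exp (- l * y)) * twist (fun t => f (y, t)) l t)%C.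
    - intros t. rewrite exp_twist_line; auto.
    - apply CAP_mult; [apply CAP_const|apply CAP_twist, (AP_line_CAP alpha beta); auto]. }
  destruct (Hex x Hx) as [m Hm].
  assert (Hall : forall y, in_strip alpha beta y -> is_mean (fun t => exp_twist f l (y, t)) m).
  { intros y Hy. destruct (Hex y Hy) as [m' Hm'].
    destruct (Rtotal_order x y) as [H|[H|H]].
    - rewrite (mean_indep_abscissa alpha beta f l x y m m'); auto.
    - rewrite <- H; auto.
    - rewrite <- (mean_indep_abscissa alpha beta f l y x m' m); auto. }
  assert (E : fourier_coef alpha beta f l = m).
  { apply (iota_unique (V := C_R_CompleteNormedModule)).
    - intros m' Hm'. specialize (Hm' x (proj1 Hx) (proj2 Hx)).
      apply (filterlim_locally_unique (V := C_R_NormedModule) (F := Rbar_locally p_infty) (fourier_mean f l x)); auto.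
      apply (fourier_mean_mean alpha beta f l x m Hf Hx Hm).
    - intros y H1 H2. apply (fourier_mean_mean alpha beta f l y m Hf); [split; auto|].
      apply Hall; split; auto. }
  rewrite E. apply mean_ext with (fun t => RtoC (exp (l * x)) * exp_twist f l (x, t))%C.
  - intros t. rewrite exp_twist_line, Cmult_assoc, <- RtoC_mult, <- exp_plus.
    replace (l * x + - l * x) with 0 by ring. rewrite exp_0. ring.
  - apply mean_scal; auto. apply Ccont_ext with (fun t => RtoC (exp (- l * x)) * twist (fun t => f (x, t)) l t)%C.
    + intros t. rewrite exp_twist_line; auto.
    + apply Ccont_mult; [apply Ccont_const|apply Ccont_twist, (AP_line_CAP alpha beta); auto].
Qed.

(** * Absolutely convergent series of complex numbers *)

Definition CSer (x : nat -> C) : C := (Series (fun n => Re (x n)), Series (fun n => Im (x n))).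

Definition Csummable (x : nat -> C) : Prop := ex_series (fun n => Cmod (x n)).

Lemma ex_series_dom (a b : nat -> R) : (forall n, Rabs (a n) <= b n) -> ex_series b -> ex_series a.
Proof. intros H Hb. apply (ex_series_le (V := R_CompleteNormedModule) a b); auto. Qed.

Lemma Csummable_dom x (b : nat -> R) : (forall n, Cmod (x n) <= b n) -> ex_series b -> Csummable x.
Proof.
  intros H Hb. apply ex_series_dom with b; auto. intros n. rewrite Rabs_pos_eq; auto using Cmod_ge_0.
Qed.

Lemma Csummable_Re x : Csummable x -> ex_series (fun n => Re (x n)).
Proof. apply ex_series_dom. intros; apply re_le_Cmod. Qed.

Lemma Csummable_Im x : Csummable x -> ex_series (fun n => Im (x n)).
Proof. apply ex_series_dom. intros; apply im_le_Cmod. Qed.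

Lemma CSer_ext x y : (forall n, x n = y n) -> CSer x = CSer y.
Proof. intros E. unfold CSer. f_equal; apply Series_ext; intros; rewrite E; auto. Qed.

Lemma Csummable_ext x y : (forall n, x n = y n) -> Csummable x -> Csummable y.
Proof. intros E H. apply ex_series_ext with (2 := H). intros; rewrite E; auto. Qed.

Lemma Csummable_plus x y : Csummable x -> Csummable y -> Csummable (fun n => x n + y n)%C.
Proof.
  intros Hx Hy. apply Csummable_dom with (fun n => Cmod (x n) + Cmod (y n)).
  - intros; apply Cmod_triangle.
  - exact (ex_series_plus _ _ Hx Hy).
Qed.

Lemma ex_series_scal_R (c : R) (b : nat -> R) : ex_series b -> ex_series (fun n => c * b n).
Proof. intros H. exact (ex_series_scal c b H). Qed.

Lemma Csummable_scal c x : Csummable x -> Csummable (fun n => c * x n)%C.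
Proof.
  intros Hx. apply Csummable_dom with (fun n => Cmod c * Cmod (x n)).
  - intros; rewrite Cmod_mult; lra.
  - apply ex_series_scal_R, Hx.
Qed.

Lemma CSer_plus x y : Csummable x -> Csummable y -> CSer (fun n => x n + y n)%C = (CSer x + CSer y)%C.
Proof.
  intros Hx Hy. apply C_ext; simpl.
  - apply (Series_plus (fun n => Re (x n)) (fun n => Re (y n))); apply Csummable_Re; auto.
  - apply (Series_plus (fun n => Im (x n)) (fun n => Im (y n))); apply Csummable_Im; auto.
Qed.

Lemma CSer_scal c x : Csummable x -> CSer (fun n => c * x n)%C = (c * CSer x)%C.
Proof.
  intros Hx. assert (H1 := Csummable_Re x Hx). assert (H2 := Csummable_Im x Hx).
  apply C_ext; simpl.
  - transitivity (Series (fun n => Re c * Re (x n)) - Series (fun n => Im c * Im (x n))).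
    + rewrite <- Series_minus by (apply ex_series_scal_R; auto). apply Series_ext. intros; reflexivity.
    + rewrite !Series_scal_l. reflexivity.
  - transitivity (Series (fun n => Re c * Im (x n)) + Series (fun n => Im c * Re (x n))).
    + rewrite <- Series_plus by (apply ex_series_scal_R; auto). apply Series_ext. intros; reflexivity.
    + rewrite !Series_scal_l. reflexivity.
Qed.

Lemma CSer_minus x y : Csummable x -> Csummable y -> CSer (fun n => x n - y n)%C = (CSer x - CSer y)%C.
Proof.
  intros Hx Hy. rewrite (CSer_ext _ (fun n => x n + RtoC (-1) * y n)%C) by (intros; rewrite RtoC_m1; ring).
  rewrite CSer_plus, CSer_scal by auto using Csummable_scal. rewrite RtoC_m1. ring.
Qed.

Lemma CSer_bound x (b : nat -> R) : (forall n, Cmod (x n) <= b n) -> ex_series b -> Cmod (CSer x) <= Series b.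
Proof.
  intros H Hb. assert (Hx := Csummable_dom x b H Hb).
  destruct (unit_phase (CSer x)) as [th Hth].
  replace (Cmod (CSer x)) with (Re (cis th * CSer x)) by (rewrite Hth; reflexivity).
  rewrite <- CSer_scal by auto.
  assert (K : forall n, Rabs (Re (cis th * x n)%C) <= b n).
  { intros n. eapply Rle_trans; [apply re_le_Cmod|]. rewrite Cmod_mult, Cmod_cis, Rmult_1_l; auto. }
  change (Series (fun n => Re (cis th * x n)%C) <= Series b).
  eapply Rle_trans; [apply Rle_abs|]. eapply Rle_trans.
  - apply Series_Rabs. apply ex_series_dom with b; auto. intros n. rewrite Rabs_Rabsolu; auto.
  - apply Series_le; auto. intros n. split; auto using Rabs_pos.
Qed.

Lemma Series_zero : Series (fun _ => 0) = 0.
Proof.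
  rewrite (Series_ext _ (fun n => 0 * (fun _ => 0) n)) by (intros; ring).
  rewrite Series_scal_l. ring.
Qed.

Lemma CSer_0 x : (forall n, x n = RtoC 0) -> CSer x = RtoC 0.
Proof.
  intros H. apply C_ext; simpl; rewrite <- Series_zero at 1; apply Series_ext;
  intros; rewrite H; auto.
Qed.

Lemma CSer_incr_1 x : Csummable x -> CSer x = (x 0%nat + CSer (fun n => x (S n)))%C.
Proof.
  intros Hx. apply C_ext; simpl.
  - apply (Series_incr_1 (fun n => Re (x n))), Csummable_Re; auto.
  - apply (Series_incr_1 (fun n => Im (x n))), Csummable_Im; auto.
Qed.

Lemma ex_series_shift (b : nat -> R) N : ex_series b -> ex_series (fun n => b (N + n)%nat).
Proof. intros H. apply (ex_series_incr_n b N). auto. Qed.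

Lemma CSer_split x N : Csummable x -> CSer x = (Csum N x + CSer (fun n => x (N + n)%nat))%C.
Proof.
  intros Hx. induction N.
  - change (CSer x = RtoC 0 + CSer x)%C. ring.
  - rewrite IHN, (CSer_incr_1 (fun n => x (N + n)%nat)) by (apply (ex_series_shift (fun n => Cmod (x n))); auto).
    simpl. rewrite Nat.add_0_r.
    rewrite (CSer_ext (fun n => x (N + S n)%nat) (fun n => x (S (N + n)))) by (intros; f_equal; lia). ring.
Qed.

Lemma Series_split (b : nat -> R) N : ex_series b -> Series b = Rsum N b + Series (fun n => b (N + n)%nat).
Proof.
  intros Hx. induction N.
  - change (Series b = 0 + Series b). ring.
  - rewrite IHN, (Series_incr_1 (fun n => b (N + n)%nat)) by (apply ex_series_shift; auto).
    simpl. rewrite Nat.add_0_r.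
    rewrite (Series_ext (fun n => b (N + S n)%nat) (fun n => b (S (N + n)))) by (intros; f_equal; lia). ring.
Qed.

Lemma sum_n_Rsum (b : nat -> R) N : sum_n b N = Rsum (S N) b.
Proof. rewrite sum_n_Reals, sum_f_R0_Rsum. reflexivity. Qed.

Lemma Series_tail (b : nat -> R) eps : ex_series b -> 0 < eps ->
  exists N, forall M, (N <= M)%nat -> Rabs (Series (fun n => b (M + n)%nat)) < eps.
Proof.
  intros Hb Heps. assert (K := Series_correct b Hb).
  assert (K' : is_lim_seq (sum_n b) (Series b)) by exact K.
  apply is_lim_seq_spec in K'. destruct (K' (mkposreal eps Heps)) as [N HN].
  exists (S N). intros M HM. destruct M as [|M]; [lia|].
  specialize (HN M ltac:(lia)). simpl in HN. rewrite sum_n_Rsum, (Series_split b (S M) Hb) in HN.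
  rewrite <- Rabs_Ropp. match type of HN with Rabs ?z < _ => replace z with (- Series (fun n => b (S M + n)%nat)) in HN by ring end.
  auto.
Qed.

Lemma bounded_partial_sums (b : nat -> R) B : (forall n, 0 <= b n) -> (forall N, Rsum N b <= B) -> ex_series b.
Proof.
  intros Hb HB.
  assert (K : ex_finite_lim_seq (sum_n b)).
  { apply ex_finite_lim_seq_incr with B.
    - intros n. rewrite !sum_n_Rsum. simpl. specialize (Hb (S n)). lra.
    - intros n. rewrite sum_n_Rsum. auto. }
  destruct K as [l Hl]. exists l. exact Hl.
Qed.

Lemma Rsum_le_Series (b : nat -> R) N : (forall n, 0 <= b n) -> ex_series b -> Rsum N b <= Series b.
Proof.
  intros Hb H. rewrite (Series_split b N H).
  assert (0 <= Series (fun n => b (N + n)%nat)); [|lra].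
  rewrite <- Series_zero. apply Series_le.
  - intros; split; [lra|auto].
  - apply ex_series_shift; auto.
Qed.

Lemma CSer_single x i : Csummable x -> (forall n, n <> i -> x n = RtoC 0) -> CSer x = x i.
Proof.
  intros Hx H. rewrite (CSer_split x (S i) Hx), CSer_0.
  - rewrite (Csum_single (S i) x i); [ring|lia|]. intros; apply H; auto.
  - intros n. apply H. lia.
Qed.

Lemma Csummable_Csum M (F : nat -> nat -> C) : (forall j, Csummable (F j)) ->
  Csummable (fun n => Csum M (fun j => F j n)).
Proof.
  intros H. induction M; simpl.
  - apply Csummable_dom with (fun _ => 0); [intros; rewrite Cmod_0; lra|].
    exists 0. apply is_series_Reals. intros e He. exists 0%nat. intros n _.
    unfold R_dist. rewrite sum_f_R0_Rsum, Rsum_const.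
    replace (INR (S n) * 0 - 0) with 0 by ring. rewrite Rabs_R0; auto.
  - apply Csummable_plus; auto.
Qed.

Lemma CSer_Csum M (F : nat -> nat -> C) : (forall j, Csummable (F j)) ->
  CSer (fun n => Csum M (fun j => F j n)) = Csum M (fun j => CSer (F j)).
Proof.
  intros H. induction M; simpl; [apply CSer_0; auto|].
  rewrite CSer_plus, IHM; auto. apply Csummable_Csum; auto.
Qed.

Definition trig_series (b : nat -> C) (u : nat -> R) (t : R) : C := CSer (fun n => b n * cis (u n * t))%C.

Lemma trig_summable b u t : Csummable b -> Csummable (fun n => b n * cis (u n * t))%C.
Proof.
  intros H. apply Csummable_dom with (fun n => Cmod (b n)); auto.
  intros n. rewrite Cmod_mult, Cmod_cis; lra.
Qed.

Lemma trig_series_partial b u eps : Csummable b -> 0 < eps -> exists N, forall M, (N <= M)%nat -> forall t,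
  Cmod (trig_series b u t - Csum M (fun n => b n * cis (u n * t))%C) <= eps.
Proof.
  intros Hb Heps. destruct (Series_tail (fun n => Cmod (b n)) eps Hb Heps) as [N HN].
  exists N. intros M HM t. unfold trig_series. rewrite (CSer_split _ M) by (apply trig_summable; auto).
  match goal with |- Cmod ?z <= _ => replace z with (CSer (fun n => b (M + n)%nat * cis (u (M + n)%nat * t))%C) by ring end.
  eapply Rle_trans; [apply CSer_bound with (b := fun n => Cmod (b (M + n)%nat))|].
  - intros n. rewrite Cmod_mult, Cmod_cis; lra.
  - apply (ex_series_shift (fun n => Cmod (b n))); auto.
  - specialize (HN M HM). apply Rlt_le, Rle_lt_trans with (2 := HN), Rle_abs.
Qed.

Lemma CAP_trig_series b u : Csummable b -> CAP (trig_series b u).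
Proof.
  intros Hb. apply CAP_unif_limit. intros eps Heps.
  destruct (trig_series_partial b u eps Hb Heps) as [N HN].
  exists (fun t => Csum N (fun n => b n * cis (u n * t))%C). split; auto.
  apply (CAP_Csum N (fun n t => b n * cis (u n * t))%C). intros n. apply CAP_mult; [apply CAP_const|apply CAP_cis0].
Qed.

(** The part of the series with frequency [nu]. An enumeration may repeat a frequency, so the
    coefficient at [nu] is a sum over all such indices. *)
Definition select (u : nat -> R) (b : nat -> C) (nu : R) (n : nat) : C :=
  if Req_EM_T (u n) nu then b n else RtoC 0.

Lemma select_summable u b nu : Csummable b -> Csummable (select u b nu).
Proof.
  intros Hb. apply Csummable_dom with (fun n => Cmod (b n)); auto. intros n. unfold select.
  destruct (Req_EM_T (u n) nu); [lra|rewrite Cmod_0; apply Cmod_ge_0].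
Qed.

Lemma trig_series_mean b u nu : Csummable b -> is_mean (twist (trig_series b u) nu) (CSer (select u b nu)).
Proof.
  intros Hb. apply mean_unif_limit; [apply Ccont_twist, CAP_trig_series; auto|].
  intros eps Heps.
  destruct (trig_series_partial b u eps Hb Heps) as [N1 HN1].
  destruct (Series_tail (fun n => Cmod (b n)) eps Hb Heps) as [N2 HN2].
  set (N := (N1 + N2)%nat).
  exists (fun t => Csum N (fun n => b n * cis ((u n - nu) * t))%C), (Csum N (select u b nu)).
  assert (Cn : forall n, Ccont (fun t => b n * cis ((u n - nu) * t))%C).
  { intros n. apply Ccont_mult; [apply Ccont_const|apply Ccont_cis0]. }
  repeat split.
  - apply (Ccont_Csum N (fun n t => b n * cis ((u n - nu) * t))%C); auto.
  - apply (Ccont_Csum N (fun n t => b n * cis ((u n - nu) * t))%C); auto.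
  - apply (mean_Csum N (fun n t => b n * cis ((u n - nu) * t))%C); auto.
    intros n. unfold select. destruct (Req_EM_T (u n) nu) as [E|E].
    + apply mean_ext with (fun _ => b n); [|apply mean_const]. intros t.
      replace ((u n - nu) * t) with 0 by (rewrite E; ring). rewrite cis_0. ring.
    + replace (RtoC 0) with (b n * RtoC 0)%C by ring. apply mean_scal; [apply Ccont_cis0|]. apply mean_cis. lra.
  - rewrite (CSer_split _ N (select_summable u b nu Hb)), Cmod_sub_sym.
    match goal with |- Cmod ?z <= _ => replace z with (CSer (fun n => select u b nu (N + n))) by ring end.
    eapply Rle_trans; [apply CSer_bound with (b := fun n => Cmod (b (N + n)%nat))|].
    + intros n. unfold select. destruct (Req_EM_T (u (N + n)%nat) nu); [lra|rewrite Cmod_0; apply Cmod_ge_0].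
    + apply (ex_series_shift (fun n => Cmod (b n))); auto.
    + specialize (HN2 N ltac:(unfold N; lia)). apply Rlt_le, Rle_lt_trans with (2 := HN2), Rle_abs.
  - intros t. specialize (HN1 N ltac:(unfold N; lia) t).
    replace (twist (trig_series b u) nu t - Csum N (fun n => b n * cis ((u n - nu) * t)))%C with
      (cis (- nu * t) * (trig_series b u t - Csum N (fun n => b n * cis (u n * t))))%C.
    + rewrite Cmod_mult, Cmod_cis, Rmult_1_l; auto.
    + unfold twist. transitivity (trig_series b u t * cis (- nu * t) - cis (- nu * t) * Csum N (fun n => b n * cis (u n * t)))%C; [ring|].
      f_equal. f_equal. rewrite <- Csum_scal. apply Csum_ext. intros n _.
      replace ((u n - nu) * t) with (- nu * t + u n * t) by ring. rewrite cis_plus. ring.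
Qed.

(** * Absolutely convergent Dirichlet series *)

Definition DS (c : nat -> C) (u : nat -> R) (s : C) : C := CSer (fun n => c n * Cexp (RtoC (u n) * s))%C.

Definition Dconv (c : nat -> C) (u : nat -> R) (x : R) : Prop := ex_series (fun n => Cmod (c n) * exp (u n * x)).

(** The coefficients of the series differentiated [j] times term by term. *)
Definition dcoef (c : nat -> C) (u : nat -> R) (j : nat) (n : nat) : C := (c n * RtoC (u n ^ j))%C.

Lemma Cmod_DS_term (c : nat -> C) (u : nat -> R) s n : Cmod (c n * Cexp (RtoC (u n) * s))%C = Cmod (c n) * exp (u n * Re s).
Proof. rewrite Cmod_mult, Cmod_Cexp. f_equal. f_equal. simpl. unfold Re; simpl. ring. Qed.

Lemma DS_summable c u s : Dconv c u (Re s) -> Csummable (fun n => c n * Cexp (RtoC (u n) * s))%C.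
Proof.
  intros H. apply ex_series_ext with (2 := H). intros n. rewrite Cmod_DS_term. reflexivity.
Qed.

Lemma DS_line c u x t : DS c u (x, t) = trig_series (fun n => c n * RtoC (exp (u n * x)))%C u t.
Proof. apply CSer_ext. intros n. rewrite Cexp_line. ring. Qed.

Lemma Dconv_line c u x : Dconv c u x -> Csummable (fun n => c n * RtoC (exp (u n * x)))%C.
Proof.
  intros H. apply ex_series_ext with (2 := H). intros n. rewrite Cmod_mult, Cmod_R, Rabs_pos_eq; auto.
  apply Rlt_le, exp_pos.
Qed.

(** Exponents of both signs occur, so a gain of $e^{|v|r}$ has to be paid for by convergence on both
    sides, at [x + r] and at [x - r]. *)
Lemma exp_abs_shift v x r : exp (v * x) * exp (Rabs v * r) <= exp (v * (x + r)) + exp (v * (x - r)).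
Proof.
  replace (v * (x + r)) with (v * x + v * r) by ring. replace (v * (x - r)) with (v * x + - (v * r)) by ring.
  rewrite !exp_plus. assert (H := exp_pos (v * x)).
  assert (H1 := exp_pos (v * r)). assert (H2 := exp_pos (- (v * r))).
  assert (E : exp (Rabs v * r) <= exp (v * r) + exp (- (v * r))).
  { unfold Rabs. destruct Rcase_abs; [replace (- v * r) with (- (v * r)) by ring|]; lra. }
  nra.
Qed.

Lemma Dconv_dcoef c u x r j : 0 < r -> Dconv c u (x + r) -> Dconv c u (x - r) -> Dconv (dcoef c u j) u x.
Proof.
  intros Hr H1 H2.
  apply ex_series_dom with (fun n => INR (Factorial.fact j) * / r ^ j * (Cmod (c n) * exp (u n * (x + r)) + Cmod (c n) * exp (u n * (x - r)))).
  - intros n. rewrite Rabs_pos_eq by (apply Rmult_le_pos; [apply Cmod_ge_0|apply Rlt_le, exp_pos]).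
    unfold dcoef. rewrite Cmod_mult, Cmod_R, <- RPow_abs.
    assert (K := pow_div_fact_le_exp (Rabs (u n) * r) j ltac:(apply Rmult_le_pos; [apply Rabs_pos|lra])).
    assert (Hf := INR_fact_lt_0 j). assert (Hrj : 0 < r ^ j) by (apply pow_lt; auto).
    rewrite Rpow_mult_distr in K.
    assert (K2 : Rabs (u n) ^ j <= INR (Factorial.fact j) * / r ^ j * exp (Rabs (u n) * r)).
    { apply Rmult_le_compat_l with (r := INR (Factorial.fact j) * / r ^ j) in K.
      - eapply Rle_trans; [|exact K]. right. field. lra.
      - apply Rlt_le, Rmult_lt_0_compat; auto. apply Rinv_0_lt_compat; auto. }
    assert (K3 := exp_abs_shift (u n) x r).
    assert (Hc := Cmod_ge_0 (c n)). assert (He := exp_pos (u n * x)).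
    set (A := INR (Factorial.fact j) * / r ^ j) in *.
    assert (HA : 0 < A) by (unfold A; apply Rmult_lt_0_compat; auto; apply Rinv_0_lt_compat; auto).
    apply Rle_trans with (Cmod (c n) * (A * exp (Rabs (u n) * r)) * exp (u n * x)).
    + apply Rmult_le_compat_r; [lra|]. apply Rmult_le_compat_l; auto.
    + replace (Cmod (c n) * (A * exp (Rabs (u n) * r)) * exp (u n * x)) with
        (A * Cmod (c n) * (exp (u n * x) * exp (Rabs (u n) * r))) by ring.
      replace (A * (Cmod (c n) * exp (u n * (x + r)) + Cmod (c n) * exp (u n * (x - r)))) with
        (A * Cmod (c n) * (exp (u n * (x + r)) + exp (u n * (x - r)))) by ring.
      apply Rmult_le_compat_l; auto. apply Rmult_le_pos; lra.
  - apply ex_series_scal_R. exact (ex_series_plus _ _ H1 H2).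
Qed.

Definition Dnorm (c : nat -> C) (u : nat -> R) (x : R) : R := Series (fun n => Cmod (c n) * exp (u n * x)).

Lemma exp_term_scal (v : R) h j : exp_term (RtoC v * h) j = (exp_term h j * RtoC (v ^ j))%C.
Proof.
  unfold exp_term. rewrite RtoC_pow.
  assert (E : ((RtoC v * h) ^ j = RtoC v ^ j * h ^ j)%C) by (induction j; simpl; [ring|rewrite IHj; ring]).
  rewrite E. ring.
Qed.

(** The remainder formula of the exponential is summed over the terms. In the term with exponent
    $v$, one factor $e^{|v|r}$ absorbs $(|v|r)^{k+1}/(k+1)!$ and another the exponential in the
    remainder, hence the distance [2 * r]. *)
Theorem DS_Taylor c u s h r k : 0 < r -> Dconv c u (Re s + 2 * r) -> Dconv c u (Re s - 2 * r) -> Cmod h <= r ->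
  Cmod (DS c u (s + h) - Csum (S k) (fun j => exp_term h j * DS (dcoef c u j) u s)%C) <=
  (Cmod h / r) ^ S k * (Dnorm c u (Re s + 2 * r) + Dnorm c u (Re s - 2 * r)).
Proof.
  intros Hr H1 H2 Hh.
  assert (Hj : forall j, Csummable (fun n => dcoef c u j n * Cexp (RtoC (u n) * s))%C).
  { intros j. apply DS_summable. apply Dconv_dcoef with (2 * r); auto. lra. }
  assert (H0 : Csummable (fun n => c n * Cexp (RtoC (u n) * s))%C).
  { apply Csummable_ext with (2 := Hj 0%nat). intros n. unfold dcoef. simpl. ring. }
  assert (E : forall n, (c n * Cexp (RtoC (u n) * (s + h)) - Csum (S k) (fun j => exp_term h j * (dcoef c u j n * Cexp (RtoC (u n) * s))))%C =
     (c n * Cexp (RtoC (u n) * s) * (Cexp (RtoC (u n) * h) - Csum (S k) (exp_term (RtoC (u n) * h))))%C).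
  { intros n. rewrite (Csum_ext (S k) (fun j => exp_term h j * (dcoef c u j n * Cexp (RtoC (u n) * s)))%C
      (fun j => (c n * Cexp (RtoC (u n) * s)) * exp_term (RtoC (u n) * h) j)%C).
    - rewrite Csum_scal. replace (RtoC (u n) * (s + h))%C with (RtoC (u n) * s + RtoC (u n) * h)%C by ring.
      rewrite Cexp_plus. ring.
    - intros j _. rewrite exp_term_scal. unfold dcoef. ring. }
  set (b := fun n => (Cmod h / r) ^ S k * (Cmod (c n) * exp (u n * (Re s + 2 * r)) + Cmod (c n) * exp (u n * (Re s - 2 * r)))).
  assert (Hb : ex_series b) by (apply ex_series_scal_R; exact (ex_series_plus _ _ H1 H2)).
  assert (Hterm : forall n, Cmod (c n * Cexp (RtoC (u n) * (s + h)) - Csum (S k) (fun j => exp_term h j * (dcoef c u j n * Cexp (RtoC (u n) * s))))%C <= b n).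
  { intros n. rewrite E, Cmod_mult, Cmod_DS_term. unfold b.
    assert (T := Cexp_Taylor (RtoC (u n) * h) k). rewrite Cmod_mult, Cmod_R in T.
    set (a := Rabs (u n)) in *. assert (Ha : 0 <= a) by apply Rabs_pos.
    assert (Hh0 := Cmod_ge_0 h).
    assert (T1 : Rabs (Re (RtoC (u n) * h)%C) <= a * r).
    { eapply Rle_trans; [apply re_le_Cmod|]. rewrite Cmod_mult, Cmod_R. apply Rmult_le_compat_l; auto. }
    assert (T2 : exp (Rabs (Re (RtoC (u n) * h)%C)) <= exp (a * r)).
    { destruct T1 as [T1| ->]; [apply Rlt_le, exp_increasing; auto|lra]. }
    assert (T3 := pow_div_fact_le_exp (a * r) (S k) ltac:(apply Rmult_le_pos; lra)).
    assert (Hf := INR_fact_lt_0 (S k)).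
    assert (T4 : (a * Cmod h) ^ S k / INR (Factorial.fact (S k)) = (Cmod h / r) ^ S k * ((a * r) ^ S k / INR (Factorial.fact (S k)))).
    { unfold Rdiv at 1 3. rewrite <- Rmult_assoc. f_equal. rewrite <- Rpow_mult_distr. f_equal. field. lra. }
    rewrite T4 in T.
    set (p := (Cmod h / r) ^ S k) in *.
    assert (Hp : 0 <= p).
    { apply pow_le. apply Rmult_le_pos; auto. apply Rlt_le, Rinv_0_lt_compat; auto. }
    assert (T5 : Cmod (Cexp (RtoC (u n) * h) - Csum (S k) (exp_term (RtoC (u n) * h))) <= p * (exp (a * (2 * r)))).
    { eapply Rle_trans; [exact T|]. replace (a * (2 * r)) with (a * r + a * r) by ring. rewrite exp_plus, <- Rmult_assoc.
      apply Rmult_le_compat; auto.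
      - apply Rmult_le_pos; auto. apply Rmult_le_pos; [apply pow_le, Rmult_le_pos; lra|apply Rlt_le, Rinv_0_lt_compat; auto].
      - apply Rlt_le, exp_pos.
      - apply Rmult_le_compat_l; auto. }
    assert (T6 := exp_abs_shift (u n) (Re s) (2 * r)). fold a in T6.
    assert (Hc := Cmod_ge_0 (c n)). assert (He := exp_pos (u n * Re s)).
    apply Rle_trans with (Cmod (c n) * exp (u n * Re s) * (p * exp (a * (2 * r)))).
    - apply Rmult_le_compat_l; auto. apply Rmult_le_pos; lra.
    - replace (Cmod (c n) * exp (u n * Re s) * (p * exp (a * (2 * r)))) with
        (p * Cmod (c n) * (exp (u n * Re s) * exp (a * (2 * r)))) by ring.
      replace (p * (Cmod (c n) * exp (u n * (Re s + 2 * r)) + Cmod (c n) * exp (u n * (Re s - 2 * r)))) with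
        (p * Cmod (c n) * (exp (u n * (Re s + 2 * r)) + exp (u n * (Re s - 2 * r)))) by ring.
      apply Rmult_le_compat_l; auto. apply Rmult_le_pos; auto. }
  assert (Hfin : Csummable (fun n => Csum (S k) (fun j => exp_term h j * (dcoef c u j n * Cexp (RtoC (u n) * s))))%C).
  { apply (Csummable_Csum (S k) (fun j n => exp_term h j * (dcoef c u j n * Cexp (RtoC (u n) * s)))%C).
    intros j. apply Csummable_scal; auto. }
  assert (Hsh : Csummable (fun n => c n * Cexp (RtoC (u n) * (s + h)))%C).
  { apply Csummable_ext with (fun n => (c n * Cexp (RtoC (u n) * (s + h)) - Csum (S k) (fun j => exp_term h j * (dcoef c u j n * Cexp (RtoC (u n) * s)))) +
       Csum (S k) (fun j => exp_term h j * (dcoef c u j n * Cexp (RtoC (u n) * s))))%C; [intros; ring|].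
    apply Csummable_plus; auto. apply Csummable_dom with b; auto. }
  replace (Csum (S k) (fun j => exp_term h j * DS (dcoef c u j) u s)%C) with
    (CSer (fun n => Csum (S k) (fun j => exp_term h j * (dcoef c u j n * Cexp (RtoC (u n) * s))))%C).
  - unfold DS. rewrite <- CSer_minus by auto.
    eapply Rle_trans; [apply CSer_bound with (b := b); auto|].
    unfold b, Dnorm. rewrite Series_scal_l, Series_plus by auto. lra.
  - rewrite (CSer_Csum (S k) (fun j n => exp_term h j * (dcoef c u j n * Cexp (RtoC (u n) * s)))%C).
    + apply Csum_ext. intros j _. apply CSer_scal; auto.
    + intros j. apply Csummable_scal; auto.
Qed.

(** * Identity theorems and leading terms for Dirichlet series *)

Definition Dconv_near (c : nat -> C) (u : nat -> R) (x r : R) : Prop :=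
  forall y, Rabs (y - x) <= r -> Dconv c u y.

Definition distinct (c : nat -> C) (u : nat -> R) : Prop :=
  forall n m, n <> m -> c n <> RtoC 0 -> c m <> RtoC 0 -> u n <> u m.

Lemma DS_ext c c' u s : (forall n, c n = c' n) -> DS c u s = DS c' u s.
Proof. intros E. apply CSer_ext. intros n; rewrite E; auto. Qed.

Lemma dcoef_dcoef c u i j n : dcoef (dcoef c u i) u j n = dcoef c u (i + j) n.
Proof. unfold dcoef. rewrite pow_add, RtoC_mult. ring. Qed.

Lemma dcoef_0 c u n : dcoef c u 0 n = c n.
Proof. unfold dcoef. simpl. ring. Qed.

Lemma Dconv_near_sub c u x r r' : r' <= r -> Dconv_near c u x r -> Dconv_near c u x r'.
Proof. intros Hr H y Hy. apply H. lra. Qed.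

Lemma Dconv_near_dcoef c u x r r' j : 0 < r' -> 0 <= r -> Dconv_near c u x (r + r') -> Dconv_near (dcoef c u j) u x r.
Proof.
  intros Hr' Hr H y Hy. apply Dconv_dcoef with r'; auto; apply H; unfold Rabs in *;
  repeat destruct Rcase_abs; repeat destruct Rcase_abs in Hy; lra.
Qed.

Lemma DS_Taylor_near c u s h r k : 0 < r -> Dconv_near c u (Re s) (2 * r) -> Cmod h <= r ->
  Cmod (DS c u (s + h) - Csum (S k) (fun j => exp_term h j * DS (dcoef c u j) u s)%C) <=
  (Cmod h / r) ^ S k * (Dnorm c u (Re s + 2 * r) + Dnorm c u (Re s - 2 * r)).
Proof.
  intros Hr H Hh. apply DS_Taylor; auto; apply H.
  - replace (Re s + 2 * r - Re s) with (2 * r) by ring. rewrite Rabs_pos_eq; lra.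
  - replace (Re s - 2 * r - Re s) with (- (2 * r)) by ring. rewrite Rabs_Ropp, Rabs_pos_eq; lra.
Qed.

(** The radius [r / 2] does not depend on [t], so vanishing spreads along the whole vertical line. *)
Lemma derivatives_zero_step c u x t t' r : 0 < r -> Dconv_near c u x (3 * r) ->
  (forall j, DS (dcoef c u j) u (x, t) = RtoC 0) -> Rabs (t' - t) <= r / 2 ->
  forall i, DS (dcoef c u i) u (x, t') = RtoC 0.
Proof.
  intros Hr Hc H0 Ht i.
  assert (Hci : Dconv_near (dcoef c u i) u (Re (x, t)) (2 * r)).
  { apply Dconv_near_dcoef with r; auto; [lra|]. replace (2 * r + r) with (3 * r) by ring. exact Hc. }
  set (h := (Ci * RtoC (t' - t))%C).
  assert (Hh : Cmod h <= r / 2) by (unfold h; rewrite Cmod_mult, Cmod_Ci, Cmod_R, Rmult_1_l; auto).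
  set (B := Dnorm (dcoef c u i) u (x + 2 * r) + Dnorm (dcoef c u i) u (x - 2 * r)).
  assert (K : forall k, Cmod (DS (dcoef c u i) u (x, t')) <= (/ 2) ^ S k * Rabs B).
  { intros k. assert (T := DS_Taylor_near (dcoef c u i) u (x, t) h r k Hr Hci ltac:(lra)).
    rewrite (Csum_0 (S k)) in T.
    2:{ intros j _. rewrite (DS_ext (dcoef (dcoef c u i) u j) (dcoef c u (i + j))) by (intros; apply dcoef_dcoef).
        rewrite H0. ring. }
    replace ((x, t) + h)%C with (x, t') in T by (unfold h; rewrite vertical_shift; f_equal; ring).
    replace (DS (dcoef c u i) u (x, t') - RtoC 0)%C with (DS (dcoef c u i) u (x, t')) in T by ring.
    eapply Rle_trans; [exact T|]. simpl (Re (x, t)). unfold Re; simpl fst. fold B.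
    assert (Hp : 0 <= (Cmod h / r)).
    { apply Rmult_le_pos; [apply Cmod_ge_0|apply Rlt_le, Rinv_0_lt_compat; auto]. }
    apply Rle_trans with ((Cmod h / r) ^ S k * Rabs B).
    - apply Rmult_le_compat_l; [apply pow_le; auto|apply Rle_abs].
    - apply Rmult_le_compat_r; [apply Rabs_pos|]. apply pow_incr. split; auto.
      apply Rmult_le_reg_r with r; auto. unfold Rdiv. rewrite Rmult_assoc, Rinv_l; lra. }
  apply Cmod_eq_0. apply Rle_antisym; [|apply Cmod_ge_0]. apply le_epsilon. intros e He. rewrite Rplus_0_l.
  assert (HB := Rabs_pos B).
  destruct (pow_lt_1_zero (/ 2) ltac:(rewrite Rabs_pos_eq; lra) (e / (Rabs B + 1))) as [n Hn].
  { apply Rdiv_lt_0_compat; lra. }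
  specialize (Hn (S n) ltac:(lia)). specialize (K n). rewrite Rabs_pos_eq in Hn by (apply pow_le; lra).
  apply Rmult_lt_compat_r with (r := Rabs B + 1) in Hn; [|lra].
  unfold Rdiv in Hn. rewrite Rmult_assoc, Rinv_l, Rmult_1_r in Hn by lra.
  assert (P : 0 <= (/ 2) ^ S n) by (apply pow_le; lra). nra.
Qed.

Lemma derivatives_zero_line c u x t r : 0 < r -> Dconv_near c u x (3 * r) ->
  (forall j, DS (dcoef c u j) u (x, t) = RtoC 0) ->
  forall t' i, DS (dcoef c u i) u (x, t') = RtoC 0.
Proof.
  intros Hr Hc H0.
  assert (K : forall n t', Rabs (t' - t) <= INR n * (r / 2) -> forall i, DS (dcoef c u i) u (x, t') = RtoC 0).
  { induction n as [|n IH]; intros t' Ht'.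
    - simpl in Ht'. replace t' with t; auto.
      assert (P := Rabs_pos (t' - t)). assert (E : Rabs (t' - t) = 0) by lra.
      apply Rabs_eq_0 in E. lra.
    - rewrite S_INR in Ht'. assert (Hn := pos_INR n).
      (* The point at the fraction [n / (n + 1)] of the way: it lies within [n] steps of [t], and
         the last step is at most [r / 2]. *)
      set (t1 := t + (t' - t) * (INR n / (INR n + 1))).
      apply derivatives_zero_step with t1 r; auto.
      + apply IH. unfold t1. replace (t + (t' - t) * (INR n / (INR n + 1)) - t) with ((t' - t) * (INR n / (INR n + 1))) by ring.
        assert (P : 0 <= INR n / (INR n + 1)) by (apply Rmult_le_pos; auto; apply Rlt_le, Rinv_0_lt_compat; lra).
        rewrite Rabs_mult, (Rabs_pos_eq (INR n / (INR n + 1))) by auto.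
        apply Rle_trans with ((INR n + 1) * (r / 2) * (INR n / (INR n + 1))).
        * apply Rmult_le_compat_r; auto.
        * right. field. lra.
      + unfold t1. replace (t' - (t + (t' - t) * (INR n / (INR n + 1)))) with ((t' - t) * / (INR n + 1)) by (field; lra).
        assert (P : 0 < / (INR n + 1)) by (apply Rinv_0_lt_compat; lra).
        rewrite Rabs_mult, (Rabs_pos_eq (/ (INR n + 1))) by lra.
        apply Rle_trans with ((INR n + 1) * (r / 2) * / (INR n + 1)).
        * apply Rmult_le_compat_r; lra.
        * right. field. lra. }
  intros t'. destruct (nfloor_ex (Rabs (t' - t) / (r / 2))) as [n Hn].
  { apply Rmult_le_pos; [apply Rabs_pos|apply Rlt_le, Rinv_0_lt_compat; lra]. }
  apply (K (S n)). rewrite S_INR.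
  replace (Rabs (t' - t)) with (Rabs (t' - t) / (r / 2) * (r / 2)) by (field; lra).
  apply Rmult_le_compat_r; lra.
Qed.

(** Vanishing derivatives at one point make the series zero on the whole vertical line. Its mean
    against the frequency [u m] is then zero, and by distinctness this mean is a nonzero multiple of
    [c m]. *)
Theorem DS_derivatives_zero c u x t r : 0 < r -> Dconv_near c u x (3 * r) -> distinct c u ->
  (forall j, DS (dcoef c u j) u (x, t) = RtoC 0) -> forall n, c n = RtoC 0.
Proof.
  intros Hr Hc Hd H0 m. apply NNPP. intros Hm.
  assert (Hx : Dconv c u x) by (apply Hc; replace (x - x) with 0 by ring; rewrite Rabs_R0; lra).
  set (b := fun n => (c n * RtoC (exp (u n * x)))%C).
  assert (Hb : Csummable b) by (apply Dconv_line; auto).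
  assert (Hz : forall t, trig_series b u t = RtoC 0).
  { intros t'. transitivity (DS c u (x, t')); [symmetry; apply DS_line|]. rewrite <- (DS_ext (dcoef c u 0)) by (intros; apply dcoef_0).
    apply derivatives_zero_line with t r; auto. }
  assert (E : CSer (select u b (u m)) = RtoC 0).
  { apply (mean_unique (twist (trig_series b u) (u m))); [apply trig_series_mean; auto|].
    apply mean_ext with (fun _ => RtoC 0); [|apply mean_const]. intros t'. unfold twist. rewrite Hz. ring. }
  rewrite (CSer_single _ m) in E.
  - unfold select in E. destruct (Req_EM_T (u m) (u m)); [|auto]. unfold b in E.
    rewrite Cmult_comm in E. apply Cmult_integral_l in E; auto.
    intros K. apply RtoC_inj in K. generalize (exp_pos (u m * x)); lra.
  - apply select_summable; auto.
  - intros n Hn. unfold select. destruct (Req_EM_T (u n) (u m)) as [K|K]; auto.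
    destruct (classic (c n = RtoC 0)) as [Hcn|Hcn]; [unfold b; rewrite Hcn; ring|].
    exfalso. apply (Hd n m); auto.
Qed.

Lemma small_multiple_zero (z : C) (K d : R) : 0 < d -> (forall e, 0 < e < d -> Cmod z <= e * K) -> z = RtoC 0.
Proof.
  intros Hd H. apply Cmod_eq_0. apply Rle_antisym; [|apply Cmod_ge_0].
  apply le_epsilon. intros e He. rewrite Rplus_0_l.
  assert (HK := Rabs_pos K).
  set (x := Rmin (d / 2) (e / (Rabs K + 1))).
  assert (Hx : 0 < x) by (apply Rmin_pos; [lra|apply Rdiv_lt_0_compat; lra]).
  assert (X1 : x <= d / 2) by apply Rmin_l. assert (X2 : x <= e / (Rabs K + 1)) by apply Rmin_r.
  eapply Rle_trans; [apply (H x); lra|].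
  apply Rmult_le_compat_r with (r := Rabs K + 1) in X2; [|lra].
  unfold Rdiv in X2. rewrite Rmult_assoc, Rinv_l, Rmult_1_r in X2 by lra.
  assert (K1 := Rle_abs K). nra.
Qed.

(** By strong induction the lower terms of Taylor's formula vanish. Dividing the formula of order
    [j] at real increments [e] by $e^j$ leaves the next derivative bounded by a multiple of [e]. *)
Lemma DS_zero_on_reals c u x t r d : 0 < r -> 0 < d -> Dconv_near c u x (2 * r) ->
  (forall y, Rabs (y - x) < d -> DS c u (y, t) = RtoC 0) ->
  forall j, DS (dcoef c u j) u (x, t) = RtoC 0.
Proof.
  intros Hr Hd Hc H0 j. induction j as [j IH] using (well_founded_induction lt_wf).
  set (B := Dnorm c u (x + 2 * r) + Dnorm c u (x - 2 * r)).
  assert (Hf := INR_fact_lt_0 j).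
  apply (small_multiple_zero _ (INR (Factorial.fact j) * / r ^ S j * B) (Rmin d r)).
  { apply Rmin_pos; auto. }
  intros e [He1 He2].
  assert (E1 := Rlt_le_trans _ _ _ He2 (Rmin_l _ _)). assert (E2 := Rlt_le_trans _ _ _ He2 (Rmin_r _ _)).
  assert (Hh : Cmod (RtoC e) = e) by (rewrite Cmod_R, Rabs_pos_eq; lra).
  assert (T := DS_Taylor_near c u (x, t) (RtoC e) r j Hr Hc ltac:(rewrite Hh; lra)).
  rewrite Hh in T. simpl Csum in T.
  rewrite Csum_0 in T by (intros i Hi; rewrite IH by auto; ring).
  replace ((x, t) + RtoC e)%C with (x + e, t) in T by (apply C_ext; simpl; ring).
  rewrite H0 in T by (replace (x + e - x) with e by ring; rewrite Rabs_pos_eq; lra).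
  change (Re (x, t)) with x in T. fold B in T.
  match type of T with Cmod ?z <= _ => replace z with (- (exp_term (RtoC e) j * DS (dcoef c u j) u (x, t)))%C in T by ring end.
  rewrite Cmod_opp, Cmod_mult in T. unfold exp_term in T.
  rewrite Cmod_mult, Cmod_R, Cmod_pow, Hh, (Rabs_pos_eq (/ _)) in T by (apply Rlt_le, Rinv_0_lt_compat; auto).
  assert (Hej : 0 < e ^ j) by (apply pow_lt; auto). assert (Hrj : 0 < r ^ S j) by (apply pow_lt; auto).
  set (D := Cmod (DS (dcoef c u j) u (x, t))) in *.
  apply Rmult_le_compat_l with (r := INR (Factorial.fact j) * / e ^ j) in T.
  2:{ apply Rlt_le, Rmult_lt_0_compat; auto. apply Rinv_0_lt_compat; auto. }
  replace (INR (Factorial.fact j) * / e ^ j * (/ INR (Factorial.fact j) * e ^ j * D)) with D in T by (field; lra).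
  eapply Rle_trans; [exact T|]. right. unfold Rdiv. rewrite Rpow_mult_distr, pow_inv. simpl. field.
  simpl in Hrj. repeat split; try lra. apply pow_nonzero; lra.
Qed.

(** The local form of a nonconstant analytic function. It gives continuity, descent of the modulus
    and isolation of values, which is all that the proof of [Hurwitz] asks of its functions. *)
Definition has_leading_term (F : C -> C) (s : C) : Prop := exists (k : nat) (d : C) (M r : R),
  (0 < k)%nat /\ d <> RtoC 0 /\ 0 < M /\ 0 < r /\
  forall h, Cmod h <= r -> Cmod (F (s + h) - F s - d * h ^ k)%C <= M * Cmod h ^ S k.

Lemma least_nat (P : nat -> Prop) : (exists n, P n) -> exists n, P n /\ forall m, (m < n)%nat -> ~ P m.
Proof.
  intros [n Hn]. revert Hn. induction n as [n IH] using (well_founded_induction lt_wf). intros Hn.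
  destruct (classic (exists m, (m < n)%nat /\ P m)) as [[m [H1 H2]]|H]; eauto.
  exists n. split; auto. intros m Hm HP. apply H. exists m; auto.
Qed.

(** The first nonvanishing derivative of positive order gives the leading term. It exists, for
    otherwise the identity theorem applied to the derived series, at the cost of one further [r],
    would give [c n0 * u n0 = 0]. *)
Theorem DS_leading_term c u s r n0 : 0 < r -> Dconv_near c u (Re s) (4 * r) -> distinct c u ->
  c n0 <> RtoC 0 -> u n0 <> 0 -> has_leading_term (DS c u) s.
Proof.
  intros Hr Hc Hd Hn0 Hu0.
  assert (Hex : exists j, DS (dcoef c u (S j)) u s <> RtoC 0).
  { apply NNPP. intros Hno.
    assert (K : forall j, DS (dcoef (dcoef c u 1) u j) u (Re s, Im s) = RtoC 0).
    { intros j. apply NNPP. intros Hne. apply Hno. exists j. intros E. apply Hne.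
      rewrite (DS_ext _ (dcoef c u (S j))) by (intros; apply dcoef_dcoef).
      replace (Re s, Im s) with s by (destruct s; auto). auto. }
    assert (K2 : dcoef c u 1 n0 = RtoC 0).
    { apply (DS_derivatives_zero (dcoef c u 1) u (Re s) (Im s) r); auto.
      - apply Dconv_near_dcoef with r; auto; [lra|]. replace (3 * r + r) with (4 * r) by ring. auto.
      - intros n m Hnm H1 H2. apply Hd; auto; intros E; [apply H1|apply H2]; unfold dcoef; rewrite E; ring. }
    unfold dcoef in K2. rewrite pow_1 in K2. apply Cmult_integral_l in K2; auto.
    apply RtoC_inj in K2. auto. }
  destruct (least_nat _ Hex) as [k [Hk Hmin]].
  assert (Hf := INR_fact_lt_0 (S k)).
  set (B := Dnorm c u (Re s + 2 * r) + Dnorm c u (Re s - 2 * r)).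
  assert (Hrk : 0 < r ^ S (S k)) by (apply pow_lt; auto).
  exists (S k), (RtoC (/ INR (Factorial.fact (S k))) * DS (dcoef c u (S k)) u s)%C, (/ r ^ S (S k) * Rabs B + 1), r.
  assert (HB := Rabs_pos B). assert (Hri : 0 < / r ^ S (S k)) by (apply Rinv_0_lt_compat; auto).
  repeat split; auto; [lia| |nra|].
  - intros E. apply Cmult_integral_l in E; auto. intros E2. apply RtoC_inj in E2.
    generalize (Rinv_0_lt_compat _ Hf). lra.
  - intros h Hh. assert (T := DS_Taylor_near c u s h r (S k) Hr
      (Dconv_near_sub c u (Re s) (4 * r) (2 * r) ltac:(lra) Hc) Hh). fold B in T.
    rewrite Csum_shift1 in T.
    rewrite (Csum_single (S k) (fun k0 => exp_term h (S k0) * DS (dcoef c u (S k0)) u s)%C k) in T; [|lia|].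
    2:{ intros j Hj Hjk. replace (DS (dcoef c u (S j)) u s) with (RtoC 0); [ring|].
        symmetry. apply NNPP. apply Hmin. lia. }
    assert (E : (DS c u (s + h) - DS c u s - RtoC (/ INR (Factorial.fact (S k))) * DS (dcoef c u (S k)) u s * h ^ S k)%C =
      (DS c u (s + h) - (exp_term h 0 * DS (dcoef c u 0) u s + exp_term h (S k) * DS (dcoef c u (S k)) u s))%C).
    { rewrite (DS_ext (dcoef c u 0) c) by (intros; apply dcoef_0).
      assert (E0 : exp_term h 0 = RtoC 1) by (unfold exp_term; simpl; rewrite Rinv_1; ring).
      rewrite E0. unfold exp_term. ring. }
    rewrite E. eapply Rle_trans; [exact T|].
    assert (Hhk : 0 <= Cmod h ^ S (S k)) by (apply pow_le, Cmod_ge_0).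
    unfold Rdiv. rewrite Rpow_mult_distr, pow_inv.
    assert (HB2 := Rle_abs B).
    assert (K : Cmod h ^ S (S k) * / r ^ S (S k) * B <= Cmod h ^ S (S k) * / r ^ S (S k) * Rabs B).
    { apply Rmult_le_compat_l; auto. apply Rmult_le_pos; lra. }
    nra.
Qed.

(** * Hurwitz's theorem by descent of the modulus *)

Lemma leading_term_continuous F s : has_leading_term F s -> forall e, 0 < e -> exists d, 0 < d /\
  forall z, Cmod (z - s) < d -> Cmod (F z - F s) < e.
Proof.
  intros [k [d [M [r [Hk [Hd [HM [Hr H]]]]]]]] e He.
  set (K := Cmod d + M). assert (Hd0 := Cmod_ge_0 d). assert (HK : 0 < K) by (unfold K; lra).
  exists (Rmin (Rmin 1 r) (e / (2 * K))). split.
  { repeat apply Rmin_pos; try lra. apply Rdiv_lt_0_compat; lra. }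
  intros z Hz. assert (Z1 := Rlt_le_trans _ _ _ Hz (Rmin_l _ _)). assert (Z2 := Rlt_le_trans _ _ _ Hz (Rmin_r _ _)).
  assert (Z3 := Rlt_le_trans _ _ _ Z1 (Rmin_l _ _)). assert (Z4 := Rlt_le_trans _ _ _ Z1 (Rmin_r _ _)).
  specialize (H (z - s)%C ltac:(lra)). replace (s + (z - s))%C with z in H by ring.
  set (h := Cmod (z - s)) in *. assert (Hh : 0 <= h) by apply Cmod_ge_0.
  assert (P : forall j, (0 < j)%nat -> h ^ j <= h).
  { intros j Hj. destruct j as [|j]; [lia|]. simpl. rewrite <- (Rmult_1_r h) at 3.
    apply Rmult_le_compat_l; auto. rewrite <- (pow1 j). apply pow_incr. lra. }
  replace (F z - F s)%C with ((F z - F s - d * (z - s) ^ k) + d * (z - s) ^ k)%C by ring.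
  eapply Rle_lt_trans; [apply Cmod_triangle|]. rewrite Cmod_mult, Cmod_pow. fold h.
  assert (P1 := P k Hk). assert (P2 := P (S k) ltac:(lia)).
  assert (Q1 : Cmod d * h ^ k <= Cmod d * h) by (apply Rmult_le_compat_l; auto).
  assert (Q2 : M * h ^ S k <= M * h) by (apply Rmult_le_compat_l; lra).
  apply Rmult_lt_compat_r with (r := 2 * K) in Z2; [|lra].
  unfold Rdiv in Z2. rewrite Rmult_assoc, Rinv_l, Rmult_1_r in Z2 by lra. unfold K in Z2. nra.
Qed.

Lemma cis_pow x k : (cis x ^ k)%C = cis (INR k * x).
Proof.
  induction k as [|k IH].
  - simpl. rewrite Rmult_0_l, cis_0. reflexivity.
  - rewrite S_INR. replace ((INR k + 1) * x) with (x + INR k * x) by ring. rewrite cis_plus, <- IH. reflexivity.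
Qed.

Lemma Cpow_mult_distr (x y : C) k : ((x * y) ^ k)%C = (x ^ k * y ^ k)%C.
Proof. induction k as [|k IH]; simpl; [ring|rewrite IH; ring]. Qed.

(** Choose [h] with [d h^k] a negative multiple of [F s - w]. *)
Lemma modulus_descent F s w rho : has_leading_term F s -> F s <> w -> 0 < rho ->
  exists h, Cmod h <= rho /\ Cmod (F (s + h) - w)%C < Cmod (F s - w).
Proof.
  intros [k [d [M [r [Hk [Hd [HM [Hr H]]]]]]]] Hw Hrho.
  set (G := (F s - w)%C).
  assert (HG : 0 < Cmod G).
  { apply Cmod_gt_0. intros E. apply Hw. replace (F s) with (G + w)%C by (unfold G; ring). rewrite E; ring. }
  assert (HGn : G <> RtoC 0) by (apply Cmod_gt_0; auto).
  assert (Hdp : 0 < Cmod d) by (apply Cmod_gt_0; auto).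
  destruct (unit_phase (- G / d)%C) as [th Hth].
  assert (HkR : 0 < INR k) by (apply lt_0_INR; auto).
  assert (Ex : exists del, 0 < del /\ del <= rho /\ del <= r /\ del ^ k * Cmod d <= Cmod G /\ M * del < Cmod d).
  { set (del := Rmin (Rmin 1 (Cmod G / Cmod d)) (Rmin (Rmin rho r) (Cmod d / (2 * M)))).
    assert (P : 0 < del) by (repeat apply Rmin_pos; try lra; apply Rdiv_lt_0_compat; lra).
    assert (P1 : del <= Rmin 1 (Cmod G / Cmod d)) by apply Rmin_l.
    assert (P2 : del <= Rmin (Rmin rho r) (Cmod d / (2 * M))) by apply Rmin_r.
    assert (P3 := Rle_trans _ _ _ P1 (Rmin_l _ _)). assert (P4 := Rle_trans _ _ _ P1 (Rmin_r _ _)).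
    assert (P5 := Rle_trans _ _ _ P2 (Rmin_l _ _)). assert (P6 := Rle_trans _ _ _ P2 (Rmin_r _ _)).
    assert (P7 := Rle_trans _ _ _ P5 (Rmin_l _ _)). assert (P8 := Rle_trans _ _ _ P5 (Rmin_r _ _)).
    exists del. repeat split; auto.
    - destruct k as [|j]; [lia|]. simpl.
      assert (Q : del ^ j <= 1) by (rewrite <- (pow1 j); apply pow_incr; lra).
      apply Rle_trans with (del * 1 * Cmod d).
      + apply Rmult_le_compat_r; [lra|]. apply Rmult_le_compat_l; lra.
      + apply Rmult_le_compat_r with (r := Cmod d) in P4; [|lra].
        unfold Rdiv in P4. rewrite Rmult_assoc, Rinv_l in P4; lra.
    - apply Rmult_le_compat_l with (r := M) in P6; [|lra].
      replace (M * (Cmod d / (2 * M))) with (Cmod d / 2) in P6 by (field; lra). lra. }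
  destruct Ex as [del [D0 [D1 [D2 [D3 D4]]]]].
  set (h := (RtoC del * cis (- th / INR k))%C).
  assert (Hh : Cmod h = del).
  { unfold h. rewrite Cmod_mult, Cmod_cis, Cmod_R, Rabs_pos_eq; lra. }
  exists h. split; [lra|].
  assert (Ehk : (d * h ^ k)%C = (RtoC (- (del ^ k * Cmod d / Cmod G)) * G)%C).
  { unfold h. rewrite Cpow_mult_distr, cis_pow, <- RtoC_pow.
    replace (INR k * (- th / INR k)) with (- th) by (field; lra).
    assert (E2 : (- G / d)%C = (cis (- th) * RtoC (Cmod G / Cmod d))%C).
    { assert (E3 : Cmod (- G / d) = Cmod G / Cmod d) by (rewrite Cmod_div, Cmod_opp; auto).
      rewrite <- E3, <- Hth. transitivity (cis th * cis (- th) * (- G / d))%C; [rewrite cis_opp_r; ring|ring]. }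
    assert (E4 : cis (- th) = (RtoC (Cmod d / Cmod G) * (- G / d))%C).
    { rewrite E2. transitivity (cis (- th) * (RtoC (Cmod d / Cmod G) * RtoC (Cmod G / Cmod d)))%C; [|ring].
      rewrite <- RtoC_mult. replace (Cmod d / Cmod G * (Cmod G / Cmod d)) with 1 by (field; lra). ring. }
    rewrite E4. replace (- (del ^ k * Cmod d / Cmod G)) with (- 1 * (del ^ k * (Cmod d / Cmod G))) by (field; lra).
    rewrite !RtoC_mult. replace (RtoC (- (1))) with (- RtoC 1)%C by (rewrite RtoC_opp; auto). field. auto. }
  specialize (H h ltac:(lra)). rewrite Hh in H.
  replace (F (s + h) - w)%C with ((F (s + h) - F s - d * h ^ k) + (G + d * h ^ k))%C by (unfold G; ring).
  eapply Rle_lt_trans; [apply Cmod_triangle|].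
  set (p := del ^ k * Cmod d / Cmod G) in *.
  assert (Hp : p * Cmod G = del ^ k * Cmod d) by (unfold p; field; lra).
  assert (Hp0 : 0 < del ^ k) by (apply pow_lt; auto).
  assert (Hp1 : 0 < p) by (unfold p; apply Rdiv_lt_0_compat; auto; apply Rmult_lt_0_compat; auto).
  assert (Hp2 : p <= 1).
  { apply Rmult_le_reg_r with (Cmod G); auto. lra. }
  assert (E : (G + d * h ^ k)%C = (RtoC (1 - p) * G)%C).
  { rewrite Ehk. unfold Rminus. rewrite RtoC_plus. ring. }
  rewrite E, Cmod_mult, Cmod_R, Rabs_pos_eq by lra.
  assert (K : M * del ^ S k < del ^ k * Cmod d).
  { simpl. replace (M * (del * del ^ k)) with (del ^ k * (M * del)) by ring.
    apply Rmult_lt_compat_l; auto. }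
  fold G. lra.
Qed.

(** If the infimum [- m] were not attained, continuity would give every point a neighbourhood on
    which [phi] exceeds it by a positive margin. Margins of four quarters combine to their minimum,
    so bisection yields a margin on the whole rectangle, against the choice of [m]. *)
Lemma rectangle_minimum (phi : R -> R -> R) x0 y0 W H : 0 < W -> 0 < H ->
  (forall x y, 0 <= phi x y) ->
  (forall u v, x0 <= u <= x0 + W -> y0 <= v <= y0 + H -> forall e, 0 < e -> exists d, 0 < d /\
     forall x y, Rabs (x - u) < d -> Rabs (y - v) < d -> Rabs (phi x y - phi u v) < e) ->
  exists u v, x0 <= u <= x0 + W /\ y0 <= v <= y0 + H /\
    forall x y, x0 <= x <= x0 + W -> y0 <= y <= y0 + H -> phi u v <= phi x y.
Proof.
  intros HW HH Hpos Hcont. apply NNPP. intros Hno.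
  destruct (completeness (fun z => exists x y, x0 <= x <= x0 + W /\ y0 <= y <= y0 + H /\ z = - phi x y)) as [m [Hm1 Hm2]].
  - exists 0. intros z [x [y [_ [_ ->]]]]. specialize (Hpos x y). lra.
  - exists (- phi x0 y0), x0, y0. repeat split; lra.
  - assert (Hm : forall x y, x0 <= x <= x0 + W -> y0 <= y <= y0 + H -> - m <= phi x y).
    { intros x y Hx Hy. assert (- phi x y <= m) by (apply Hm1; exists x, y; auto). lra. }
    assert (Hm' : forall x y, x0 <= x <= x0 + W -> y0 <= y <= y0 + H -> - m < phi x y).
    { intros x y Hx Hy. apply Rnot_le_lt. intros Hle. apply Hno. exists x, y. repeat split; try lra.
      intros x' y' Hx' Hy'. specialize (Hm x' y' Hx' Hy'). lra. }
    set (P := fun x y q => exists e, 0 < e /\ forall x' y', x <= x' <= x + q * W -> y <= y' <= y + q * H -> - m + e <= phi x' y').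
    assert (K : P x0 y0 1).
    { apply (rectangle_bisection W H x0 y0 P); auto.
      - intros x y q Hq _ _ _ _ [e1 [P1 Q1]] [e2 [P2 Q2]] [e3 [P3 Q3]] [e4 [P4 Q4]].
        exists (Rmin (Rmin e1 e2) (Rmin e3 e4)). split; [repeat apply Rmin_pos; auto|].
        intros x' y' Hx' Hy'.
        assert (M1 := Rmin_l (Rmin e1 e2) (Rmin e3 e4)). assert (M2 := Rmin_r (Rmin e1 e2) (Rmin e3 e4)).
        assert (M3 := Rmin_l e1 e2). assert (M4 := Rmin_r e1 e2). assert (M5 := Rmin_l e3 e4). assert (M6 := Rmin_r e3 e4).
        destruct (Rle_dec x' (x + q / 2 * W)); destruct (Rle_dec y' (y + q / 2 * H)).
        + specialize (Q1 x' y' ltac:(lra) ltac:(lra)). lra.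
        + specialize (Q3 x' y' ltac:(lra) ltac:(lra)). lra.
        + specialize (Q2 x' y' ltac:(lra) ltac:(lra)). lra.
        + specialize (Q4 x' y' ltac:(lra) ltac:(lra)). lra.
      - intros u v Hu Hv. specialize (Hm' u v Hu Hv).
        destruct (Hcont u v Hu Hv ((phi u v + m) / 2)) as [d [Hd Hdl]]; [lra|].
        exists (Rmin (d / (2 * W)) (d / (2 * H))). split.
        { apply Rmin_pos; apply Rdiv_lt_0_compat; lra. }
        intros x y q [Hq Hqd] X Y _ _ _ _. exists ((phi u v + m) / 2). split; [lra|].
        assert (Q1 := Rlt_le_trans _ _ _ Hqd (Rmin_l _ _)). assert (Q2 := Rlt_le_trans _ _ _ Hqd (Rmin_r _ _)).
        apply Rmult_lt_compat_r with (r := W) in Q1; auto. apply Rmult_lt_compat_r with (r := H) in Q2; auto.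
        replace (d / (2 * W) * W) with (d / 2) in Q1 by (field; lra).
        replace (d / (2 * H) * H) with (d / 2) in Q2 by (field; lra).
        intros x' y' Hx' Hy'. specialize (Hdl x' y' ltac:(apply Rabs_def1; lra) ltac:(apply Rabs_def1; lra)).
        apply Rabs_def2 in Hdl. lra. }
    destruct K as [e [He K]].
    assert (m <= m - e); [|lra]. apply Hm2. intros z [x [y [Hx [Hy ->]]]].
    specialize (K x y ltac:(lra) ltac:(lra)). lra.
Qed.

(** On a small square around [s0] the translate of [F1] has $|F_1-w|$ at most [m0 / 4] at the
    centre, but larger on the boundary, where $|F_2-w|$ is at least [m0]. The minimum is therefore
    interior, and [modulus_descent] leaves only the value zero for it. *)
Theorem Hurwitz F1 F2 s0 rho : 0 < rho -> has_leading_term F2 s0 ->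
  (forall s, Rabs (Re s - Re s0) <= rho -> has_leading_term F1 s) ->
  (forall e, 0 < e -> exists tau, forall s, Rabs (Re s - Re s0) <= rho -> Cmod (F1 (s + Ci * RtoC tau) - F2 s)%C <= e) ->
  exists s, Rabs (Re s - Re s0) <= rho /\ F1 s = F2 s0.
Proof.
  intros Hrho [k [d [M [r [Hk [Hd [HM [Hr H]]]]]]]] HF1 Happ.
  assert (Hdp : 0 < Cmod d) by (apply Cmod_gt_0; auto).
  (* Half the side of the square, whose boundary lies in the annulus $a\le|h|\le 2a$. There the
     bound on [a] keeps the remainder below half of the leading term; [a <= rho] keeps the square in
     the region of approximation. *)
  set (a := Rmin rho (Rmin (r / 2) (Cmod d / (4 * M)))).
  assert (Ha : 0 < a) by (repeat apply Rmin_pos; try lra; apply Rdiv_lt_0_compat; lra).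
  assert (A1 : a <= rho) by apply Rmin_l.
  assert (A0 : a <= Rmin (r / 2) (Cmod d / (4 * M))) by apply Rmin_r.
  assert (A2 := Rle_trans _ _ _ A0 (Rmin_l _ _)). assert (A3 := Rle_trans _ _ _ A0 (Rmin_r _ _)).
  assert (A4 : M * (2 * a) <= Cmod d / 2).
  { apply Rmult_le_compat_l with (r := 2 * M) in A3; [|lra].
    replace (2 * M * (Cmod d / (4 * M))) with (Cmod d / 2) in A3 by (field; lra). lra. }
  set (w := F2 s0).
  assert (Hbig : forall h, a <= Cmod h <= 2 * a -> Cmod d / 2 * a ^ k <= Cmod (F2 (s0 + h) - w)%C).
  { intros h [B1 B2]. specialize (H h ltac:(lra)). fold w in H.
    assert (K := Cmod_rev_triangle (d * h ^ k)%C (- (F2 (s0 + h) - w - d * h ^ k))%C).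
    rewrite Cmod_opp in K.
    replace (d * h ^ k - - (F2 (s0 + h) - w - d * h ^ k))%C with (F2 (s0 + h) - w)%C in K by ring.
    rewrite Cmod_mult, Cmod_pow in K.
    assert (P : 0 <= Cmod h ^ k) by (apply pow_le, Cmod_ge_0).
    assert (Q : M * Cmod h ^ S k <= Cmod d / 2 * Cmod h ^ k).
    { simpl. rewrite <- Rmult_assoc. apply Rmult_le_compat_r; auto.
      eapply Rle_trans; [|exact A4]. apply Rmult_le_compat_l; lra. }
    assert (Q2 : a ^ k <= Cmod h ^ k) by (apply pow_incr; lra).
    assert (Q3 : Cmod d / 2 * a ^ k <= Cmod d / 2 * Cmod h ^ k) by (apply Rmult_le_compat_l; lra).
    lra. }
  set (m0 := Cmod d / 2 * a ^ k) in *.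
  assert (Hm0 : 0 < m0) by (apply Rmult_lt_0_compat; [lra|apply pow_lt; auto]).
  destruct (Happ (m0 / 4)) as [tau Htau]; [lra|].
  destruct s0 as [x0 y0]. unfold Re in *. simpl fst in *.
  set (phi := fun x y => Cmod (F1 (x, y + tau) - w)).
  assert (Hpt : forall x y, Rabs (x - x0) <= rho -> Cmod (F1 (x, y + tau) - F2 (x, y)) <= m0 / 4).
  { intros x y Hx. rewrite <- vertical_shift. apply Htau; auto. }
  destruct (rectangle_minimum phi (x0 - a) (y0 - a) (2 * a) (2 * a)) as [u [v [Hu [Hv Hmin]]]]; try lra.
  { intros; apply Cmod_ge_0. }
  { intros u v Hu Hv e He.
    destruct (leading_term_continuous F1 (u, v + tau) (HF1 (u, v + tau) ltac:(simpl; apply Rabs_le; lra)) e He) as [dl [Hdl K]].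
    exists (dl / 2). split; [lra|]. intros x y Hx Hy. unfold phi.
    assert (K1 : Cmod (F1 (x, y + tau) - F1 (u, v + tau)) < e).
    { apply K. eapply Rle_lt_trans; [apply Cmod_le_re_im|]. simpl.
      replace (y + tau + - (v + tau)) with (y - v) by ring. change (x + - u) with (x - u). lra. }
    assert (K2 := Cmod_rev_triangle (F1 (x, y + tau) - w) (F1 (u, v + tau) - w)).
    assert (K3 := Cmod_rev_triangle (F1 (u, v + tau) - w) (F1 (x, y + tau) - w)).
    replace (F1 (x, y + tau)%R - w - (F1 (u, v + tau)%R - w))%C with (F1 (x, (y + tau)%R) - F1 (u, (v + tau)%R))%C in K2 by ring.
    rewrite (Cmod_sub_sym (F1 (u, (v + tau)%R) - w) (F1 (x, (y + tau)%R) - w)) in K3.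
    replace (F1 (x, y + tau)%R - w - (F1 (u, v + tau)%R - w))%C with (F1 (x, (y + tau)%R) - F1 (u, (v + tau)%R))%C in K3 by ring.
    apply Rabs_def1; lra. }
  assert (Hcenter : phi x0 y0 <= m0 / 4).
  { apply (Hpt x0 y0). replace (x0 - x0) with 0 by ring. rewrite Rabs_R0. lra. }
  assert (Huv : phi u v <= m0 / 4) by (eapply Rle_trans; [apply (Hmin x0 y0)|]; lra).
  assert (Hx : Rabs (u - x0) <= rho) by (apply Rabs_le; lra).
  assert (Hin : Rabs (u - x0) < a /\ Rabs (v - y0) < a).
  { apply NNPP. intros Hno.
    set (h := (u - x0, v - y0)).
    assert (E1 : Cmod h <= 2 * a).
    { eapply Rle_trans; [apply Cmod_le_re_im|]. simpl.
      assert (Rabs (u - x0) <= a) by (apply Rabs_le; lra). assert (Rabs (v - y0) <= a) by (apply Rabs_le; lra). lra. }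
    assert (E2 : a <= Cmod h).
    { assert (K1 := re_le_Cmod h). assert (K2 := im_le_Cmod h). simpl in K1, K2.
      apply Rnot_lt_le. intros Hlt. apply Hno. split; lra. }
    specialize (Hbig h (conj E2 E1)).
    replace ((x0, y0) + h)%C with (u, v) in Hbig by (unfold h; apply C_ext; simpl; ring).
    specialize (Hpt u v Hx). unfold phi in Huv.
    assert (K := Cmod_triangle_sub (F2 (u, v)) (F1 (u, v + tau)) w).
    rewrite (Cmod_sub_sym (F2 (u, v)) (F1 (u, v + tau))) in K. lra. }
  destruct Hin as [I1 I2]. apply Rabs_def2 in I1. apply Rabs_def2 in I2.
  exists (u, v + tau). simpl. split; auto.
  apply NNPP. intros Hne. fold w in Hne.
  set (rr := Rmin (Rmin (a - (u - x0)) (a + (u - x0))) (Rmin (a - (v - y0)) (a + (v - y0)))).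
  assert (Hrr : 0 < rr) by (repeat apply Rmin_pos; lra).
  assert (R1 : rr <= Rmin (a - (u - x0)) (a + (u - x0))) by apply Rmin_l.
  assert (R2 : rr <= Rmin (a - (v - y0)) (a + (v - y0))) by apply Rmin_r.
  assert (R3 := Rle_trans _ _ _ R1 (Rmin_l _ _)). assert (R4 := Rle_trans _ _ _ R1 (Rmin_r _ _)).
  assert (R5 := Rle_trans _ _ _ R2 (Rmin_l _ _)). assert (R6 := Rle_trans _ _ _ R2 (Rmin_r _ _)).
  destruct (modulus_descent F1 (u, v + tau) w rr (HF1 (u, v + tau) ltac:(simpl; auto)) Hne Hrr) as [[h1 h2] [Hh Hlt]].
  assert (K1 := Rle_trans _ _ _ (re_le_Cmod (h1, h2)) Hh). assert (K2 := Rle_trans _ _ _ (im_le_Cmod (h1, h2)) Hh).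
  simpl in K1, K2. apply Rabs_le_between in K1. apply Rabs_le_between in K2.
  specialize (Hmin (u + h1) (v + h2) ltac:(lra) ltac:(lra)). unfold phi in Hmin.
  replace (u + h1, v + h2 + tau) with ((u, (v + tau)%R) + (h1, h2))%C in Hmin by (apply C_ext; simpl; ring).
  lra.
Qed.

(** * Kronecker's theorem *)

(** Passage from sequences, where a zero coefficient marks an index to be ignored, to the
    repetition-free lists of [Bohr_inequality]. *)
Fixpoint freq_list (c : nat -> C) (u th : nat -> R) (N : nat) : list (R * R) :=
  match N with
  | O => nil
  | S m => if excluded_middle_informative (c m = RtoC 0) then freq_list c u th m
           else (u m, th m) :: freq_list c u th m
  end.

Definition if_nonzero (c : nat -> C) (F : nat -> C) (n : nat) : C :=
  if excluded_middle_informative (c n = RtoC 0) then RtoC 0 else F n.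

Lemma In_freq_list c u th N x : In x (map fst (freq_list c u th N)) ->
  exists n, (n < N)%nat /\ c n <> RtoC 0 /\ x = u n.
Proof.
  induction N as [|N IH]; simpl; [intros []|].
  destruct (excluded_middle_informative (c N = RtoC 0)) as [E|E].
  - intros H. destruct (IH H) as [n [H1 H2]]. exists n; split; auto; lia.
  - simpl. intros [H|H].
    + exists N. repeat split; auto.
    + destruct (IH H) as [n [H1 H2]]. exists n; split; auto; lia.
Qed.

Lemma NoDup_freq_list c u th N : distinct c u -> NoDup (map fst (freq_list c u th N)).
Proof.
  intros Hd. induction N as [|N IH]; simpl; [constructor|].
  destruct (excluded_middle_informative (c N = RtoC 0)) as [E|E]; auto.
  simpl. constructor; auto. intros H. apply In_freq_list in H. destruct H as [n [H1 [H2 H3]]].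
  apply (Hd N n); auto. lia.
Qed.

Lemma Lsum_freq_list c u th N F :
  Lsum (freq_list c u th N) F = Csum N (if_nonzero c (fun n => F (u n, th n))).
Proof.
  induction N as [|N IH]; simpl; auto. unfold if_nonzero at 2.
  destruct (excluded_middle_informative (c N = RtoC 0)) as [E|E]; simpl; rewrite IH; ring.
Qed.

Lemma Bohr_inequality_seq (L : R -> Prop) f a c u th B N : Q_lin_indep L -> Ccont f ->
  (forall nu, is_mean (twist f nu) (a nu)) -> (forall nu, a nu <> RtoC 0 -> L nu) ->
  (forall t, Re (f t) <= B) -> distinct c u -> (forall n, c n <> RtoC 0 -> L (u n)) ->
  Re (Csum N (if_nonzero c (fun n => cis (th n) * a (u n)))%C) <= B.
Proof.
  intros HL Cf Hm Ha HB Hd Hu.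
  assert (E := Lsum_freq_list c u th N (fun p => cis (snd p) * a (fst p))%C). cbn [fst snd] in E.
  rewrite <- E.
  apply (Bohr_inequality L f a); auto.
  - apply NoDup_freq_list; auto.
  - apply List.Forall_forall. intros x Hx. apply In_freq_list in Hx. destruct Hx as [n [_ [H ->]]]. auto.
Qed.

(** The prescribed phases are chosen to rotate every coefficient onto its modulus, so Bohr's
    inequality bounds the sum of the moduli. *)
Lemma Bohr_coefficient_bound (L : R -> Prop) f a b u B : Q_lin_indep L -> Ccont f ->
  (forall nu, is_mean (twist f nu) (a nu)) -> (forall nu, a nu <> RtoC 0 -> L nu) ->
  (forall t, Cmod (f t) <= B) -> distinct b u -> (forall n, b n <> RtoC 0 -> a (u n) = b n) ->
  forall N, Rsum N (fun n => Cmod (b n)) <= B.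
Proof.
  intros HL Cf Hm Ha HB Hd Hb N.
  set (th := fun n => epsilon (inhabits 0) (fun x => (cis x * b n)%C = RtoC (Cmod (b n)))).
  assert (Hth : forall n, (cis (th n) * b n)%C = RtoC (Cmod (b n))).
  { intros n. apply (epsilon_spec (inhabits 0) (fun x => (cis x * b n)%C = RtoC (Cmod (b n)))). apply unit_phase. }
  assert (K := Bohr_inequality_seq L f a b u th B N HL Cf Hm Ha
    (fun t => Rle_trans _ _ _ (re_bound (f t)) (HB t)) Hd
    (fun n Hn => Ha (u n) ltac:(rewrite (Hb n Hn); auto))).
  eapply Rle_trans; [|exact K]. right. rewrite Re_Csum. apply Rsum_ext. intros n _. unfold if_nonzero.
  destruct (excluded_middle_informative (b n = RtoC 0)) as [E|E].
  - rewrite E, Cmod_0. reflexivity.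
  - rewrite Hb, Hth by auto. reflexivity.
Qed.

Lemma Cmod_cis_sub_sq x y : Cmod (cis x - cis y) ^ 2 = 2 - 2 * cos (x - y).
Proof.
  rewrite Cmod2_alt. simpl. rewrite cos_minus.
  assert (H1 := sin2_cos2 x). assert (H2 := sin2_cos2 y). unfold Rsqr in *.
  unfold Re, Im; simpl. nra.
Qed.

(** Bohr's inequality applied to the sum of the [e^(i (u_n t - th_n))]: its real part must come
    arbitrarily close to the number of terms. *)
Theorem Kronecker (L : R -> Prop) c u th : Q_lin_indep L -> distinct c u -> (forall n, c n <> RtoC 0 -> L (u n)) ->
  forall N e, 0 < e -> exists tau, forall n, (n < N)%nat -> c n <> RtoC 0 -> Cmod (cis (u n * tau) - cis (th n)) <= e.
Proof.
  intros HL Hd Hu N e He. apply NNPP. intros Hno.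
  set (f := fun t => Csum N (if_nonzero c (fun n => cis (u n * t + - th n)))).
  set (a := fun nu => Csum N (if_nonzero c (fun n => if Req_EM_T (u n) nu then cis (- th n) else RtoC 0))).
  set (M := Rsum N (fun n => if excluded_middle_informative (c n = RtoC 0) then 0 else 1)).
  assert (Cn : forall n, Ccont (fun t => if_nonzero c (fun n => cis (u n * t + - th n)) n)).
  { intros n. unfold if_nonzero. destruct (excluded_middle_informative (c n = RtoC 0));
      [apply Ccont_const|apply Ccont_cis]. }
  assert (Cf : Ccont f) by (apply (Ccont_Csum N (fun n t => if_nonzero c (fun n => cis (u n * t + - th n)) n)); auto).
  assert (Hm : forall nu, is_mean (twist f nu) (a nu)).
  { intros nu. apply mean_ext with (fun t => Csum N (fun n => if_nonzero c (fun n => cis (u n * t + - th n)) n * cis (- nu * t)))%C.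
    { intros t. unfold twist, f. rewrite (Cmult_comm (Csum N _)), <- Csum_scal. apply Csum_ext. intros; ring. }
    apply (mean_Csum N (fun n t => if_nonzero c (fun n => cis (u n * t + - th n)) n * cis (- nu * t))%C).
    - intros n. apply Ccont_mult; auto. apply Ccont_cis0.
    - intros n. unfold if_nonzero. destruct (excluded_middle_informative (c n = RtoC 0)).
      + apply mean_ext with (fun _ => RtoC 0); [intros; ring|apply mean_const].
      + apply mean_ext with (fun t => cis (- th n) * cis ((u n - nu) * t))%C.
        { intros t. rewrite <- !cis_plus. f_equal. ring. }
        destruct (Req_EM_T (u n) nu) as [E|E].
        * apply mean_ext with (fun _ => cis (- th n)); [|apply mean_const]. intros t.
          replace ((u n - nu) * t) with 0 by (rewrite E; ring). rewrite cis_0. ring.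
        * replace (RtoC 0) with (cis (- th n) * RtoC 0)%C by ring.
          apply mean_scal; [apply Ccont_cis0|apply mean_cis; lra]. }
  assert (Ha : forall nu, a nu <> RtoC 0 -> L nu).
  { intros nu H. apply NNPP. intros Hn. apply H. unfold a. apply Csum_0. intros n _. unfold if_nonzero.
    destruct (excluded_middle_informative (c n = RtoC 0)) as [E|E]; auto.
    destruct (Req_EM_T (u n) nu) as [E2|E2]; auto. exfalso. apply Hn. rewrite <- E2. auto. }
  assert (He2 : 0 < e ^ 2) by (apply pow_lt; auto).
  (* If no [tau] works, then at every [t] some phase is off by more than [e]. Since
     $|e^{ix}-e^{iy}|^2=2-2\cos(x-y)$, its term has real part at most $1-e^2/2$, the other terms at
     most 1. *)
  assert (HB : forall t, Re (f t) <= M - e ^ 2 / 2).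
  { intros t. unfold f, M. rewrite Re_Csum.
    assert (Hbad : exists n, (n < N)%nat /\ c n <> RtoC 0 /\ e < Cmod (cis (u n * t) - cis (th n))).
    { apply NNPP. intros Hnb. apply Hno. exists t. intros n H1 H2. apply Rnot_lt_le. intros H3.
      apply Hnb. exists n; auto. }
    destruct Hbad as [i [Hi [Hci Hbad]]].
    set (g := fun n => (if excluded_middle_informative (c n = RtoC 0) then 0 else 1)
        - Re (if_nonzero c (fun n => cis (u n * t + - th n)) n)).
    assert (Hg : forall n, 0 <= g n).
    { intros n. unfold g, if_nonzero. destruct (excluded_middle_informative (c n = RtoC 0)); simpl.
      - unfold Re; simpl. lra.
      - unfold Re; simpl. generalize (COS_bound (u n * t + - th n)). lra. }
    assert (Hgi : e ^ 2 / 2 <= g i).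
    { unfold g, if_nonzero. destruct (excluded_middle_informative (c i = RtoC 0)); [contradiction|].
      unfold Re; simpl fst. assert (K := Cmod_cis_sub_sq (u i * t) (th i)).
      change (u i * t - th i) with (u i * t + - th i) in K.
      assert (K2 : e ^ 2 <= Cmod (cis (u i * t) - cis (th i)) ^ 2) by (apply pow_incr; lra). lra. }
    assert (K := Rsum_ge_term N g i (fun k _ => Hg k) Hi).
    assert (E : Rsum N (fun n => if excluded_middle_informative (c n = RtoC 0) then 0 else 1) =
      Rsum N g + Rsum N (fun n => Re (if_nonzero c (fun n => cis (u n * t + - th n)) n))).
    { rewrite <- Rsum_plus. apply Rsum_ext. intros n _. unfold g. ring. }
    rewrite E. lra. }
  assert (K := Bohr_inequality_seq L f a c u th _ N HL Cf Hm Ha HB Hd Hu).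
  assert (E : Re (Csum N (if_nonzero c (fun n => cis (th n) * a (u n))))%C = M).
  { rewrite Re_Csum. apply Rsum_ext. intros n Hn. unfold if_nonzero at 1.
    destruct (excluded_middle_informative (c n = RtoC 0)) as [Ec|Ec]; [reflexivity|].
    unfold a. rewrite (Csum_single N _ n Hn).
    - unfold if_nonzero. destruct (excluded_middle_informative (c n = RtoC 0)); [contradiction|].
      destruct (Req_EM_T (u n) (u n)); [|lra]. rewrite cis_opp_r. reflexivity.
    - intros m Hm' Hmn. unfold if_nonzero. destruct (excluded_middle_informative (c m = RtoC 0)); auto.
      destruct (Req_EM_T (u m) (u n)); auto. exfalso. apply (Hd m n); auto. }
  rewrite E in K. lra.
Qed.

(** The sum [b] of the moduli of the terms at the two edges dominates the series on the whole strip.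
    Kronecker's theorem aligns the first [N] phases, and the tail of [b], doubled for the two
    series, bounds the rest uniformly. *)
Lemma DS_translation_approx (L : R -> Prop) c c' u th x rho : Q_lin_indep L -> distinct c u ->
  (forall n, c n <> RtoC 0 -> L (u n)) -> (forall n, c' n = (c n * cis (th n))%C) -> 0 < rho ->
  Dconv_near c u x rho ->
  forall e, 0 < e -> exists tau, forall s, Rabs (Re s - x) <= rho ->
    Cmod (DS c u (s + Ci * RtoC tau) - DS c' u s)%C <= e.
Proof.
  intros HL Hd Hu Hc' Hrho Hc e He.
  set (b := fun n => Cmod (c n) * exp (u n * (x + rho)) + Cmod (c n) * exp (u n * (x - rho))).
  assert (D1 : Dconv c u (x + rho)) by (apply Hc; replace (x + rho - x) with rho by ring; rewrite Rabs_pos_eq; lra).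
  assert (D2 : Dconv c u (x - rho)) by (apply Hc; replace (x - rho - x) with (- rho) by ring; rewrite Rabs_Ropp, Rabs_pos_eq; lra).
  assert (Hb : ex_series b) by exact (ex_series_plus _ _ D1 D2).
  assert (Hb0 : forall n, 0 <= b n).
  { intros n. unfold b. assert (P := Cmod_ge_0 (c n)).
    assert (P1 := exp_pos (u n * (x + rho))). assert (P2 := exp_pos (u n * (x - rho))).
    apply Rplus_le_le_0_compat; apply Rmult_le_pos; lra. }
  destruct (Series_tail b (e / 4) Hb) as [N HN]; [lra|]. specialize (HN N (Nat.le_refl N)).
  assert (HS : 0 <= Series b) by (eapply Rle_trans; [|apply (Rsum_le_Series b 0); auto]; simpl; lra).
  destruct (Kronecker L c u th HL Hd Hu N (e / (2 * (Series b + 1)))) as [tau Htau].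
  { apply Rdiv_lt_0_compat; lra. }
  set (del := e / (2 * (Series b + 1))) in *.
  assert (Hdel : 0 < del) by (apply Rdiv_lt_0_compat; lra).
  exists tau. intros s Hs.
  assert (Hbs : forall n, Cmod (c n * Cexp (RtoC (u n) * s))%C <= b n).
  { intros n. rewrite Cmod_DS_term. unfold b. rewrite <- Rmult_plus_distr_l.
    apply Rmult_le_compat_l; [apply Cmod_ge_0|].
    assert (K := exp_abs_shift (u n) x rho).
    eapply Rle_trans; [|exact K]. rewrite <- exp_plus.
    assert (Q : u n * Re s <= u n * x + Rabs (u n) * rho).
    { assert (Q : u n * (Re s - x) <= Rabs (u n) * rho); [|lra].
      eapply Rle_trans; [apply Rle_abs|]. rewrite Rabs_mult. apply Rmult_le_compat_l; auto. apply Rabs_pos. }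
    destruct Q as [Q|Q]; [apply Rlt_le, exp_increasing; auto|rewrite Q; lra]. }
  set (y := fun n => (c n * Cexp (RtoC (u n) * s) * (cis (u n * tau) - cis (th n)))%C).
  assert (Hyb : forall n, Cmod (y n) <= 2 * b n).
  { intros n. unfold y. rewrite Cmod_mult, Rmult_comm. apply Rmult_le_compat; auto using Cmod_ge_0.
    eapply Rle_trans; [apply Cmod_triangle|]. rewrite Cmod_opp, !Cmod_cis. lra. }
  assert (Hy : Csummable y) by (apply Csummable_dom with (fun n => 2 * b n); auto; apply ex_series_scal_R; auto).
  assert (Hs0 : Csummable (fun n => c n * Cexp (RtoC (u n) * s))%C) by (apply Csummable_dom with b; auto).
  assert (E : (DS c u (s + Ci * RtoC tau) - DS c' u s)%C = CSer y).
  { unfold DS. rewrite <- CSer_minus.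
    - apply CSer_ext. intros n. unfold y. rewrite Hc'.
      replace (RtoC (u n) * (s + Ci * RtoC tau))%C with (RtoC (u n) * s + RtoC (u n) * (0, tau))%C
        by (rewrite (Cpair 0 tau); ring).
      rewrite Cexp_plus, Cexp_line, Rmult_0_r, exp_0. ring.
    - apply Csummable_ext with (fun n => cis (u n * tau) * (c n * Cexp (RtoC (u n) * s)))%C.
      + intros n. replace (RtoC (u n) * (s + Ci * RtoC tau))%C with (RtoC (u n) * s + RtoC (u n) * (0, tau))%C
        by (rewrite (Cpair 0 tau); ring).
        rewrite Cexp_plus, Cexp_line, Rmult_0_r, exp_0. ring.
      + apply Csummable_dom with b; auto. intros n. rewrite Cmod_mult, Cmod_cis, Rmult_1_l; auto.
    - apply Csummable_dom with b; auto. intros n. rewrite Hc'.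
      replace (c n * cis (th n) * Cexp (RtoC (u n) * s))%C with (cis (th n) * (c n * Cexp (RtoC (u n) * s)))%C by ring.
      rewrite Cmod_mult, Cmod_cis, Rmult_1_l; auto. }
  rewrite E, (CSer_split y N Hy). eapply Rle_trans; [apply Cmod_triangle|].
  assert (K1 : Cmod (Csum N y) <= e / 2).
  { eapply Rle_trans; [apply Cmod_Csum|]. apply Rle_trans with (Rsum N (fun n => del * b n)).
    - apply Rsum_le. intros n Hn. unfold y. destruct (classic (c n = RtoC 0)) as [Ec|Ec].
      + rewrite Ec. replace (RtoC 0 * Cexp (RtoC (u n) * s) * (cis (u n * tau) - cis (th n)))%C with (RtoC 0) by ring.
        rewrite Cmod_0. apply Rmult_le_pos; auto; lra.
      + rewrite Cmod_mult, Rmult_comm. apply Rmult_le_compat; auto using Cmod_ge_0.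
    - rewrite Rsum_scal. apply Rle_trans with (del * (Series b + 1)).
      + apply Rmult_le_compat_l; [lra|]. assert (K := Rsum_le_Series b N Hb0 Hb). lra.
      + unfold del. right. field. lra. }
  assert (K2 : Cmod (CSer (fun n => y (N + n)%nat)) <= 2 * Series (fun n => b (N + n)%nat)).
  { rewrite <- Series_scal_l. apply CSer_bound; [intros; apply Hyb|].
    apply ex_series_scal_R, ex_series_shift; auto. }
  assert (K3 := Rle_abs (Series (fun n => b (N + n)%nat))). lra.
Qed.

(** Hurwitz's theorem for translates of the first series tending to the second. Leading terms are
    needed at abscissas up to [r] from [x], each using [4 * r], hence [5 * r]. The zero series,
    which has no leading term, is treated apart. *)
Theorem DS_equivalent_values (L : R -> Prop) c c' u th x t r : Q_lin_indep L -> distinct c u ->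
  (forall n, c n <> RtoC 0 -> L (u n)) -> (forall n, c' n = (c n * cis (th n))%C) -> 0 < r ->
  Dconv_near c u x (5 * r) ->
  exists s, Rabs (Re s - x) <= r /\ DS c u s = DS c' u (x, t).
Proof.
  intros HL Hd Hu Hc' Hr Hc.
  destruct (classic (exists n, c n <> RtoC 0)) as [[n0 Hn0]|Hz].
  - assert (Hu0 : u n0 <> 0).
    { intros E. apply (Q_indep_0 L HL). rewrite <- E. auto. }
    assert (Hmod : forall n, Cmod (c' n) = Cmod (c n)).
    { intros n. rewrite Hc', Cmod_mult, Cmod_cis; ring. }
    assert (Hz' : forall n, c' n <> RtoC 0 -> c n <> RtoC 0).
    { intros n H E. apply H. rewrite Hc', E. ring. }
    destruct (Hurwitz (DS c u) (DS c' u) (x, t) r Hr) as [s [H1 H2]].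
    + apply DS_leading_term with r n0; auto.
      * intros y Hy. change (Re (x, t)) with x in Hy.
        apply ex_series_ext with (fun n => Cmod (c n) * exp (u n * y)); [intros; rewrite Hmod; auto|].
        apply Hc. lra.
      * intros n m Hnm A B. apply Hd; auto.
      * intros E. apply Hn0. apply Cmod_eq_0. rewrite <- Hmod, E, Cmod_0; auto.
    + intros s Hs. change (Re (x, t)) with x in Hs. apply DS_leading_term with r n0; auto.
      intros y Hy. apply Hc. replace (y - x) with ((y - Re s) + (Re s - x)) by ring.
      eapply Rle_trans; [apply Rabs_triang|]. lra.
    + change (Re (x, t)) with x. apply (DS_translation_approx L c c' u th x r); auto.
      apply Dconv_near_sub with (5 * r); auto. lra.
    + exists s. split; auto.
  - assert (Hc0 : forall n, c n = RtoC 0).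
    { intros n. apply NNPP. intros H. apply Hz. exists n; auto. }
    exists (x, t). split.
    + change (Re (x, t)) with x. replace (x - x) with 0 by ring. rewrite Rabs_R0; lra.
    + apply DS_ext. intros n. rewrite Hc', Hc0. ring.
Qed.

(** * Dirichlet series of almost periodic functions with independent exponents *)

(** The enumeration may repeat values; only first occurrences carry a coefficient. *)
Definition first_occurrence (w : nat -> R) (n : nat) : Prop := forall m, (m < n)%nat -> w m <> w n.

Definition seq_coef (w : nat -> R) (a : R -> C) (n : nat) : C :=
  if excluded_middle_informative (first_occurrence w n) then a (w n) else RtoC 0.

Lemma first_occurrence_distinct w c : (forall n, c n <> RtoC 0 -> first_occurrence w n) -> distinct c w.
Proof.
  intros H n m Hnm Hn Hm E. destruct (Nat.lt_total n m) as [K|[K|K]]; auto.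
  - apply (H m Hm n K E).
  - apply (H n Hn m K). auto.
Qed.

Lemma seq_coef_first w a n : seq_coef w a n <> RtoC 0 -> first_occurrence w n.
Proof.
  unfold seq_coef. destruct (excluded_middle_informative (first_occurrence w n)); auto. intros []; auto.
Qed.

Lemma seq_coef_eq w a n : seq_coef w a n <> RtoC 0 -> seq_coef w a n = a (w n).
Proof.
  unfold seq_coef. destruct (excluded_middle_informative (first_occurrence w n)); auto. intros []; auto.
Qed.

Lemma first_occurrence_exists (w : nat -> R) nu : (exists n, w n = nu) -> exists n, w n = nu /\ first_occurrence w n.
Proof.
  intros H. destruct (least_nat _ H) as [n [H1 H2]]. exists n. split; auto.
  intros m Hm E. apply (H2 m Hm). congruence.
Qed.

Lemma seq_coef_at w a n : first_occurrence w n -> seq_coef w a n = a (w n).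
Proof. intros H. unfold seq_coef. destruct (excluded_middle_informative (first_occurrence w n)); tauto. Qed.

(** [w] enumerates, possibly with repetitions and superfluous values, the exponents of [f]. *)
Definition independent_exponents (alpha beta : Rbar) (f : C -> C) (L : R -> Prop) (w : nat -> R) : Prop :=
  Rbar_lt alpha beta /\ AP alpha beta f /\ Q_lin_indep L /\
  forall nu, fourier_coef alpha beta f nu <> RtoC 0 -> L nu /\ exists n, w n = nu.

Definition exponent_coef (alpha beta : Rbar) (f : C -> C) (w : nat -> R) : nat -> C :=
  seq_coef w (fourier_coef alpha beta f).

(** On the line of abscissa [x] the Fourier coefficients carry the weight [exp (w n * x)]. Keeping
    [B] arbitrary gives absolute convergence and, later, the lower bound for the supremum. *)
Lemma AP_coef_sum_bound alpha beta f L w x B N : independent_exponents alpha beta f L w -> in_strip alpha beta x -> (forall t, Cmod (f (x, t)) <= B) ->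
  Rsum N (fun n => Cmod (exponent_coef alpha beta f w n) * exp (w n * x)) <= B.
Proof.
  intros [Hab [Hf [HL Ha]]] Hx HB.
  set (a := fourier_coef alpha beta f) in *. set (c := exponent_coef alpha beta f w).
  set (b := fun n => (RtoC (exp (w n * x)) * c n)%C).
  assert (Hb : forall n, b n <> RtoC 0 -> c n <> RtoC 0).
  { intros n H E. apply H. unfold b. rewrite E. ring. }
  rewrite (Rsum_ext N _ (fun n => Cmod (b n))).
  - apply (Bohr_coefficient_bound L (fun t => f (x, t)) (fun nu => RtoC (exp (nu * x)) * a nu)%C b w B HL).
    + apply (AP_line_CAP alpha beta); auto.
    + intros nu. apply (fourier_coef_mean alpha beta); auto.
    + intros nu H. apply Ha. intros E. apply H. rewrite E. ring.
    + auto.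
    + apply first_occurrence_distinct. intros n H. apply (seq_coef_first w a), Hb, H.
    + intros n H. unfold b, c, exponent_coef. rewrite seq_coef_eq; [reflexivity|]. apply (Hb n H).
  - intros n _. unfold b. rewrite Cmod_mult, Cmod_R, Rabs_pos_eq by (apply Rlt_le, exp_pos). ring.
Qed.

Lemma AP_Dconv alpha beta f L w x : independent_exponents alpha beta f L w -> in_strip alpha beta x -> Dconv (exponent_coef alpha beta f w) w x.
Proof.
  intros Hi Hx. assert (Hf := proj1 (proj2 Hi)). destruct (TB_bounded _ (proj2 (AP_line_CAP alpha beta f x Hf Hx))) as [B [_ HB]].
  apply bounded_partial_sums with B.
  - intros n. apply Rmult_le_pos; [apply Cmod_ge_0|apply Rlt_le, exp_pos].
  - intros N. apply AP_coef_sum_bound with L; auto.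
Qed.

(** On each line both sides have the same Fourier coefficients, so their difference vanishes by
    [CAP_zero_means]. A frequency that recurs in [w] is counted once, at its first occurrence. *)
Lemma AP_eq_DS alpha beta f L w x t : independent_exponents alpha beta f L w -> in_strip alpha beta x -> f (x, t) = DS (exponent_coef alpha beta f w) w (x, t).
Proof.
  intros Hi Hx. assert (HD := AP_Dconv alpha beta f L w x Hi Hx). destruct Hi as [Hab [Hf [HL Ha]]].
  set (a := fourier_coef alpha beta f) in *. set (c := exponent_coef alpha beta f w) in *.
  set (b := fun n => (c n * RtoC (exp (w n * x)))%C).
  assert (Hb : Csummable b) by (apply Dconv_line; auto).
  assert (Hl := AP_line_CAP alpha beta f x Hf Hx).
  assert (Ht := CAP_trig_series b w Hb).
  set (g := fun t => (f (x, t) + RtoC (-1) * trig_series b w t)%C).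
  assert (Hg : CAP g) by (apply CAP_plus; auto; apply CAP_mult; auto; apply CAP_const).
  assert (Hz : forall nu, is_mean (twist g nu) (RtoC 0)).
  { intros nu.
    apply mean_ext with (fun t => twist (fun t => f (x, t)) nu t + RtoC (-1) * twist (trig_series b w) nu t)%C.
    { intros s. unfold twist, g. ring. }
    assert (M1 := fourier_coef_mean alpha beta f nu x Hab Hf Hx).
    assert (M2 := trig_series_mean b w nu Hb).
    assert (E : CSer (select w b nu) = (RtoC (exp (nu * x)) * a nu)%C).
    { destruct (classic (exists n, w n = nu)) as [Hex|Hno].
      - destruct (first_occurrence_exists w nu Hex) as [n [Hn Hfo]].
        rewrite (CSer_single _ n (select_summable w b nu Hb)).
        + unfold select. destruct (Req_EM_T (w n) nu); [|contradiction].
          unfold b, c, exponent_coef. rewrite seq_coef_at, Hn by auto. fold a. ring.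
        + intros m Hm. unfold select. destruct (Req_EM_T (w m) nu) as [E|E]; auto.
          unfold b. destruct (classic (c m = RtoC 0)) as [E2|E2]; [rewrite E2; ring|].
          exfalso. apply (seq_coef_first w a) in E2. destruct (Nat.lt_total n m) as [K|[K|K]].
          * apply (E2 n K). congruence.
          * auto.
          * apply (Hfo m K). congruence.
      - rewrite CSer_0.
        + replace (a nu) with (RtoC 0); [ring|].
          apply NNPP. intros H. apply Hno, Ha. auto.
        + intros n. unfold select. destruct (Req_EM_T (w n) nu) as [E|E]; auto. exfalso. eauto. }
    rewrite E in M2.
    replace (RtoC 0) with (RtoC (exp (nu * x)) * a nu +
       RtoC (-1) * (RtoC (exp (nu * x)) * a nu))%C by (rewrite RtoC_m1; ring).
    apply mean_plus; auto.
    - apply Ccont_twist, Hl.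
    - apply Ccont_mult; [apply Ccont_const|apply Ccont_twist, Ht].
    - apply mean_scal; auto. apply Ccont_twist, Ht. }
  assert (K := CAP_zero_means g Hg Hz t). unfold g in K.
  rewrite DS_line. fold b.
  replace (f (x, t)) with ((f (x, t) + RtoC (-1) * trig_series b w t) + trig_series b w t)%C by (rewrite RtoC_m1; ring).
  rewrite K. ring.
Qed.

Lemma AP_modulus_le_Dnorm alpha beta f L w x t : independent_exponents alpha beta f L w -> in_strip alpha beta x -> Cmod (f (x, t)) <= Dnorm (exponent_coef alpha beta f w) w x.
Proof.
  intros Hi Hx. rewrite (AP_eq_DS alpha beta f L w) by auto. apply CSer_bound.
  - intros n. rewrite Cmod_DS_term. apply Rle_refl.
  - apply (AP_Dconv alpha beta f L w); auto.
Qed.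

(** Otherwise [Dnorm - e] would bound the modulus on the line, and hence by Bohr's inequality all
    partial sums of the series with sum [Dnorm]. *)
Lemma AP_modulus_near_Dnorm alpha beta f L w x e : independent_exponents alpha beta f L w -> in_strip alpha beta x -> 0 < e -> exists t, Dnorm (exponent_coef alpha beta f w) w x - e < Cmod (f (x, t)).
Proof.
  intros Hi Hx He. set (c := exponent_coef alpha beta f w). apply NNPP. intros Hno.
  assert (HB : forall t, Cmod (f (x, t)) <= Dnorm c w x - e).
  { intros t. apply Rnot_lt_le. intros H. apply Hno. exists t; auto. }
  assert (HD := AP_Dconv alpha beta f L w x Hi Hx).
  destruct (Series_tail _ e HD He) as [N HN]. specialize (HN N (Nat.le_refl N)). fold c in HN.
  assert (K := AP_coef_sum_bound alpha beta f L w x _ N Hi Hx HB).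
  fold c in HD, K. unfold Dnorm in K. rewrite (Series_split _ N HD) in K.
  assert (K2 := Rle_abs (Series (fun n => Cmod (c (N + n)%nat) * exp (w (N + n)%nat * x)))). lra.
Qed.

Lemma CSer_RtoC (p : nat -> R) : CSer (fun n => RtoC (p n)) = RtoC (Series p).
Proof. unfold CSer. simpl. apply C_ext; simpl; [reflexivity|apply Series_zero]. Qed.

(** [Dnorm] thereby becomes a Dirichlet series restricted to the real axis, so Taylor's formula
    gives its continuity and the identity theorem recovers its coefficients. *)
Lemma DS_real_coef (p : nat -> R) u y : DS (fun n => RtoC (p n)) u (y, 0) = RtoC (Series (fun n => p n * exp (u n * y))).
Proof.
  rewrite <- CSer_RtoC. apply CSer_ext. intros n. rewrite Cexp_line, Rmult_0_r, cis_0, RtoC_mult. ring.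
Qed.

Lemma Dnorm_continuous c u x r e : 0 < r -> Dconv_near c u x (2 * r) -> 0 < e ->
  exists d, 0 < d /\ forall y, Rabs (y - x) < d -> Rabs (Dnorm c u y - Dnorm c u x) < e.
Proof.
  intros Hr Hc He.
  set (c' := fun n => RtoC (Cmod (c n))).
  assert (E : forall y, DS c' u (y, 0) = RtoC (Dnorm c u y)) by (intros; apply (DS_real_coef (fun n => Cmod (c n)))).
  assert (Hc' : Dconv_near c' u x (2 * r)).
  { intros y Hy. apply ex_series_ext with (2 := Hc y Hy). intros n. unfold c'.
    rewrite Cmod_R, Rabs_pos_eq; auto. apply Cmod_ge_0. }
  set (B := Rabs (Dnorm c' u (x + 2 * r) + Dnorm c' u (x - 2 * r))).
  assert (HB : 0 <= B) by apply Rabs_pos.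
  exists (Rmin r (e * r / (B + 1))). split.
  { apply Rmin_pos; auto. apply Rdiv_lt_0_compat; [apply Rmult_lt_0_compat; auto|lra]. }
  intros y Hy. assert (Y1 := Rlt_le_trans _ _ _ Hy (Rmin_l _ _)). assert (Y2 := Rlt_le_trans _ _ _ Hy (Rmin_r _ _)).
  assert (T := DS_Taylor_near c' u (x, 0) (RtoC (y - x)) r 0 Hr Hc' ltac:(rewrite Cmod_R; lra)).
  simpl Csum in T. rewrite (DS_ext (dcoef c' u 0) c') in T by (intros; apply dcoef_0).
  replace ((x, 0) + RtoC (y - x))%C with (y, 0) in T by (apply C_ext; simpl; ring).
  rewrite !E, Cmod_R in T.
  replace (RtoC (Dnorm c u y) - (RtoC 0 + exp_term (RtoC (y - x)) 0 * RtoC (Dnorm c u x)))%C with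
    (RtoC (Dnorm c u y - Dnorm c u x)) in T.
  2:{ unfold exp_term. simpl. rewrite Rinv_1, RtoC_minus. ring. }
  rewrite Cmod_R in T. eapply Rle_lt_trans; [exact T|].
  change (Re (x, 0)) with x. rewrite pow_1.
  apply Rle_lt_trans with (Rabs (y - x) / r * B).
  { apply Rmult_le_compat_l; [|apply Rle_abs]. apply Rmult_le_pos; [apply Rabs_pos|apply Rlt_le, Rinv_0_lt_compat; auto]. }
  apply Rmult_lt_compat_r with (r := B + 1) in Y2; [|lra].
  replace (e * r / (B + 1) * (B + 1)) with (e * r) in Y2 by (field; lra).
  apply Rmult_lt_reg_r with r; auto.
  replace (Rabs (y - x) / r * B * r) with (Rabs (y - x) * B) by (field; lra).
  assert (P := Rabs_pos (y - x)). nra.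
Qed.

(** The difference of the two norms is a Dirichlet series with coefficients
    [Cmod (c1 n) - Cmod (c2 n)] that vanishes on a real interval, hence has vanishing derivatives at
    [x] and vanishing coefficients. *)
Lemma Dnorm_eq_moduli c1 c2 u x r d : 0 < r -> 0 < d ->
  (forall n, c1 n <> RtoC 0 -> first_occurrence u n) -> (forall n, c2 n <> RtoC 0 -> first_occurrence u n) ->
  Dconv_near c1 u x (3 * r) -> Dconv_near c2 u x (3 * r) ->
  (forall y, Rabs (y - x) < d -> Dnorm c1 u y = Dnorm c2 u y) ->
  forall n, Cmod (c1 n) = Cmod (c2 n).
Proof.
  intros Hr Hd F1 F2 H1 H2 HE n.
  set (p := fun n => Cmod (c1 n) - Cmod (c2 n)). set (c := fun n => RtoC (p n)).
  assert (Hc : Dconv_near c u x (3 * r)).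
  { intros y Hy. apply ex_series_dom with (fun n => Cmod (c1 n) * exp (u n * y) + Cmod (c2 n) * exp (u n * y)).
    - intros m. rewrite Rabs_mult, (Rabs_pos_eq (exp _)) by apply Rlt_le, exp_pos.
      rewrite <- Rmult_plus_distr_r. apply Rmult_le_compat_r; [apply Rlt_le, exp_pos|].
      rewrite Rabs_pos_eq by apply Cmod_ge_0. unfold c, p. rewrite Cmod_R.
      assert (P1 := Cmod_ge_0 (c1 m)). assert (P2 := Cmod_ge_0 (c2 m)). apply Rabs_le. lra.
    - exact (ex_series_plus _ _ (H1 y Hy) (H2 y Hy)). }
  assert (K : c n = RtoC 0).
  { apply (DS_derivatives_zero c u x 0 r Hr Hc).
    - apply first_occurrence_distinct. intros m Hm. destruct (classic (c1 m = RtoC 0)) as [E1|E1]; auto.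
      apply F2. intros E2. apply Hm. unfold c, p. rewrite E1, E2. f_equal. ring.
    - apply (DS_zero_on_reals c u x 0 r (Rmin d (3 * r))); auto.
      + apply Rmin_pos; lra.
      + apply Dconv_near_sub with (3 * r); auto. lra.
      + intros y Hy. assert (Y1 := Rlt_le_trans _ _ _ Hy (Rmin_l _ _)). assert (Y2 := Rlt_le_trans _ _ _ Hy (Rmin_r _ _)).
        unfold c. rewrite DS_real_coef. f_equal.
        assert (E : Series (fun n => p n * exp (u n * y)) = Dnorm c1 u y - Dnorm c2 u y).
        { unfold Dnorm. rewrite <- Series_minus by (apply H1 || apply H2; lra).
          apply Series_ext. intros m. unfold p. ring. }
        rewrite E, HE by auto. ring. }
  apply RtoC_inj in K. unfold p in K. lra.
Qed.

(** * Comparison of the values of the two functions *)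

Lemma in_strip_ball alpha beta x : in_strip alpha beta x ->
  exists d, 0 < d /\ forall y, Rabs (y - x) <= d -> in_strip alpha beta y.
Proof.
  intros [H1 H2].
  assert (K1 : exists d, 0 < d /\ forall y, Rabs (y - x) <= d -> Rbar_lt alpha y).
  { destruct alpha as [a| |]; simpl in *; try contradiction.
    - exists ((x - a) / 2). split; [lra|]. intros y Hy. apply Rabs_le_between in Hy. lra.
    - exists 1. split; [lra|auto]. }
  assert (K2 : exists d, 0 < d /\ forall y, Rabs (y - x) <= d -> Rbar_lt y beta).
  { destruct beta as [b| |]; simpl in *; try contradiction.
    - exists ((b - x) / 2). split; [lra|]. intros y Hy. apply Rabs_le_between in Hy. lra.
    - exists 1. split; [lra|auto]. }
  destruct K1 as [d1 [P1 Q1]]. destruct K2 as [d2 [P2 Q2]].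
  exists (Rmin d1 d2). split; [apply Rmin_pos; auto|]. intros y Hy. split.
  - apply Q1. eapply Rle_trans; [exact Hy|apply Rmin_l].
  - apply Q2. eapply Rle_trans; [exact Hy|apply Rmin_r].
Qed.

Lemma AP_Dconv_near alpha beta f L w x r : independent_exponents alpha beta f L w ->
  (forall y, Rabs (y - x) <= r -> in_strip alpha beta y) -> Dconv_near (exponent_coef alpha beta f w) w x r.
Proof. intros Hi H y Hy. apply AP_Dconv with L; auto. Qed.

(** A value of [f2] on the line at [x] of nearly maximal modulus is a value of [f1] only at some
    nearby abscissa [y], so it is bounded by the norm at [y]. Continuity of [Dnorm] brings the bound
    back to [x]. *)
Lemma Dnorm_le_of_values alpha1 beta1 f1 L1 alpha2 beta2 f2 L2 w x d0 :
  independent_exponents alpha1 beta1 f1 L1 w -> independent_exponents alpha2 beta2 f2 L2 w ->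
  in_strip alpha1 beta1 x -> in_strip alpha2 beta2 x -> 0 < d0 ->
  (forall d, 0 < d <= d0 -> forall z, (exists y, Rabs (y - x) < d /\ Img f2 y z) ->
     exists y, Rabs (y - x) < d /\ Img f1 y z) ->
  Dnorm (exponent_coef alpha2 beta2 f2 w) w x <= Dnorm (exponent_coef alpha1 beta1 f1 w) w x.
Proof.
  intros I1 I2 S1 S2 Hd0 Himg. set (c1 := exponent_coef alpha1 beta1 f1 w). set (c2 := exponent_coef alpha2 beta2 f2 w).
  apply Rnot_lt_le. intros Hlt. set (e := (Dnorm c2 w x - Dnorm c1 w x) / 2). assert (He : 0 < e) by (unfold e; lra).
  destruct (in_strip_ball alpha1 beta1 x S1) as [d1 [Hd1 B1]].
  destruct (Dnorm_continuous c1 w x (d1 / 2) e) as [d2 [Hd2 B2]]; [lra| |auto|].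
  { apply (AP_Dconv_near alpha1 beta1 f1 L1); auto. intros y Hy. apply B1. lra. }
  destruct (AP_modulus_near_Dnorm alpha2 beta2 f2 L2 w x e I2 S2 He) as [t Ht]. fold c2 in Ht.
  set (d := Rmin d0 (Rmin d1 d2)). assert (Hd : 0 < d) by (repeat apply Rmin_pos; auto).
  assert (D0 : d <= d0) by apply Rmin_l. assert (D : d <= Rmin d1 d2) by apply Rmin_r.
  assert (D1 := Rle_trans _ _ _ D (Rmin_l _ _)). assert (D2 := Rle_trans _ _ _ D (Rmin_r _ _)).
  destruct (Himg d (conj Hd D0) (f2 (x, t))) as [y [Hy [t' Ht']]].
  { exists x. split; [replace (x - x) with 0 by ring; rewrite Rabs_R0; auto|exists t; auto]. }
  assert (K := AP_modulus_le_Dnorm alpha1 beta1 f1 L1 w y t' I1 (B1 y ltac:(lra))). rewrite Ht' in K. fold c1 in K.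
  specialize (B2 y ltac:(lra)). apply Rabs_def2 in B2. unfold e in *. lra.
Qed.

Lemma open_ball_R x d : open (fun y => Rabs (y - x) < d).
Proof.
  intros y Hy. assert (H : 0 < d - Rabs (y - x)) by lra. exists (mkposreal _ H). intros z Hz.
  change (Rabs (z - y) < d - Rabs (y - x)) in Hz.
  replace (z - x) with ((z - y) + (y - x)) by ring. eapply Rle_lt_trans; [apply Rabs_triang|]. lra.
Qed.

Lemma equivalent_images a1 b1 f1 a2 b2 f2 L w (th : R -> R) (E : R -> Prop) x z :
  independent_exponents a1 b1 f1 L w -> independent_exponents a2 b2 f2 L w ->
  (forall nu, fourier_coef a2 b2 f2 nu = (fourier_coef a1 b1 f1 nu * cis (th nu))%C) ->
  open E -> E x -> in_strip a1 b1 x -> in_strip a2 b2 x -> Img f2 x z ->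
  exists y, E y /\ Img f1 y z.
Proof.
  intros I1 I2 Hco HE Hx S1 S2 [t Ht].
  destruct (HE x Hx) as [d1 Hd1]. destruct (in_strip_ball a1 b1 x S1) as [d2 [Hd2 B2]].
  (* The first bound keeps the abscissa found within [E]; the second gives the [5 * r] of
     convergence required by [DS_equivalent_values]. *)
  set (r := Rmin (d1 / 2) (d2 / 5)).
  assert (Hr : 0 < r) by (apply Rmin_pos; [generalize (cond_pos d1)|]; lra).
  assert (R1 : r <= d1 / 2) by apply Rmin_l. assert (R2 : r <= d2 / 5) by apply Rmin_r.
  destruct (DS_equivalent_values L (exponent_coef a1 b1 f1 w) (exponent_coef a2 b2 f2 w) w (fun n => th (w n)) x t r)
    as [s [Hs Hval]]; auto.
  - apply I1.
  - apply first_occurrence_distinct. intros n. apply seq_coef_first.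
  - intros n Hn. unfold exponent_coef in Hn. apply I1. rewrite <- (seq_coef_eq w _ n); auto.
  - intros n. unfold exponent_coef, seq_coef. destruct (excluded_middle_informative (first_occurrence w n)); auto. ring.
  - apply (AP_Dconv_near a1 b1 f1 L); auto. intros y Hy. apply B2. lra.
  - exists (Re s). split.
    + apply Hd1. change (Rabs (Re s - x) < d1). generalize (cond_pos d1). lra.
    + exists (Im s). rewrite (AP_eq_DS a1 b1 f1 L w) by (auto; apply B2; lra).
      replace (Re s, Im s) with s by (destruct s; auto).
      rewrite Hval, <- (AP_eq_DS a2 b2 f2 L w) by auto. auto.
Qed.

Lemma Q_lin_indep_ext (L L' : R -> Prop) : (forall x, L x <-> L' x) -> Q_lin_indep L -> Q_lin_indep L'.
Proof.
  intros E H l H1 H2 H3. apply H; auto. apply List.Forall_impl with (2 := H2). intros x. apply E.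
Qed.

(** Both functions are expanded along one common enumeration, so that their coefficients can be
    compared index by index before the two sets of exponents are known to agree. *)
Lemma countable_union (L1 L2 : R -> Prop) : countable_set L1 -> countable_set L2 ->
  exists w : nat -> R, forall x, L1 x \/ L2 x -> exists n, w n = x.
Proof.
  intros [u1 H1] [u2 H2]. exists (fun n => if Nat.even n then u1 (Nat.div2 n) else u2 (Nat.div2 n)).
  intros x [Hx|Hx].
  - destruct (H1 x Hx) as [n Hn]. exists (2 * n)%nat. rewrite Nat.even_even, Nat.div2_double. auto.
  - destruct (H2 x Hx) as [n Hn]. exists (S (2 * n)).
    rewrite Nat.even_succ, Nat.div2_succ_double, Nat.odd_even. auto.
Qed.

Lemma Cexp_Ci x : Cexp (Ci * RtoC x) = cis x.
Proof.
  replace (Ci * RtoC x)%C with (RtoC x * (0, 1))%C by (unfold Ci; ring).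
  rewrite Cexp_line, Rmult_0_r, Rmult_1_r, exp_0. ring.
Qed.

Lemma equal_moduli_phase (z z' : C) : Cmod z = Cmod z' -> exists th, z' = (z * cis th)%C.
Proof.
  intros E. destruct (unit_phase z) as [t1 H1]. destruct (unit_phase z') as [t2 H2]. rewrite <- E, <- H1 in H2.
  exists (t1 - t2). unfold Rminus. rewrite cis_plus.
  transitivity (cis t2 * cis (- t2) * z')%C; [rewrite cis_opp_r; ring|].
  transitivity (cis (- t2) * (cis t2 * z'))%C; [ring|]. rewrite H2. ring.
Qed.

Theorem theorem12
  (alpha1 beta1 alpha2 beta2 : Rbar)
  (hU1 : Rbar_lt alpha1 beta1) (hU2 : Rbar_lt alpha2 beta2)
  (hU : exists s : C, strip alpha1 beta1 s /\ strip alpha2 beta2 s)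
  (Lambda1 Lambda2 : R -> Prop)
  (hcount1 : countable_set Lambda1) (hcount2 : countable_set Lambda2)
  (hind1 : Q_lin_indep Lambda1) (hind2 : Q_lin_indep Lambda2)
  (f1 f2 : C -> C)
  (hf1 : AP alpha1 beta1 f1) (hf2 : AP alpha2 beta2 f2)
  (hexp1 : forall lambda : R,
     fourier_exponent alpha1 beta1 f1 lambda <-> Lambda1 lambda)
  (hexp2 : forall lambda : R,
     fourier_exponent alpha2 beta2 f2 lambda <-> Lambda2 lambda) :
  Bohr_equiv alpha1 beta1 f1 alpha2 beta2 f2 <->
  exists alpha beta : Rbar,
    Rbar_lt alpha beta /\
    (forall sigma : R, Rbar_lt alpha sigma -> Rbar_lt sigma beta ->
       (Rbar_lt alpha1 sigma /\ Rbar_lt sigma beta1) /\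
       (Rbar_lt alpha2 sigma /\ Rbar_lt sigma beta2)) /\
    (forall E : R -> Prop,
       open E ->
       (forall sigma : R, E sigma ->
          Rbar_lt alpha sigma /\ Rbar_lt sigma beta) ->
       forall w : C,
         (exists sigma : R, E sigma /\ Img f1 sigma w) <->
         (exists sigma : R, E sigma /\ Img f2 sigma w)).
Proof.
  destruct (countable_union Lambda1 Lambda2 hcount1 hcount2) as [w hw].
  assert (I1 : independent_exponents alpha1 beta1 f1 Lambda1 w).
  { refine (conj hU1 (conj hf1 (conj hind1 _))). intros nu H. apply hexp1 in H. split; auto. }
  assert (I2 : independent_exponents alpha2 beta2 f2 Lambda2 w).
  { refine (conj hU2 (conj hf2 (conj hind2 _))). intros nu H. apply hexp2 in H. split; auto. }
  split.
  - intros [Hexp [psi [_ Hpsi]]].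
    (* Outside the common set of exponents both coefficients are zero, so the relation holds at
       every real [nu]. *)
    assert (Hco : forall nu, fourier_coef alpha2 beta2 f2 nu = (fourier_coef alpha1 beta1 f1 nu * cis (psi nu))%C).
    { intros nu. destruct (classic (fourier_exponent alpha1 beta1 f1 nu)) as [H|H].
      - rewrite Hpsi by auto. rewrite Cexp_Ci. reflexivity.
      - assert (H2 : ~ fourier_exponent alpha2 beta2 f2 nu) by (rewrite <- Hexp; auto).
        apply NNPP in H. apply NNPP in H2. rewrite H, H2. ring. }
    assert (Hco' : forall nu, fourier_coef alpha1 beta1 f1 nu = (fourier_coef alpha2 beta2 f2 nu * cis (- psi nu))%C).
    { intros nu. rewrite Hco, <- Cmult_assoc, cis_opp_r. ring. }
    assert (I2' : independent_exponents alpha2 beta2 f2 Lambda1 w).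
    { refine (conj hU2 (conj hf2 (conj hind1 _))). intros nu H. split; [apply hexp1, Hexp; auto|apply I2; auto]. }
    (* The interval may be any ball inside both strips; it is centred at the abscissa of a common
       point. *)
    destruct hU as [s [[A1 A2] [A3 A4]]].
    destruct (in_strip_ball alpha1 beta1 (Re s) (conj A1 A2)) as [d1 [Hd1 B1]].
    destruct (in_strip_ball alpha2 beta2 (Re s) (conj A3 A4)) as [d2 [Hd2 B2]].
    set (d := Rmin d1 d2). assert (Hd : 0 < d) by (apply Rmin_pos; auto).
    assert (D1 : d <= d1) by apply Rmin_l. assert (D2 : d <= d2) by apply Rmin_r.
    assert (Hin : forall sigma, Re s - d < sigma -> sigma < Re s + d ->
      in_strip alpha1 beta1 sigma /\ in_strip alpha2 beta2 sigma).
    { intros sigma H1 H2. assert (Rabs (sigma - Re s) <= d) by (apply Rabs_le; lra).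
      split; [apply B1|apply B2]; lra. }
    exists (Finite (Re s - d)), (Finite (Re s + d)). split; [simpl; lra|]. split; [exact Hin|].
    intros E HE HEin z. split; intros [x [Hx Him]].
    + destruct (HEin x Hx) as [C1 C2]. destruct (Hin x C1 C2) as [S1 S2].
      apply (equivalent_images alpha2 beta2 f2 alpha1 beta1 f1 Lambda1 w (fun nu => - psi nu) E x z); auto.
    + destruct (HEin x Hx) as [C1 C2]. destruct (Hin x C1 C2) as [S1 S2].
      apply (equivalent_images alpha1 beta1 f1 alpha2 beta2 f2 Lambda1 w psi E x z); auto.
  - intros [alpha [beta [Hab [Hsub Himg]]]].
    set (c1 := exponent_coef alpha1 beta1 f1 w). set (c2 := exponent_coef alpha2 beta2 f2 w).
    (* The hypothesis on images is applied to small balls around [x] as the open sets, in both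
       directions. *)
    assert (Hnorm : forall x, in_strip alpha beta x -> Dnorm c1 w x = Dnorm c2 w x).
    { intros x Hx. destruct (Hsub x (proj1 Hx) (proj2 Hx)) as [S1 S2].
      destruct (in_strip_ball alpha beta x Hx) as [d0 [Hd0 B0]].
      assert (Hball : forall d, 0 < d <= d0 -> forall z,
        (exists y, Rabs (y - x) < d /\ Img f1 y z) <-> (exists y, Rabs (y - x) < d /\ Img f2 y z)).
      { intros d Hd z. apply (Himg (fun y => Rabs (y - x) < d) (open_ball_R x d)).
        intros y Hy. apply B0. lra. }
      apply Rle_antisym.
      - apply (Dnorm_le_of_values alpha2 beta2 f2 Lambda2 alpha1 beta1 f1 Lambda1 w x d0); auto.
        intros d Hd z. apply Hball; auto.
      - apply (Dnorm_le_of_values alpha1 beta1 f1 Lambda1 alpha2 beta2 f2 Lambda2 w x d0); auto.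
        intros d Hd z. apply Hball; auto. }
    destruct (in_strip_exists alpha beta Hab) as [x Hx].
    destruct (in_strip_ball alpha beta x Hx) as [d [Hd B]].
    assert (Hmod : forall n, Cmod (c1 n) = Cmod (c2 n)).
    { apply (Dnorm_eq_moduli c1 c2 w x (d / 3) d); try lra.
      - intros n. apply seq_coef_first.
      - intros n. apply seq_coef_first.
      - apply (AP_Dconv_near alpha1 beta1 f1 Lambda1); auto. intros y Hy.
        destruct (B y ltac:(lra)) as [C1 C2]. apply (Hsub y C1 C2).
      - apply (AP_Dconv_near alpha2 beta2 f2 Lambda2); auto. intros y Hy.
        destruct (B y ltac:(lra)) as [C1 C2]. apply (Hsub y C1 C2).
      - intros y Hy. apply Hnorm, B. lra. }
    assert (Hmodnu : forall nu, Cmod (fourier_coef alpha1 beta1 f1 nu) = Cmod (fourier_coef alpha2 beta2 f2 nu)).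
    { intros nu. destruct (classic (exists n, w n = nu)) as [Hex|Hno].
      - destruct (first_occurrence_exists w nu Hex) as [n [Hn Hfo]]. specialize (Hmod n).
        unfold c1, c2, exponent_coef in Hmod. rewrite !seq_coef_at, Hn in Hmod by auto. auto.
      - assert (E1 : fourier_coef alpha1 beta1 f1 nu = RtoC 0).
        { apply NNPP. intros H. apply Hno, I1. auto. }
        assert (E2 : fourier_coef alpha2 beta2 f2 nu = RtoC 0).
        { apply NNPP. intros H. apply Hno, I2. auto. }
        rewrite E1, E2. reflexivity. }
    split.
    (* Equal moduli already force the two sets of exponents to coincide. *)
    + intros nu. unfold fourier_exponent. rewrite !Cmod_gt_0, Hmodnu. tauto.
    (* A phase is chosen for each frequency separately, with no relation between them; independence
       is what allows these choices to be extended linearly. *)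
    + set (th := fun nu => epsilon (inhabits 0) (fun x =>
        fourier_coef alpha2 beta2 f2 nu = (fourier_coef alpha1 beta1 f1 nu * cis x)%C)).
      assert (Hth : forall nu, fourier_coef alpha2 beta2 f2 nu = (fourier_coef alpha1 beta1 f1 nu * cis (th nu))%C).
      { intros nu. apply (epsilon_spec (inhabits 0) (fun x =>
          fourier_coef alpha2 beta2 f2 nu = (fourier_coef alpha1 beta1 f1 nu * cis x)%C)).
        apply equal_moduli_phase, Hmodnu. }
      destruct (Q_linear_extension (fourier_exponent alpha1 beta1 f1) th) as [psi [H1 H2]].
      { apply Q_lin_indep_ext with Lambda1; auto. intros nu. symmetry. apply hexp1. }
      exists psi. split; auto. intros nu Hnu. rewrite Cexp_Ci, H2 by auto. apply Hth.
Qed.
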